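(* Let $n\in\{2,3\}$, let $\Omega\subset\mathbb{R}^n$ be a polyhedral domain with meshes $\mathcal{T}_h$ of mesh size $h$ consisting of $n$-cubes, and let $V_h$ be any one of the following spaces of piecewise polynomial vector fields on $\mathcal{T}_h$ (all defined in the context): (i) $V_h=[W_h]^n$, where $W_h$ is one of the 0-form spaces $\mathcal{G}_r^-\Lambda^0(\mathcal{T}_h)$ ($r\ge 3$), $\mathcal{A}_r\Lambda^0(\mathcal{T}_h)$ ($r\ge 3$), $\mathcal{A}_r^-\Lambda^0(\mathcal{T}_h)$ ($r\ge 3$) of the Hermite, Adini and trimmed-Adini complexes; (ii) $V_h$ is one of the 1-form spaces $\mathcal{G}_r^-\Lambda^1(\mathcal{T}_h)$ ($r\ge 3$), $\mathcal{A}_r\Lambda^1(\mathcal{T}_h)$ ($r\ge 2$), $\mathcal{A}_r^-\Lambda^1(\mathcal{T}_h)$ ($r\ge 3$) of the Hermite, Adini and trimmed-Adini complexes. Then there exists a constant $C>0$, independent of the mesh size $h$, such that $$\|v\|_{1,h}^2\le C\Big(\sum_{T\in\mathcal{T}_h}\|\epsilon(v)\|_{0,T}^2+\|v\|_{0,\Omega}^2\Big)\quad\forall v\in V_h,$$ $$\|v\|_{1,h}^2\le C\Big(\sum_{T\in\mathcal{T}_h}\|\epsilon(v)\|_{0,T}^2+\sum_{i=1}^n\int_{\partial\Omega}|v_i|^2\,ds\Big)\quad\forall v\in V_h,$$ $$\|v\|_{1,h}^2\le C\sum_{T\in\mathcal{T}_h}\|\epsilon(v)\|_{0,T}^2\quad\forall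 v\in V_h^0,$$ where $V_h^0$ is the subspace of $V_h$ of functions whose degrees of freedom on $\partial\Omega$ vanish.
   Context: Cubes are axis-parallel and meshes are conforming (face-to-face). $\epsilon(v)_{ij}=\tfrac12(\partial_iv_j+\partial_jv_i)$ is taken elementwise; $\|\cdot\|_{m,T}$ is the $H^m(T)$ norm and $\|v\|_{m,h}=(\sum_{T\in\mathcal{T}_h}\|v\|_{m,T}^2)^{1/2}$. Polynomial spaces. $\mathcal{P}_r$: total degree $\le r$. $\mathcal{P}_{r,s}$, $\mathcal{P}_{r,s,t}$: degree $\le r$ in $x$, $\le s$ in $y$ (and $\le t$ in $z$). $\mathcal{Q}_r=\mathcal{P}_{r,r}$ or $\mathcal{P}_{r,r,r}$. The superlinear degree of a monomial is the total degree of the variables that enter with power at least 2; $\mathcal{S}_r$ is the span of monomials of superlinear degree $\le r$ (in 2D for $r \ge 2$, $\mathcal{S}_r=\mathcal{P}_r+\mathrm{span}\{x^ry,xy^r\}$). Shape function spaces on a cube $\square_n$. - $\mathcal{Q}_r^-\Lambda^0=\mathcal{Q}_r$. $\mathcal{Q}_r^-\Lambda^1(\square_2)=\mathcal{P}_{r,r-1}\times\mathcal{P}_{r-1,r}$. $\mathcal{Q}_r^-\Lambda^1(\square_3)=\mathcal{P}_{r-1,r,r}\times\mathcal{P}_{r,r-1,r}\times\mathcal{P}_{r,r,r-1}$. - $\mathcal{S}_r\Lambda^0=\mathcal{S}_r$. $\mathcal{S}_r\Lambda^1(\square_2)=[\mathcal{P}_r]^2+\mathrm{span}\{\operatorname{curl}(x^{r+1}y),\operatorname{curl}(xy^{r+1})\}$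 with $\operatorname{curl}u=(-\partial_2u,\partial_1u)^T$. $\mathcal{S}_r\Lambda^2(\square_2)=\mathcal{P}_r$. - In 3D, for $w=(w_1(y,z),w_2(x,z),w_3(x,y))$ put $\Phi(w)=\big(yz(w_2-w_3),\,zx(w_3-w_1),\,xy(w_1-w_2)\big)^T$. Then $\mathcal{S}_r\Lambda^1(\square_3)=[\mathcal{P}_r]^3+\{\Phi(w):w_i\in\mathcal{P}_{r-1}\}+\{\operatorname{grad}q:q\in\mathcal{S}_{r+1}\}$, and $\mathcal{S}_r\Lambda^2(\square_3)=[\mathcal{P}_r]^3+\{\operatorname{curl}\Phi(w):w_i\in\mathcal{P}_r\}$. - $\mathcal{S}_r^-\Lambda^0=\mathcal{S}_r\Lambda^0$ and $\mathcal{S}_r^-\Lambda^1=\mathcal{S}_{r-1}\Lambda^1+\kappa\,\mathcal{S}_{r-1}\Lambda^2$, where $\kappa$ is the Koszul operator: in 2D $\kappa v=v\,\bm{x}$ for scalar $v$; in 3D $\kappa\bm{w}=\bm{w}\times\bm{x}$ (up to sign), $\bm{x}$ being the position vector. Global spaces. The shape functions for the Hermite spaces $\mathcal{G}_r^-\Lambda^k$, the Adini spaces $\mathcal{A}_r\Lambda^k$ and the trimmed-Adini spaces $\mathcal{A}_r^-\Lambda^k$ are $\mathcal{Q}_r^-\Lambda^k$, $\mathcal{S}_r\Lambda^k$ and $\mathcal{S}_r^-\Lambda^k$, respectively. - 0-forms ($k=0$): piecewise shape functions that are globally continuous and whose first order partial derivatives are single-valued at each mesh vertex. - 1-forms ($k=1$):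 piecewise shape functions (vector fields) whose value is single-valued at each mesh vertex and such that the normal component is continuous across each interior edge if $n=2$ ($H(\operatorname{div})$-conforming), respectively the tangential component is continuous across each interior face if $n=3$ ($H(\operatorname{curl})$-conforming). Vanishing boundary degrees of freedom means: for 0-forms, zero trace on $\partial\Omega$ and zero first derivatives at boundary vertices; for 1-forms, zero normal ($n=2$) or tangential ($n=3$) trace on $\partial\Omega$ and zero value at boundary vertices. For $V_h=[W_h]^n$ this is imposed on each component. *)

(* Defs.v *)
From HB Require Import structures.
From mathcomp Require Import all_boot all_order all_algebra.
From mathcomp Require Import all_classical all_reals all_analysis.
From mathcomp Require Import -(notations) mpoly.

Set Implicit Arguments.
Unset Strict Implicit.
Unset Printing Implicit Defensive.

Import Order.TTheory GRing.Theory Num.Theory.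
Import numFieldNormedType.Exports.

Local Open Scope classical_set_scope.
Local Open Scope ring_scope.

Section Polynomials.
Context {R : realType}.

Definition pvar {n} (i : 'I_n) : mpoly n R := mpolyX R (mnm1 i).

Definition peval {n} (p : mpoly n R) (x : 'rV[R]_n) : R := meval (x 0) p.

Definition vec2 (a b : mpoly 2 R) : 'rV[mpoly 2 R]_2 := \row_i [:: a; b]`_i.
Definition vec3 (a b c : mpoly 3 R) : 'rV[mpoly 3 R]_3 :=
  \row_i [:: a; b; c]`_i.

Definition pgrad {n} (p : mpoly n R) : 'rV[mpoly n R]_n := \row_i mderiv i p.

Definition curl2 (p : mpoly 2 R) : 'rV[mpoly 2 R]_2 :=
  vec2 (- mderiv 1 p) (mderiv 0 p).

Definition curl3 (v : 'rV[mpoly 3 R]_3) : 'rV[mpoly 3 R]_3 :=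
  vec3 (mderiv 1 (v 0 2) - mderiv 2 (v 0 1))
       (mderiv 2 (v 0 0) - mderiv 0 (v 0 2))
       (mderiv 0 (v 0 1) - mderiv 1 (v 0 0)).

Definition pcross (v w : 'rV[mpoly 3 R]_3) : 'rV[mpoly 3 R]_3 :=
  vec3 (v 0 1 * w 0 2 - v 0 2 * w 0 1)
       (v 0 2 * w 0 0 - v 0 0 * w 0 2)
       (v 0 0 * w 0 1 - v 0 1 * w 0 0).

Definition position {n} : 'rV[mpoly n R]_n := \row_i pvar i.

Definition Ptot {n} (r : nat) : set (mpoly n R) :=
  [set p | forall m, m \in msupp p -> (mdeg m <= r)%N].

(* degree at most d i in the i-th variable *)
Definition Ppart {n} (d : 'I_n -> nat) : set (mpoly n R) :=
  [set p | forall m, m \in msupp p -> forall i, (m i <= d i)%N].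

Definition sldeg {n} (m : multinom n) : nat := (\sum_(i | (2 <= m i)%N) m i)%N.

Definition Sser {n} (r : nat) : set (mpoly n R) :=
  [set p | forall m, m \in msupp p -> (sldeg m <= r)%N].

Definition Pvec {n} (r : nat) : set 'rV[mpoly n R]_n :=
  [set v | forall i, Ptot r (v 0 i)].

(* [w 0 i] of degree at most r and independent of the i-th variable *)
Definition Pskip (r : nat) : set 'rV[mpoly 3 R]_3 :=
  [set w | Pvec r w /\
           forall i m, m \in msupp (w 0 i) -> m i = 0%N].

Definition Phi (w : 'rV[mpoly 3 R]_3) : 'rV[mpoly 3 R]_3 :=
  let x := pvar 0 in let y := pvar 1 in let z := pvar 2 in
  vec3 (y * z * (w 0 1 - w 0 2))
       (z * x * (w 0 2 - w 0 0))
       (x * y * (w 0 0 - w 0 1)).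

End Polynomials.

Inductive family := Hermite | Adini | TrimmedAdini.

Section ShapeFunctions.
Context {R : realType}.

Definition Qm1_2 (r : nat) : set 'rV[mpoly 2 R]_2 :=
  [set v | forall i,
    Ppart (fun j => if j == i then r else r.-1) (v 0 i)].

Definition Qm1_3 (r : nat) : set 'rV[mpoly 3 R]_3 :=
  [set v | forall i,
    Ppart (fun j => if j == i then r.-1 else r) (v 0 i)].

Definition S1_2 (r : nat) : set 'rV[mpoly 2 R]_2 :=
  let x := pvar 0 in let y := pvar 1 in
  [set v | exists p (a b : R), Pvec r p /\
     v = p + mpolyC 2 a *: curl2 (x ^+ r.+1 * y)
           + mpolyC 2 b *: curl2 (x * y ^+ r.+1)].

Definition S1_3 (r : nat) : set 'rV[mpoly 3 R]_3 :=
  [set v | exists p w q, [/\ Pvec r p, Pskip r.-1 w, Sser r.+1 q &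
     v = p + Phi w + pgrad q]].

Definition S2_2 (r : nat) : set (mpoly 2 R) := Ptot r.

Definition S2_3 (r : nat) : set 'rV[mpoly 3 R]_3 :=
  [set v | exists p w, [/\ Pvec r p, Pskip r w & v = p + curl3 (Phi w)]].

Definition Sm1_2 (r : nat) : set 'rV[mpoly 2 R]_2 :=
  [set v | exists u w, [/\ S1_2 r.-1 u, S2_2 r.-1 w & v = u + w *: position]].

Definition Sm1_3 (r : nat) : set 'rV[mpoly 3 R]_3 :=
  [set v | exists u w,
    [/\ S1_3 r.-1 u, S2_3 r.-1 w & v = u + pcross w position]].

Definition shape0 {n} (F : family) (r : nat) : set (mpoly n R) :=
  match F with
  | Hermite => Ppart (fun=> r)
  | Adini => Sser r
  | TrimmedAdini => Sser r
  end.

Definition shape1_2 (F : family) (r : nat) : set 'rV[mpoly 2 R]_2 :=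
  match F with
  | Hermite => Qm1_2 r
  | Adini => S1_2 r
  | TrimmedAdini => Sm1_2 r
  end.

Definition shape1_3 (F : family) (r : nat) : set 'rV[mpoly 3 R]_3 :=
  match F with
  | Hermite => Qm1_3 r
  | Adini => S1_3 r
  | TrimmedAdini => Sm1_3 r
  end.

(* only used for n = 2 and n = 3 *)
Definition shape1 {n} (F : family) (r : nat) : set 'rV[mpoly n R]_n :=
  match n return set 'rV[mpoly n R]_n with
  | 2%N => shape1_2 F r
  | 3%N => shape1_3 F r
  | _ => set0
  end.

End ShapeFunctions.

Section Meshes.
Context {R : realType} {n : nat}.

(* Bounded and connected, and the interior of a finite union of polyhedra, each
   given as a finite list of half-spaces [a . x <= b].  The interior of a closed
   set is regular open, so slits are excluded. *)
Definition polyhedral_domain (Omega : set 'rV[R]_n) : Prop :=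
  [/\ Omega !=set0, connected Omega,
      exists M : R, forall x, Omega x -> forall i, `|x 0 i| <= M &
      exists Ps : seq (seq ('rV[R]_n * R)),
        Omega = interior [set x : 'rV[R]_n | exists2 P, P \in Ps &
          forall c, c \in P -> \sum_i c.1 0 i * x 0 i <= c.2]].

(* lower corner and edge length *)
Definition cube : Type := ('rV[R]_n * R)%type.

Definition cell (T : cube) : set 'rV[R]_n :=
  [set x | forall i, T.1 0 i <= x 0 i <= T.1 0 i + T.2].

(* the two values taken by the i-th coordinate on the vertices *)
Definition endpoint (T : cube) (i : 'I_n) (b : bool) : R :=
  T.1 0 i + b%:R * T.2.

Definition vertex (T : cube) : set 'rV[R]_n :=
  [set x | forall i, exists b, x 0 i = endpoint T i b].

(* The faces of all dimensions: [s i = Some b] fixes the i-th coordinate. *)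
Definition face (T : cube) (s : 'I_n -> option bool) : set 'rV[R]_n :=
  [set x | cell T x /\ forall i b, s i = Some b -> x 0 i = endpoint T i b].

Definition facet (T : cube) (i : 'I_n) (b : bool) : set 'rV[R]_n :=
  face T (fun j => if j == i then Some b else None).

(* Two cubes of positive edge length whose intersection is a common face either
   coincide or have disjoint interiors. *)
Definition conforming (Th : seq cube) : Prop :=
  forall T T', T \in Th -> T' \in Th ->
    cell T `&` cell T' = set0 \/
    exists s s', cell T `&` cell T' = face T s /\
                 cell T `&` cell T' = face T' s'.

Definition cube_diam (T : cube) : R := Num.sqrt n%:R * T.2.

Definition cube_mesh (Omega : set 'rV[R]_n) (h : R) (Th : seq cube) : Prop :=
  [/\ uniq Th,
      forall T, T \in Th -> 0 < T.2,
      closure Omega = [set x : 'rV[R]_n | exists2 T, T \in Th & cell T x],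
      conforming Th &
      h = \big[Num.max/0]_(T <- Th) cube_diam T].

Definition boundary (Omega : set 'rV[R]_n) : set 'rV[R]_n :=
  closure Omega `\` interior Omega.

Definition upd (x : 'rV[R]_n) (i : 'I_n) (t : R) : 'rV[R]_n :=
  \row_j (if j == i then t else x 0 j).

(* Iterated Lebesgue integral over T in the coordinates listed in s, the other
   coordinates being those of x.  By Fubini this is the Lebesgue integral for
   the polynomial integrands considered here. *)
Fixpoint iterint (T : cube) (s : seq 'I_n) (f : 'rV[R]_n -> R)
    (x : 'rV[R]_n) : R :=
  if s is i :: s' then
    \int[lebesgue_measure]_(t in `[T.1 0 i, T.1 0 i + T.2])
      iterint T s' f (upd x i t)
  else f x.

Definition cell_int (T : cube) (f : 'rV[R]_n -> R) : R :=
  iterint T (enum 'I_n) f T.1.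

Definition facet_int (T : cube) (i : 'I_n) (b : bool) (f : 'rV[R]_n -> R) : R :=
  iterint T (rem i (enum 'I_n)) f (upd T.1 i (endpoint T i b)).

End Meshes.

Arguments cube : clear implicits.

Section PiecewisePolynomials.
Context {R : realType} {n : nat}.

(* A piecewise polynomial is given by its restrictions to the cells; the values
   at cubes outside the mesh are irrelevant. *)
Definition pwpoly : Type := cube R n -> mpoly n R.
Definition pwvec : Type := cube R n -> 'rV[mpoly n R]_n.

Definition zero_forms (F : family) (r : nat) (Th : seq (cube R n)) :
    set pwpoly :=
  [set w |
    [/\ forall T, T \in Th -> shape0 F r (w T),
        forall T T', T \in Th -> T' \in Th ->
          forall x, cell T x -> cell T' x ->
            peval (w T) x = peval (w T') x &
        forall T T', T \in Th -> T' \in Th ->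
          forall x, vertex T x -> vertex T' x ->
            forall i, peval (mderiv i (w T)) x = peval (mderiv i (w T')) x]].

(* The components v_j constrained on a facet orthogonal to e_i: the normal one
   if n = 2 (H(div)), the tangential ones if n = 3 (H(curl)). *)
Definition trace_comp (i j : 'I_n) : bool :=
  if n == 2%N then j == i else j != i.

Definition one_forms (F : family) (r : nat) (Th : seq (cube R n)) :
    set pwvec :=
  [set v |
    [/\ forall T, T \in Th -> shape1 F r (v T),
        forall T T', T \in Th -> T' \in Th ->
          forall x, vertex T x -> vertex T' x ->
            forall j, peval (v T 0 j) x = peval (v T' 0 j) x &
        forall T T', T \in Th -> T' \in Th -> T != T' ->
          forall i b b', facet T i b = facet T' i b' ->
            forall x, facet T i b x -> forall j, trace_comp i j ->
              peval (v T 0 j) x = peval (v T' 0 j) x]].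

Definition vanishing0 (Omega : set 'rV[R]_n) (Th : seq (cube R n))
    (w : pwpoly) : Prop :=
  forall T, T \in Th ->
    (forall x, cell T x -> boundary Omega x -> peval (w T) x = 0) /\
    (forall x, vertex T x -> boundary Omega x ->
       forall i, peval (mderiv i (w T)) x = 0).

Definition vanishing1 (Omega : set 'rV[R]_n) (Th : seq (cube R n))
    (v : pwvec) : Prop :=
  forall T, T \in Th ->
    (forall i b, facet T i b `<=` boundary Omega ->
       forall x, facet T i b x -> forall j, trace_comp i j ->
         peval (v T 0 j) x = 0) /\
    (forall x, vertex T x -> boundary Omega x ->
       forall j, peval (v T 0 j) x = 0).

(* [strain v i j] is the (i, j) entry of the symmetric gradient. *)
Definition strain (v : 'rV[mpoly n R]_n) (i j : 'I_n) : mpoly n R :=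
  (2^-1 : R) *: (mderiv i (v 0 j) + mderiv j (v 0 i)).

Definition L2sq (T : cube R n) (p : mpoly n R) : R :=
  cell_int T (fun x => peval p x ^+ 2).

Definition H1sq (T : cube R n) (p : mpoly n R) : R :=
  L2sq T p + \sum_i L2sq T (mderiv i p).

Definition norm0_sq (Th : seq (cube R n)) (v : pwvec) : R :=
  \sum_(T <- Th) \sum_j L2sq T (v T 0 j).

Definition norm1h_sq (Th : seq (cube R n)) (v : pwvec) : R :=
  \sum_(T <- Th) \sum_j H1sq T (v T 0 j).

Definition strain_sq (Th : seq (cube R n)) (v : pwvec) : R :=
  \sum_(T <- Th) \sum_i \sum_j L2sq T (strain (v T) i j).

(* The boundary of Omega is the union of the facets contained in it. *)
Definition boundary_sq (Omega : set 'rV[R]_n) (Th : seq (cube R n))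
    (v : pwvec) : R :=
  \sum_j \sum_(T <- Th) \sum_i \sum_(b | `[< facet T i b `<=` boundary Omega >])
    facet_int T i b (fun x => peval (v T 0 j) x ^+ 2).

End PiecewisePolynomials.

Arguments pwpoly : clear implicits.
Arguments pwvec : clear implicits.

(* [ZeroForms F] stands for [W_h]^n with W_h the 0-form space of F. *)
Inductive fe_space := ZeroForms of family | OneForms of family.

Definition min_degree (S : fe_space) : nat :=
  if S is OneForms Adini then 2%N else 3%N.

Section Spaces.
Context {R : realType} {n : nat}.

Definition Vh (S : fe_space) (r : nat) (Th : seq (cube R n)) :
    set (pwvec R n) :=
  match S with
  | ZeroForms F => [set v | forall j, zero_forms F r Th (fun T => v T 0 j)]
  | OneForms F => one_forms F r Th
  end.

Definition Vh0 (S : fe_space) (r : nat) (Omega : set 'rV[R]_n)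
    (Th : seq (cube R n)) : set (pwvec R n) :=
  [set v | Vh S r Th v /\
    match S with
    | ZeroForms _ => forall j, vanishing0 Omega Th (fun T => v T 0 j)
    | OneForms _ => vanishing1 Omega Th v
    end].

End Spaces.

(* Main.v *)
(** Only two properties of the spaces matter: the degrees are bounded, and the
    values at mesh vertices are single-valued.

    On one cell, a functional or seminorm that vanishes on rigid motions is
    bounded by the strain (finite dimension and scaling).  Hence the gradient on
    a cell is controlled by the strain and by the difference quotients of the
    vertex values, and it remains to prove Korn's inequality for grid functions.

    Conformity and connectedness of Omega force all cells of a mesh onto one
    lattice.  Fix one mesh; each of its cells [Q] determines, in any other mesh,
    the rectangular block of cells that overlap [Q], of side at least that of
    [Q].  There are finitely many blocks, independently of the mesh size.  The
    entries [ij], [ji] of the discrete gradient only involve two directions, so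
    Korn's second inequality on a block reduces to two-dimensional slices.  There
    it follows from a cutoff, reflections, Nitsche's extension with dilations 1
    and 2 (which preserves the lattice), and summation by parts on the plane.

    The other two inequalities follow from the first one: the diagonal strain
    controls the variation of [v_i] along [e_i], and walking through the cells in
    that direction leads to a boundary facet, so the L2 norm is bounded by the
    strain and the boundary values. *)

Require Import Defs.
From HB Require Import structures.
From mathcomp Require Import all_boot all_order all_algebra.
From mathcomp Require Import all_classical all_reals all_analysis.
From mathcomp Require Import -(notations) mpoly.
From mathcomp Require Import ring lra zify.
Import Order.TTheory GRing.Theory Num.Theory.
Import numFieldNormedType.Exports.
Local Open Scope classical_set_scope.
Local Open Scope ring_scope.

Set Implicit Arguments.
Unset Strict Implicit.
Unset Printing Implicit Defensive.

(** * Discrete Korn inequality on a two-dimensional grid *)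

(** The right-hand side of Korn's second inequality is a sum over cells and contains the L2 norm, so
    the blocks may overlap and no rigid motions have to be glued together. In this first estimate
    the shape of Omega enters only through the number and the edge length of the cubes of the fixed
    mesh. The obstacle is uniformity in the number of cells of a block: finite-dimensional arguments
    are confined to one reference cube, and the grid needs explicit constants. On the grid, the
    cross term of the squared shear is a null Lagrangian, equal in sum to a product of diagonal
    strains once one component vanishes on the border. The cutoff creates zero values on two sides,
    at the price of the mass term; an extension creates them on the other two. Reflecting [p] evenly
    and [q] oddly would preserve the strain but tear [q] apart on the axis, and this is what
    Nitsche's second dilation repairs. Summation by parts turns forward into backward differences.
    This is why a cell controls [p] on both horizontal edges and [q] on both vertical ones, but the
    shear at one corner only. *)

Section DiscreteKorn.
Variable R : realFieldType.
Implicit Types (x y z : R) (p q K N : nat -> nat -> R).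

Lemma sqrD_le2 x y : (x + y) ^+ 2 <= 2 * (x ^+ 2 + y ^+ 2).
Proof. by have := sqr_ge0 (x - y); nra. Qed.

Lemma sqrD_le3 x y z :
  (x + y + z) ^+ 2 <= 3 * (x ^+ 2 + y ^+ 2 + z ^+ 2).
Proof.
have := sqr_ge0 (x - y); have := sqr_ge0 (y - z); have := sqr_ge0 (x - z).
nra.
Qed.

(* [p], [q] are the two components of a displacement of the grid points. *)
Definition cell_ctl p q K (a b : nat) : Prop :=
  [/\ (p a.+1 b - p a b) ^+ 2 <= K a b,
      (p a.+1 b.+1 - p a b.+1) ^+ 2 <= K a b,
      (q a b.+1 - q a b) ^+ 2 <= K a b,
      (q a.+1 b.+1 - q a.+1 b) ^+ 2 <= K a b &
      (p a b.+1 - p a b + (q a.+1 b - q a b)) ^+ 2 <= K a b].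

Definition gsum K (A B : nat) : R := \sum_(a < A) \sum_(b < B) K a b.

Definition vdiff_sq p : nat -> nat -> R :=
  gsum (fun a b => (p a b.+1 - p a b) ^+ 2).

Lemma gsumC K A B : gsum K A B = gsum (fun a b => K b a) B A.
Proof. exact: exchange_big. Qed.

Lemma le_gsum (K L : nat -> nat -> R) A B :
  (forall a b, (a < A)%N -> (b < B)%N -> K a b <= L a b) ->
  gsum K A B <= gsum L A B.
Proof. by move=> KL; apply: ler_sum => a _; apply: ler_sum => b _; apply: KL. Qed.

Lemma gsumD K L A B :
  gsum (fun a b => K a b + L a b) A B = gsum K A B + gsum L A B.
Proof. by rewrite -big_split; apply: eq_bigr => a _; rewrite big_split. Qed.

Lemma gsumZ c K A B : gsum (fun a b => c * K a b) A B = c * gsum K A B.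
Proof.
by rewrite /gsum mulr_sumr; apply: eq_bigr => a _; rewrite mulr_sumr.
Qed.

Lemma gsum_ge0 K A B :
  (forall a b, (a < A)%N -> (b < B)%N -> 0 <= K a b) -> 0 <= gsum K A B.
Proof. by move=> K0; apply: sumr_ge0 => a _; apply: sumr_ge0 => b _; apply: K0. Qed.

Lemma cell_ctl_ge0 p q K a b : cell_ctl p q K a b -> 0 <= K a b.
Proof. by case=> h _ _ _ _; apply: le_trans h; apply: sqr_ge0. Qed.

Lemma sum_tele (h : nat -> R) A :
  \sum_(a < A) (h a.+1 - h a) = h A - h 0%N.
Proof.
by rewrite -(telescope_sumr h (leq0n A)) big_mkord.
Qed.

(* Two summations by parts exchange the mixed differences:
   the forward [dy p * dx q] becomes the backward [dx p * dy q]. *)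
Lemma null_lagrangian p q A B :
  (forall b, p 0%N b = 0) -> (forall b, p A b = 0) ->
  (forall a, p a 0%N = 0) -> (forall a, p a B = 0) ->
  gsum (fun a b => (p a b.+1 - p a b) * (q a.+1 b - q a b)) A B =
  gsum (fun a b =>
    (p a.+1 b.+1 - p a b.+1) * (q a.+1 b.+1 - q a.+1 b)) A B.
Proof.
move=> pl pr pb pt.
(* The first bracket is the [a]-difference of [p a b.+1 * (q a b - q a b.+1)], the second the
   [b]-difference of [p a b * (q a.+1 b - q a b)]; both telescope to border terms, where [p]
   vanishes. *)
have diffE a b : (p a b.+1 - p a b) * (q a.+1 b - q a b) =
   (p a.+1 b.+1 - p a b.+1) * (q a.+1 b.+1 - q a.+1 b) +
   ((p a.+1 b.+1 * q a.+1 b - p a b.+1 * q a b)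
   - (p a.+1 b.+1 * q a.+1 b.+1 - p a b.+1 * q a b.+1)) +
   ((p a b.+1 * q a.+1 b.+1 - p a b * q a.+1 b)
   - (p a b.+1 * q a b.+1 - p a b * q a b)).
  by ring.
transitivity (gsum (fun a b =>
    (p a.+1 b.+1 - p a b.+1) * (q a.+1 b.+1 - q a.+1 b) +
   ((p a.+1 b.+1 * q a.+1 b - p a b.+1 * q a b)
   - (p a.+1 b.+1 * q a.+1 b.+1 - p a b.+1 * q a b.+1)) +
   ((p a b.+1 * q a.+1 b.+1 - p a b * q a.+1 b)
   - (p a b.+1 * q a b.+1 - p a b * q a b))) A B).
  by apply: eq_bigr => a _; apply: eq_bigr => b _; rewrite -diffE.
rewrite 2!gsumD -[RHS]addr0 -addrA; congr (_ + _).
rewrite [X in X + _]gsumC /gsum !big1 ?addr0// => k _.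
- rewrite sumrB (sum_tele (fun b => p k b * q k.+1 b)).
  by rewrite (sum_tele (fun b => p k b * q k b)) pt pb !mul0r !subr0.
- rewrite sumrB (sum_tele (fun a => p a k.+1 * q a k)).
  by rewrite (sum_tele (fun a => p a k.+1 * q a k.+1)) pl pr !mul0r !subr0.
Qed.

(** Korn's first inequality: squaring the shear leaves the cross term of [dy p] and [dx q], whose
    sum [null_lagrangian] turns into products of diagonal strains. Zero values of one component
    suffice, so the two components can be treated in turn. *)
Lemma korn_zero_boundary p q K A B :
  (forall b, p 0%N b = 0) -> (forall b, p A b = 0) ->
  (forall a, p a 0%N = 0) -> (forall a, p a B = 0) ->
  (forall a b, cell_ctl p q K a b) ->
  vdiff_sq p A B <= 3 * gsum K A B.
Proof.
move=> pl pr pb pt ctl.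
have Hle : vdiff_sq p A B <= gsum (fun a b => 2^-1 * ((p a b.+1 - p a b) ^+ 2)) A B
   + gsum (fun a b => 2^-1 * K a b) A B
   + -1 * gsum (fun a b => (p a b.+1 - p a b) * (q a.+1 b - q a b)) A B.
  rewrite /vdiff_sq -gsumZ -!gsumD; apply: le_gsum => a b _ _.
  have [_ _ _ _] := ctl a b.
  set X := p a b.+1 - p a b; set Y := q a.+1 b - q a b.
  by have := sqr_ge0 Y; nra.
have Hle2 : -1 * gsum (fun a b => (p a b.+1 - p a b) * (q a.+1 b - q a b)) A B
    <= gsum K A B.
  rewrite null_lagrangian// -gsumZ; apply: le_gsum => a b _ _.
  have [_ h1 _ h2 _] := ctl a b.
  move: h1 h2; set X := p a.+1 b.+1 - _; set Y := q a.+1 b.+1 - _.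
  have := sqr_ge0 (X + Y); nra.
move: Hle; rewrite !gsumZ -/(vdiff_sq p A B); lra.
Qed.

Definition swap K : nat -> nat -> R := fun a b => K b a.

Lemma cell_ctl_swap p q K a b :
  cell_ctl p q K a b -> cell_ctl (swap q) (swap p) (swap K) b a.
Proof.
by case=> *; split => //; rewrite /swap addrC.
Qed.

(** The shear is the sum of the two off-diagonal differences, so either one controls the other. This
    exchanges the roles of the components, hence of the free sides. *)
Lemma vdiff_sq_swap p q K A B :
  (forall a b, (a < A)%N -> (b < B)%N -> cell_ctl p q K a b) ->
  vdiff_sq p A B <= 2 * vdiff_sq (swap q) B A + 2 * gsum K A B.
Proof.
move=> ctl; rewrite /vdiff_sq (gsumC _ B A).
rewrite -!gsumZ -gsumD; apply: le_gsum => a b aA bB.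
have [_ _ _ _] := ctl a b aA bB; rewrite /swap.
set X := p a b.+1 - _; set Y := q a.+1 b - _.
by have := sqr_ge0 (X + Y + Y); nra.
Qed.

(* Nitsche's extension across [b = 0], moved up by [B]: the weights make the
   shear strain of the extension a combination of strains. *)
Definition ext_p (B : nat) p : nat -> nat -> R := fun a b =>
  if (b < B)%N then 3 * p a (B - b)%N - 2 * p a (B - b).*2
  else p a (b - B)%N.

Definition ext_q (B : nat) q : nat -> nat -> R := fun a b =>
  if (b < B)%N then 4 * q a (B - b).*2 - 3 * q a (B - b)%N
  else q a (b - B)%N.

(** At depth [t] below the axis, dilation 1 sees the cell [t] and dilation 2 the cells [2t] and
    [2t+1]. The factor 400 absorbs the coefficients arising in [ext_ctl], the largest being 324, in
    the shear. *)
Definition ext_K (B : nat) K : nat -> nat -> R := fun a b =>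
  if (b < B)%N then
    let t := (B - b.+1)%N in 400 * (K a t + (K a t.*2 + K a t.*2.+1))
  else K a (b - B)%N.

(** Both pairs of weights, [3 - 2] and [4 - 3], sum to 1; hence the extension is continuous and the
    reflected formula remains valid on the axis [b = B]. *)
Lemma ext_pE B p a b : (b <= B)%N ->
  ext_p B p a b = 3 * p a (B - b)%N - 2 * p a (B - b).*2.
Proof.
rewrite leq_eqVlt /ext_p => /orP[/eqP->|->//].
by rewrite ltnn subnn double0; ring.
Qed.

Lemma ext_qE B q a b : (b <= B)%N ->
  ext_q B q a b = 4 * q a (B - b).*2 - 3 * q a (B - b)%N.
Proof.
rewrite leq_eqVlt /ext_q => /orP[/eqP->|->//].
by rewrite ltnn subnn double0; ring.
Qed.

Lemma lin3_sqr x y z (k l m : R) : x ^+ 2 <= k -> y ^+ 2 <= l -> z ^+ 2 <= m ->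
  (x + y + z) ^+ 2 <= 3 * (k + l + m).
Proof. by move=> ? ? ?; apply: le_trans (sqrD_le3 _ _ _) _; lra. Qed.

Lemma scale_sqr x (c k : R) : x ^+ 2 <= k -> (c * x) ^+ 2 <= c ^+ 2 * k.
Proof. by move=> ?; rewrite exprMn ler_wpM2l// sqr_ge0. Qed.

Lemma ext_ctl B p q K : (forall a b, cell_ctl p q K a b) ->
  forall a b, cell_ctl (ext_p B p) (ext_q B q) (ext_K B K) a b.
Proof.
move=> ctl a b; have [bB|Bb] := ltnP b B; last first.
  have := ctl a (b - B)%N; rewrite /cell_ctl /ext_p /ext_q /ext_K.
  by rewrite -subSn// ltnNge Bb /= ltnNge (leq_trans Bb).
have [t Bt] : exists t, (B - b = t.+1)%N by exists (B - b.+1)%N; lia.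
have Bt' : (B - b.+1 = t)%N by lia.
rewrite /cell_ctl !ext_pE ?(ltnW bB)// !ext_qE ?(ltnW bB)// /ext_K bB Bt Bt'.
rewrite !doubleS.
have K1 := cell_ctl_ge0 (ctl a t).
have K2 := cell_ctl_ge0 (ctl a t.*2).
have K3 := cell_ctl_ge0 (ctl a t.*2.+1).
have [f1 F1 g1 G1 s1] := ctl a t.
have [f2 F2 g2 G2 s2] := ctl a t.*2.
have [f3 F3 g3 G3 s3] := ctl a t.*2.+1.
set k := K a t; set l := K a t.*2; set m := K a t.*2.+1.
rewrite -/k in K1 f1 F1 g1 G1 s1; rewrite -/l in K2 f2 F2 g2 G2 s2.
rewrite -/m in K3 f3 F3 g3 G3 s3.
have h0 : (0 : R) ^+ 2 <= 0 by rewrite expr0n.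
split.
- have := lin3_sqr (scale_sqr 3 F1) (scale_sqr (-2) F3) h0.
  set u := (_ + _ + 0) ^+ 2; set v := (_ - _) ^+ 2.
  by have -> : u = v; [rewrite /u /v; ring|lra].
- have := lin3_sqr (scale_sqr 3 f1) (scale_sqr (-2) f2) h0.
  set u := (_ + _ + 0) ^+ 2; set v := (_ - _) ^+ 2.
  by have -> : u = v; [rewrite /u /v; ring|lra].
- have := lin3_sqr (scale_sqr 3 g1) (scale_sqr (-4) g2) (scale_sqr (-4) g3).
  set u := (_ + _ + _) ^+ 2; set v := (_ - _) ^+ 2.
  by have -> : u = v; [rewrite /u /v; ring|lra].
- have := lin3_sqr (scale_sqr 3 G1) (scale_sqr (-4) G2) (scale_sqr (-4) G3).
  set u := (_ + _ + _) ^+ 2; set v := (_ - _) ^+ 2.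
  by have -> : u = v; [rewrite /u /v; ring|lra].
(* The reflected cell takes [dx q] on its upper edge, whereas its shear takes it on the lower one;
   the two differ by the vertical differences of [q] on both sides. For dilation 2 the weight 4 of
   [q] is twice that of [p], because a difference of [p] there spans two cells. *)
- have := lin3_sqr
    (lin3_sqr (scale_sqr (-3) s1) (scale_sqr (-3) G1) (scale_sqr 3 g1))
    (lin3_sqr (scale_sqr 2 s2) (scale_sqr 2 G2) (scale_sqr (-2) g2))
    (lin3_sqr (scale_sqr 2 s3) (scale_sqr 4 G3) (scale_sqr (-4) g3)).
  set u := (_ + _ + _) ^+ 2; set v := (_ - _ + (_ - _)) ^+ 2.
  by have -> : u = v; [rewrite /u /v; ring|lra].
Qed.

Lemma sum_double (h : nat -> R) B :
  \sum_(t < B) (h t.*2 + h t.*2.+1) = \sum_(t < B.*2) h t.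
Proof.
elim: B => [|B IH]; first by rewrite double0 !big_ord0.
by rewrite big_ord_recr IH doubleS !big_ord_recr /= addrA.
Qed.

Lemma sum_ord_addn (h : nat -> R) m n :
  \sum_(t < m + n) h t = \sum_(t < m) h t + \sum_(t < n) h (m + t)%N.
Proof. by rewrite big_split_ord. Qed.

(** As [t] varies, each cell occurs at most once as [t] and once as [2t] or [2t+1], so the total is
    at most [2 * 400 + 1] times the original sum. *)
Lemma ext_K_sum B K A : (forall a b, 0 <= K a b) ->
  (forall a b, (B <= b)%N -> K a b = 0) ->
  gsum (ext_K B K) A B.*2 <= 1000 * gsum K A B.
Proof.
move=> K0 Kz; rewrite /gsum mulr_sumr; apply: ler_sum => a _.
rewrite -addnn (sum_ord_addn (ext_K B K a)).
have -> : \sum_(t < B) ext_K B K a (B + t)%N = \sum_(t < B) K a t.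
  by apply: eq_bigr => t _; rewrite /ext_K ltnNge leq_addr /= addKn.
have -> : \sum_(t < B) ext_K B K a t =
    400 * (\sum_(t < B) K a t + \sum_(t < B.*2) K a t).
  rewrite -sum_double -big_split /= mulr_sumr (reindex_inj rev_ord_inj) /=.
  apply: eq_bigr => t _; rewrite /ext_K.
  have -> : (B - t.+1 < B)%N by have := ltn_ord t; lia.
  by have -> : (B - (B - t.+1).+1 = t)%N by have := ltn_ord t; lia.
have Kout : \sum_(t < B) K a (B + t)%N = 0.
  by apply: big1 => t _; apply/Kz/leq_addr.
rewrite -addnn (sum_ord_addn (K a)) Kout addr0.
have : 0 <= \sum_(t < B) K a t by apply: sumr_ge0.
lra.
Qed.

Lemma vdiff_sq_ext B p A :
  vdiff_sq p A B <= vdiff_sq (ext_p B p) A B.*2.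
Proof.
apply: ler_sum => a _.
rewrite -addnn (sum_ord_addn (fun b => (ext_p B p a b.+1 - ext_p B p a b) ^+ 2)).
rewrite -[X in X <= _]add0r lerD//; first by apply: sumr_ge0 => t _; apply: sqr_ge0.
apply: ler_sum => t _.
have extE k : ext_p B p a (B + k) = p a k.
  by rewrite /ext_p ltnNge leq_addr /= addKn.
by rewrite -[(B + t).+1]addnS !extE.
Qed.

Definition supported p (A B : nat) :=
  forall a b, (A <= a)%N || (B <= b)%N -> p a b = 0.

Lemma ext_supported (p p' : nat -> nat -> R) A B :
  p' = ext_p B p \/ p' = ext_q B p \/ p' = ext_K B p ->
  supported p A B -> supported p' A B.*2.
Proof.
move=> + ps a b ab.
case=> [->|[->|->]]; rewrite /ext_p /ext_q /ext_K; case: ltnP => bB;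
 rewrite !ps ?mulr0 ?addr0 ?mulr0 ?subr0//; lia.
Qed.

Lemma ext_zero (p p' : nat -> nat -> R) A B : (0 < B)%N ->
  p' = ext_p B p \/ p' = ext_q B p ->
  supported p A B -> forall a, p' a 0%N = 0.
Proof.
move=> B0 + ps a.
case=> ->; rewrite /ext_p /ext_q B0 !ps ?mulr0 ?subr0//; lia.
Qed.

(** The bottom side is still free. One extension across it makes [p] vanish on all four sides,
    because the extended support ends before the new bottom; the constant is [3 * 1000]. *)
Lemma korn_half p q K A B : (0 < B)%N ->
  (forall b, p 0%N b = 0) ->
  supported p A B -> supported K A B ->
  (forall a b, cell_ctl p q K a b) -> supported q A B ->
  vdiff_sq p A B <= 3000 * gsum K A B.
Proof.
move=> B0 pl ps Ks ctl qs.
apply: le_trans (vdiff_sq_ext _ _ _) _.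
have ps' : supported (ext_p B p) A B.*2 by apply: ext_supported ps; left.
have := @korn_zero_boundary (ext_p B p) (ext_q B q) (ext_K B K) A B.*2.
have : gsum (ext_K B K) A B.*2 <= 1000 * gsum K A B.
  apply: ext_K_sum => a b; first exact: cell_ctl_ge0 (ctl a b).
  by move=> Bb; apply: Ks; rewrite Bb orbT.
move=> hK H; apply: le_trans (H _ _ _ _ _) _; last lra.
- by move=> b; rewrite /ext_p; case: ltnP => _; rewrite !pl ?mulr0 ?subr0.
- by move=> b; apply: ps'; rewrite leqnn.
- by apply: (ext_zero (A := A) (p := p)); first exact: B0; [left|].
- by move=> a; apply: ps'; rewrite leqnn orbT.
- exact: ext_ctl.
Qed.

Lemma swap_supported p A B : supported p A B -> supported (swap p) B A.
Proof. by move=> ps a b ab; apply: ps; rewrite orbC. Qed.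

(** Two sides are free. After extension across the bottom, [q] vanishes there, so with the axes
    swapped [q] takes the place of [p] in [korn_half], and its remaining free side is the left one.
    The constant dominates [2 * 3000 * 1000 + 2 * 1000]. *)
Lemma korn_quadrant p q K A B : (0 < A)%N -> (0 < B)%N ->
  supported p A B -> supported q A B -> supported K A B ->
  (forall a b, cell_ctl p q K a b) ->
  vdiff_sq p A B <= 3000 * 3000 * gsum K A B.
Proof.
move=> A0 B0 ps qs Ks ctl.
have K0 a b : 0 <= K a b by apply: cell_ctl_ge0 (ctl a b).
apply: le_trans (vdiff_sq_ext _ _ _) _.
have ctl' := ext_ctl B ctl.
apply: le_trans (vdiff_sq_swap (fun a b _ _ => ctl' a b)) _.
have hK : gsum (ext_K B K) A B.*2 <= 1000 * gsum K A B.
  apply: ext_K_sum => // a b Bb.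
  by apply: Ks; rewrite Bb orbT.
have ctls a b := cell_ctl_swap (ctl' b a).
have HH : vdiff_sq (swap (ext_q B q)) B.*2 A <= 3000 * gsum (ext_K B K) A B.*2.
  rewrite (gsumC (ext_K B K)).
  apply: (korn_half (q := swap (ext_p B p)) (K := swap (ext_K B K))) => //.
  - by move=> b; apply: (ext_zero (A := A) (B := B) (p := q)) => //; right.
  - by apply/swap_supported/(ext_supported _ qs); right; left.
  - by apply/swap_supported/(ext_supported _ Ks); right; right.
  - by apply/swap_supported/(ext_supported _ ps); left.
have G0 : 0 <= gsum K A B by apply: gsum_ge0.
move: hK HH G0; set g1 := gsum _ _ _; set g2 := gsum _ _ _; set g3 := vdiff_sq _ _ _.
move=> *; lra.
Qed.

End DiscreteKorn.

(** * Rectangular grids without boundary conditions: cutoff and reflections *)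

Section DiscreteKorn2.
Variable R : realFieldType.
Implicit Types (x y z : R) (p q K N : nat -> nat -> R).

(** In [96 = 32 * 3], the 3 bounds the strain of the cut-off fields and [32 = 2 * 16] undoes the
    cutoff. Each reflection multiplies the control by 9: the one of the first axis leads to
    [19 = 1 + 2 * 9], plus 8 for passing to the opposite edge of a cell, the one of the second axis
    to [10 = 1 + 9]. *)
Definition corner_const : R := 96 * (3000 * 3000) + 32.
Definition grid_const : R := 10 * (19 * corner_const + 8).

Lemma corner_const_ge0 : 0 <= corner_const.
Proof. by rewrite addr_ge0 ?ler0n ?mulr_ge0 ?ler0n. Qed.

Definition node_bound p N (a b : nat) : Prop :=
  [/\ (p a b) ^+ 2 <= N a b, (p a.+1 b) ^+ 2 <= N a b,
      (p a b.+1) ^+ 2 <= N a b & (p a.+1 b.+1) ^+ 2 <= N a b].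

(* truncated subtraction makes the cutoff vanish for [m <= a] *)
Definition cutoff (m a : nat) : R := (m - a)%:R / m%:R.

Lemma cutoff_ge0 m a : 0 <= cutoff m a.
Proof. by rewrite divr_ge0. Qed.

Lemma cutoff_le1 m a : cutoff m a <= 1.
Proof.
have [->|m0] := posnP m; first by rewrite /cutoff sub0n mul0r.
by rewrite ler_pdivrMr ?ltr0n// mul1r ler_nat leq_subr.
Qed.

Lemma cutoffS m a : (a < m)%N -> cutoff m a.+1 - cutoff m a = - m%:R^-1.
Proof.
move=> am; rewrite /cutoff -mulrBl -[RHS]mulN1r; congr (_ * _).
have -> : (m - a = (m - a.+1).+1)%N by lia.
by rewrite -natr1; ring.
Qed.

Lemma cutoff_half m a : (0 < m)%N -> (a.*2 <= m)%N -> 1 / 2 <= cutoff m a.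
Proof.
move=> m0 am; rewrite ler_pdivlMr ?ltr0n// mulrC mulrA mulr1.
rewrite ler_pdivrMr// -natrM ler_nat; lia.
Qed.

(** The product rule for the cutoff: its slopes [1 / A] and [1 / B] multiply nodal values. *)
Definition node_ctl p q K N (A B a b : nat) : R :=
  K a b + (A%:R^-1 ^+ 2 + B%:R^-1 ^+ 2) * N a b.

Lemma node_term_ge0 (A B : nat) (x : R) : 0 <= x ->
  0 <= (A%:R^-1 ^+ 2 + B%:R^-1 ^+ 2) * x.
Proof. by move=> x0; apply: mulr_ge0 => //; apply: addr_ge0; apply: sqr_ge0. Qed.

Lemma mul_sqr_le (w x c k : R) : w ^+ 2 <= c -> x ^+ 2 <= k ->
  (w * x) ^+ 2 <= c * k.
Proof. by move=> wc xk; rewrite exprMn ler_pM// sqr_ge0. Qed.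

Lemma prod01 (w x : R) : 0 <= w <= 1 -> 0 <= x <= 1 -> (w * x) ^+ 2 <= 1.
Proof.
move=> /andP[w0 w1] /andP[x0 x1]; rewrite -[leRHS](expr1n _ 2).
by rewrite lerXn2r ?nnegrE ?mulr_ge0// mulr_ile1.
Qed.

Lemma prod0d (w d c : R) : 0 <= w <= 1 -> d ^+ 2 <= c -> (w * d) ^+ 2 <= c.
Proof.
move=> /andP[w0 w1] dc; rewrite -[leRHS]mul1r; apply: mul_sqr_le => //.
by rewrite -[leRHS](expr1n _ 2) lerXn2r ?nnegrE.
Qed.

Section Corner.
Variables (p q K N : nat -> nat -> R) (A B : nat).
Hypotheses (A0 : (0 < A)%N) (B0 : (0 < B)%N).
Hypothesis ctl : forall a b, (a < A)%N -> (b < B)%N -> cell_ctl p q K a b.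
Hypothesis pN : forall a b, (a < A)%N -> (b < B)%N -> node_bound p N a b.
Hypothesis qN : forall a b, (a < A)%N -> (b < B)%N -> node_bound q N a b.

Let w a b := cutoff A a * cutoff B b.
Let L := node_ctl p q K N A B.
Let P a b := w a b * p a b.
Let Q a b := w a b * q a b.
(** [korn_quadrant] asks for control on the whole quadrant. Outside the grid all four nodes of a
    cell carry the value 0, so 0 is an admissible control. *)
Let KP a b := if (a < A)%N && (b < B)%N then 3 * L a b else 0.

Let N0 a b : (a < A)%N -> (b < B)%N -> 0 <= N a b.
Proof.
by move=> aA bB; have [h _ _ _] := pN aA bB; apply: le_trans h; apply: sqr_ge0.
Qed.

Let K0 a b : (a < A)%N -> (b < B)%N -> 0 <= K a b.
Proof. by move=> aA bB; apply: cell_ctl_ge0 (ctl aA bB). Qed.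

Let w01 m a : 0 <= cutoff m a <= 1.
Proof. by rewrite cutoff_ge0 cutoff_le1. Qed.

Let w1 a b : w a b ^+ 2 <= 1.
Proof. exact: prod01. Qed.

Let wx a b : (a < A)%N -> (w a.+1 b - w a b) ^+ 2 <= A%:R^-1 ^+ 2.
Proof.
move=> aA; rewrite /w -mulrBl mulrC; apply: prod0d => //.
by rewrite cutoffS// sqrrN.
Qed.

Let wy a b : (b < B)%N -> (w a b.+1 - w a b) ^+ 2 <= B%:R^-1 ^+ 2.
Proof.
move=> aA; rewrite /w -mulrBr; apply: prod0d => //.
by rewrite cutoffS// sqrrN.
Qed.

Let supp (f : nat -> nat -> R) : supported (fun a b => w a b * f a b) A B.
Proof.
move=> a b ab; rewrite /w /cutoff.
have /orP[/eqP->|/eqP->] : ((A - a == 0) || (B - b == 0))%N by lia.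
- by rewrite !mul0r.
- by rewrite mul0r mulr0 mul0r.
Qed.

Let ctlP a b : cell_ctl P Q KP a b.
Proof.
rewrite /cell_ctl /KP; have [/andP[aA bB]|ab] := ifPn; last first.
  have -> : P a b = 0 by apply: supp; lia.
  have -> : P a.+1 b = 0 by apply: supp; lia.
  have -> : P a b.+1 = 0 by apply: supp; lia.
  have -> : P a.+1 b.+1 = 0 by apply: supp; lia.
  have -> : Q a b = 0 by apply: supp; lia.
  have -> : Q a.+1 b = 0 by apply: supp; lia.
  have -> : Q a b.+1 = 0 by apply: supp; lia.
  have -> : Q a.+1 b.+1 = 0 by apply: supp; lia.
  by rewrite !subr0 addr0 expr0n /= lexx.
have [f F g G s] := ctl aA bB.
have [p1 p2 p3 p4] := pN aA bB.
have [q1 q2 q3 q4] := qN aA bB.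
have k0 := K0 aA bB; have n0 := N0 aA bB.
have A2 : 0 <= A%:R^-1 ^+ 2 * N a b by rewrite mulr_ge0// sqr_ge0.
have B2 : 0 <= B%:R^-1 ^+ 2 * N a b by rewrite mulr_ge0// sqr_ge0.
have two (u v k l m : R) : u ^+ 2 <= 1 * k -> v ^+ 2 <= l -> 0 <= m ->
    (u + v) ^+ 2 <= 3 * (k + (l + m)).
  move=> hu hv hm; apply: le_trans (sqrD_le2 _ _) _.
  have := sqr_ge0 u; have := sqr_ge0 v; lra.
rewrite /L /node_ctl [(_ + _) * N a b]mulrDl; split.
- have := two _ _ _ _ _ (mul_sqr_le (w1 a.+1 b) f)
    (mul_sqr_le (wx b aA) p1) B2.
  set u := (_ + _) ^+ 2; set v := (P _ _ - _) ^+ 2.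
  by have -> : u = v by rewrite /u /v /P; ring.
- have := two _ _ _ _ _ (mul_sqr_le (w1 a.+1 b.+1) F)
    (mul_sqr_le (wx b.+1 aA) p3) B2.
  set u := (_ + _) ^+ 2; set v := (P _ _ - _) ^+ 2.
  by have -> : u = v by rewrite /u /v /P; ring.
- rewrite [X in K a b + X]addrC.
  have := two _ _ _ _ _ (mul_sqr_le (w1 a b.+1) g)
    (mul_sqr_le (wy a bB) q1) A2.
  set u := (_ + _) ^+ 2; set v := (Q _ _ - _) ^+ 2.
  by have -> : u = v by rewrite /u /v /Q; ring.
- rewrite [X in K a b + X]addrC.
  have := two _ _ _ _ _ (mul_sqr_le (w1 a.+1 b.+1) G)
    (mul_sqr_le (wy a.+1 bB) q2) A2.
  set u := (_ + _) ^+ 2; set v := (Q _ _ - _) ^+ 2.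
  by have -> : u = v by rewrite /u /v /Q; ring.
- have := lin3_sqr (mul_sqr_le (w1 a b) s) (mul_sqr_le (wx b aA) q2)
    (mul_sqr_le (wy a bB) p3).
  set u := (_ + _ + _) ^+ 2; set v := (P _ _ - _ + _) ^+ 2.
  have -> : u = v by rewrite /u /v /Q /P; ring.
  by rewrite mul1r addrA.
Qed.

(** On the lower left quarter both factors of the cutoff are at least 1/2, so dividing by it costs
    at most 16 in the squares. The other quarters are reached by reflections. *)
Lemma korn_corner :
  gsum (fun a b => if (a.*2 <= A)%N && (b.*2 <= B)%N
     then (p a b.+1 - p a b) ^+ 2 else 0) A B
  <= corner_const * gsum (node_ctl p q K N A B) A B.
Proof.
have L0 a b : (a < A)%N -> (b < B)%N -> 0 <= L a b.
  by move=> aA bB; apply: addr_ge0; [apply: K0|apply/node_term_ge0/N0].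
have KPE : gsum KP A B = 3 * gsum L A B.
  rewrite -gsumZ; apply: eq_bigr => a _; apply: eq_bigr => b _.
  by rewrite /KP !ltn_ord.
have suppK : supported KP A B.
  by move=> a b ab; rewrite /KP; case: ifP => //; lia.
apply: (@le_trans _ _ (32 * vdiff_sq P A B + 32 * gsum L A B)); last first.
  have := korn_quadrant A0 B0 (supp p) (supp q) suppK ctlP.
  rewrite KPE /corner_const; move: (vdiff_sq P A B) (gsum L A B) => u g H.
  by lra.
rewrite /vdiff_sq -!gsumZ -gsumD; apply: le_gsum => a b aA bB.
have l0 := L0 _ _ aA bB.
case: ifPn => [/andP[a2 b2]|_]; last by have := sqr_ge0 (P a b.+1 - P a b); lra.
have [_ _ p3 _] := pN aA bB.
have wq : 1 / 4 <= w a b.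
  have : (1 / 2) * (1 / 2) <= w a b.
    by rewrite ler_pM ?cutoff_half//; lra.
  lra.
set X := p a b.+1 - p a b.
have -> : P a b.+1 - P a b = w a b * X + (w a b.+1 - w a b) * p a b.+1.
  by rewrite /P /X; ring.
have hd := mul_sqr_le (wy a bB) p3; set d := (_ - _) * _ in hd *.
have hL : d ^+ 2 <= L a b.
  apply: le_trans hd _; rewrite /L /node_ctl mulrDl addrA.
  have k0 := K0 aA bB; have n0 := N0 aA bB.
  have A2 : 0 <= A%:R^-1 ^+ 2 * N a b by rewrite mulr_ge0// sqr_ge0.
  lra.
have h1 : (w a b * X) ^+ 2 <= 2 * ((w a b * X + d) ^+ 2 + d ^+ 2).
  have := sqrD_le2 (w a b * X + d) (- d); rewrite sqrrN.
  by have -> : w a b * X + d - d = w a b * X by ring.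
have h2 : X ^+ 2 <= 16 * (w a b * X) ^+ 2.
  rewrite exprMn mulrA -[leLHS]mul1r ler_wpM2r ?sqr_ge0//; nra.
lra.
Qed.

End Corner.

Lemma gsum_revl K A B : gsum (fun a b => K (A - a.+1)%N b) A B = gsum K A B.
Proof. by rewrite /gsum [RHS](reindex_inj rev_ord_inj). Qed.

Lemma gsum_revr K A B : gsum (fun a b => K a (B - b.+1)%N) A B = gsum K A B.
Proof. by rewrite gsumC (gsum_revl (fun a b => K b a)) -gsumC. Qed.

(** Reflecting the first axis, with a change of sign of [p], maps the right half to the left one.
    The shear of a reflected cell sits at its other lower corner and differs by the two horizontal
    differences of [p]; three squares give the 9 in [K']. *)
Lemma korn_bottom p q K N (A B : nat) : (0 < A)%N -> (0 < B)%N ->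
  (forall a b, (a < A)%N -> (b < B)%N -> cell_ctl p q K a b) ->
  (forall a b, (a < A)%N -> (b < B)%N -> node_bound p N a b) ->
  (forall a b, (a < A)%N -> (b < B)%N -> node_bound q N a b) ->
  gsum (fun a b => if (b.*2 <= B)%N then (p a b.+1 - p a b) ^+ 2 else 0) A B
  <= (19 * corner_const + 8) * gsum (node_ctl p q K N A B) A B.
Proof.
move=> A0 B0 ctl pN qN.
have K0 a b (aA : (a < A)%N) (bB : (b < B)%N) : 0 <= K a b.
  exact: cell_ctl_ge0 (ctl _ _ aA bB).
have N0 a b (aA : (a < A)%N) (bB : (b < B)%N) : 0 <= N a b.
  by have [h _ _ _] := pN _ _ aA bB; apply: le_trans h; apply: sqr_ge0.
have L0 : 0 <= gsum (node_ctl p q K N A B) A B.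
  by apply: gsum_ge0 => a b aA bB; apply: addr_ge0; [apply: K0|apply/node_term_ge0/N0].
pose p' a b := - p (A - a)%N b; pose q' a b := q (A - a)%N b.
pose K' a b := 9 * K (A - a.+1)%N b; pose N' a b := N (A - a.+1)%N b.
have E a : (a < A)%N -> exists2 c, (c < A)%N & (((A - a)%N = c.+1) * ((A - a.+1)%N = c))%type.
  by move=> aA; exists (A - a.+1)%N; [lia|split; lia].
have ctl' a b : (a < A)%N -> (b < B)%N -> cell_ctl p' q' K' a b.
  move=> aA bB; rewrite /cell_ctl /p' /q' /K'.
  have [c cA Ec] := E _ aA; rewrite !Ec.
  have [f F g G s] := ctl c b cA bB; have k0 := K0 c b cA bB.
  split.
  - by apply: le_trans (_ : K c b <= _); last lra; rewrite opprK addrC.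
  - by apply: le_trans (_ : K c b <= _); last lra; rewrite opprK addrC.
  - by lra.
  - by lra.
  - have nf : (- (p c.+1 b.+1 - p c b.+1)) ^+ 2 <= K c b by rewrite sqrrN.
    have ns : (- (p c b.+1 - p c b + (q c.+1 b - q c b))) ^+ 2 <= K c b.
      by rewrite sqrrN.
    have := lin3_sqr f nf ns.
    set u := (_ + _ + _) ^+ 2; set v := (_ - _ + (_ - _)) ^+ 2.
    by have -> : u = v; [rewrite /u /v; ring|lra].
have bnd (f f' : nat -> nat -> R) : (forall a b, f' a b ^+ 2 = f (A - a)%N b ^+ 2) ->
  (forall a b, (a < A)%N -> (b < B)%N -> node_bound f N a b) ->
  forall a b, (a < A)%N -> (b < B)%N -> node_bound f' N' a b.
  move=> ff fN a b aA bB; rewrite /node_bound /N' !ff.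
  have [c cA Ec] := E _ aA; rewrite !Ec.
  by have [? ? ? ?] := fN c b cA bB.
have L'le : gsum (node_ctl p' q' K' N' A B) A B <=
    9 * gsum (node_ctl p q K N A B) A B.
  rewrite -[X in _ <= _ * X]gsum_revl -gsumZ.
  apply: le_gsum => a b aA bB; rewrite /node_ctl /K' /N'.
  have [c cA ->] := E _ aA; rewrite mulrDr lerD2l.
  have : 0 <= (A%:R^-1 ^+ 2 + B%:R^-1 ^+ 2) * N c b.
    by apply/node_term_ge0/N0.
  lra.
pose F1 a b := if (a.*2 <= A)%N && (b.*2 <= B)%N
  then (p a b.+1 - p a b) ^+ 2 else 0.
pose F2 a b := if (a.*2 <= A)%N && (b.*2 <= B)%N
  then (p' a b.+1 - p' a b) ^+ 2 else 0.
set F := (X in gsum X _ _ <= _).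
have FF : gsum F A B <= gsum F1 A B + (2 * gsum F2 A B
    + 8 * gsum (node_ctl p q K N A B) A B).
  rewrite -(gsum_revl F2) -!gsumZ -!gsumD; apply: le_gsum => a b aA bB.
  rewrite /F /F1 /F2; have [b2|_] := ifP; last first.
    rewrite !andbF mulr0 !add0r; apply: mulr_ge0 => //; apply: addr_ge0.
      by apply: K0.
    by apply/node_term_ge0/N0.
  have hL : K a b <= node_ctl p q K N A B a b.
    by rewrite /node_ctl lerDl; apply/node_term_ge0/N0.
  have k0 := K0 a b aA bB.
  rewrite !andbT; have [a2|a2] := leqP a.*2 A.
    rewrite lerDl; apply: addr_ge0; apply: mulr_ge0 => //; last exact: le_trans hL.
    by case: ifP => // _; apply: sqr_ge0.
  (* The reflected estimate concerns the right edge of the cell, the goal its left edge. They differ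
     by the horizontal differences of [p] at top and bottom, which costs [8 * K a b]. *)
  have -> : ((A - a.+1).*2 <= A)%N by lia.
  rewrite /p'; have -> : (A - (A - a.+1) = a.+1)%N by lia.
  have [f1 f2 _ _ _] := ctl a b aA bB.
  have nf1 : (- (p a.+1 b.+1 - p a b.+1)) ^+ 2 <= K a b by rewrite sqrrN.
  have h := lin3_sqr (lexx (((p a.+1 b.+1 - p a.+1 b)) ^+ 2)) nf1 f1.
  have := sqrD_le2 (p a.+1 b.+1 - p a.+1 b)
    (- (p a.+1 b.+1 - p a b.+1) + (p a.+1 b - p a b)).
  have := sqrD_le2 (- (p a.+1 b.+1 - p a b.+1)) (p a.+1 b - p a b).
  have -> : p a.+1 b.+1 - p a.+1 b +
    (- (p a.+1 b.+1 - p a b.+1) + (p a.+1 b - p a b)) = p a b.+1 - p a b by ring.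
  have -> : (- p a.+1 b.+1 - - p a.+1 b) ^+ 2 = (p a.+1 b.+1 - p a.+1 b) ^+ 2.
    by ring.
  lra.
have H2 : gsum F2 A B <= _ := korn_corner A0 B0 ctl' (bnd p p' (fun a b => sqrrN _) pN)
   (bnd q q' (fun a b => erefl) qN).
have H1 : gsum F1 A B <= _ := korn_corner A0 B0 ctl pN qN.
have H3 := ler_wpM2l corner_const_ge0 L'le.
apply: (le_trans FF).
move: H1 H2 H3; clear.
set g1 := gsum F1 _ _; set g2 := gsum F2 _ _; set g3 := gsum _ _ _.
set g4 := gsum _ _ _; move: g1 g2 g3 g4 corner_const => g1 g2 g3 g4 c H1 H2 H3.
lra.
Qed.

(** Reflecting the second axis maps vertical edges to vertical edges of the same column, so here no
    passage to an opposite edge is needed. *)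
Lemma korn_grid p q K N (A B : nat) : (0 < A)%N -> (0 < B)%N ->
  (forall a b, (a < A)%N -> (b < B)%N -> cell_ctl p q K a b) ->
  (forall a b, (a < A)%N -> (b < B)%N -> node_bound p N a b) ->
  (forall a b, (a < A)%N -> (b < B)%N -> node_bound q N a b) ->
  vdiff_sq p A B
  <= grid_const * gsum (node_ctl p q K N A B) A B.
Proof.
move=> A0 B0 ctl pN qN.
have K0 a b (aA : (a < A)%N) (bB : (b < B)%N) : 0 <= K a b.
  exact: cell_ctl_ge0 (ctl _ _ aA bB).
have N0 a b (aA : (a < A)%N) (bB : (b < B)%N) : 0 <= N a b.
  by have [h _ _ _] := pN _ _ aA bB; apply: le_trans h; apply: sqr_ge0.
have L0 : 0 <= gsum (node_ctl p q K N A B) A B.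
  by apply: gsum_ge0 => a b aA bB; apply: addr_ge0; [apply: K0|apply/node_term_ge0/N0].
pose p' a b := p a (B - b)%N; pose q' a b := - q a (B - b)%N.
pose K' a b := 9 * K a (B - b.+1)%N; pose N' a b := N a (B - b.+1)%N.
have E b : (b < B)%N -> exists2 c, (c < B)%N & (((B - b)%N = c.+1) * ((B - b.+1)%N = c))%type.
  by move=> bB; exists (B - b.+1)%N; [lia|split; lia].
have ctl' a b : (a < A)%N -> (b < B)%N -> cell_ctl p' q' K' a b.
  move=> aA bB; rewrite /cell_ctl /p' /q' /K'.
  have [c cB Ec] := E _ bB; rewrite !Ec.
  have [f F g G s] := ctl a c aA cB; have k0 := K0 a c aA cB.
  split.
  - by lra.
  - by lra.
  - by apply: le_trans (_ : K a c <= _); last lra; rewrite opprK addrC.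
  - by apply: le_trans (_ : K a c <= _); last lra; rewrite opprK addrC.
  - have nG : (- (q a.+1 c.+1 - q a.+1 c)) ^+ 2 <= K a c by rewrite sqrrN.
    have ns : (- (p a c.+1 - p a c + (q a.+1 c - q a c))) ^+ 2 <= K a c.
      by rewrite sqrrN.
    have := lin3_sqr g nG ns.
    set u := (_ + _ + _) ^+ 2; set v := (_ - _ + (_ - _)) ^+ 2.
    by have -> : u = v; [rewrite /u /v; ring|lra].
have bnd (f f' : nat -> nat -> R) : (forall a b, f' a b ^+ 2 = f a (B - b)%N ^+ 2) ->
  (forall a b, (a < A)%N -> (b < B)%N -> node_bound f N a b) ->
  forall a b, (a < A)%N -> (b < B)%N -> node_bound f' N' a b.
  move=> ff fN a b aA bB; rewrite /node_bound /N' !ff.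
  have [c cB Ec] := E _ bB; rewrite !Ec.
  by have [? ? ? ?] := fN a c aA cB.
have L'le : gsum (node_ctl p' q' K' N' A B) A B <=
    9 * gsum (node_ctl p q K N A B) A B.
  rewrite -[X in _ <= _ * X]gsum_revr -gsumZ.
  apply: le_gsum => a b aA bB; rewrite /node_ctl /K' /N'.
  have [c cB ->] := E _ bB; rewrite mulrDr lerD2l.
  have : 0 <= (A%:R^-1 ^+ 2 + B%:R^-1 ^+ 2) * N a c.
    by apply/node_term_ge0/N0.
  lra.
pose F1 a b := if (b.*2 <= B)%N then (p a b.+1 - p a b) ^+ 2 else 0.
pose F2 a b := if (b.*2 <= B)%N then (p' a b.+1 - p' a b) ^+ 2 else 0.
have FF : vdiff_sq p A B <= gsum F1 A B + gsum F2 A B.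
  rewrite -(gsum_revr F2) -!gsumD; apply: le_gsum => a b aA bB.
  rewrite /F1 /F2 /p'; have [b2|b2] := leqP b.*2 B.
    by rewrite lerDl; case: ifP => // _; apply: sqr_ge0.
  have -> : ((B - b.+1).*2 <= B)%N by lia.
  have -> : (B - (B - b.+1) = b.+1)%N by lia.
  have -> : (B - (B - b.+1).+1 = b)%N by lia.
  by rewrite add0r -sqrrN opprB.
have H2 : gsum F2 A B <= _ := korn_bottom A0 B0 ctl' (bnd p p' (fun a b => erefl) pN)
   (bnd q q' (fun a b => sqrrN _) qN).
have H1 : gsum F1 A B <= _ := korn_bottom A0 B0 ctl pN qN.
have c0 : 0 <= 19 * corner_const + 8.
  by apply: addr_ge0 => //; apply: mulr_ge0 => //; apply: corner_const_ge0.
have H3 := ler_wpM2l c0 L'le.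
apply: (le_trans FF); rewrite /grid_const.
move: H1 H2 H3; clear.
set g1 := gsum F1 _ _; set g2 := gsum F2 _ _; set g3 := gsum _ _ _.
set g4 := gsum _ _ _; move: g1 g2 g3 g4 (_ + _) => g1 g2 g3 g4 c H1 H2 H3.
lra.
Qed.

End DiscreteKorn2.

(** * Domination of positive semidefinite forms *)

Section PsdForms.
Variables (R : realFieldType) (N : nat).
Implicit Types (x y z : 'rV[R]_N) (a b : 'rV[R]_N -> 'rV[R]_N -> R).

Definition lin_form (f : 'rV[R]_N -> R) : Prop :=
  forall c x y, f (c *: x + y) = c * f x + f y.

Definition psd_form b : Prop :=
  [/\ forall y, lin_form (b^~ y), forall x y, b x y = b y x &
      forall x, 0 <= b x x].

Lemma lin_formD f x y : lin_form f -> f (x + y) = f x + f y.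
Proof. by move=> lf; rewrite -[x]scale1r lf mul1r scale1r. Qed.

Lemma lin_form0 f : lin_form f -> f 0 = 0.
Proof.
by move=> lf; have := lf (-1) 0 0; rewrite scaler0 addr0 mulN1r addNr.
Qed.

Lemma lin_formZ f c x : lin_form f -> f (c *: x) = c * f x.
Proof. by move=> lf; rewrite -[c *: x]addr0 lf lin_form0// addr0. Qed.

Lemma lin_formE f x : lin_form f ->
  f x = \sum_i x 0 i * f (delta_mx 0 i).
Proof.
move=> lf; rewrite {1}[x]row_sum_delta.
rewrite (big_morph f (fun u v => lin_formD u v lf) (lin_form0 lf)).
by apply: eq_bigr => i _; rewrite lin_formZ.
Qed.

Section OneForm.
Variable b : 'rV[R]_N -> 'rV[R]_N -> R.
Hypothesis bP : psd_form b.

Lemma psd_sym x y : b x y = b y x. Proof. by case: bP. Qed.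
Lemma psd_ge0 x : 0 <= b x x. Proof. by case: bP. Qed.
Lemma psd_lin y : lin_form (b^~ y). Proof. by case: bP. Qed.
Lemma psd_linr x : lin_form (b x).
Proof. by move=> c y z; rewrite !(psd_sym x) (psd_lin x). Qed.

Lemma psd_sqrD t x y :
  b (t *: y + x) (t *: y + x) = t ^+ 2 * b y y + 2 * t * b x y + b x x.
Proof.
by rewrite (psd_lin _ t) !(psd_linr _ t) (psd_sym y x); ring.
Qed.

Lemma psd_cauchy x y : b x y ^+ 2 <= b x x * b y y.
Proof.
have [y0|yn0] := eqVneq (b y y) 0; last first.
  have := psd_ge0 ((- (b x y / b y y)) *: y + x); rewrite psd_sqrD.
  have yp : 0 < b y y by rewrite lt0r yn0 psd_ge0.
  rewrite -(ler_pM2r yp) mul0r.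
  have -> : ((- (b x y / b y y)) ^+ 2 * b y y + 2 * (- (b x y / b y y)) * b x y
    + b x x) * b y y = b x x * b y y - b x y ^+ 2 by field.
  lra.
rewrite y0 mulr0 le_eqVlt sqrf_eq0; apply/orP; left; apply: contraT => xy0.
(* With [b y y = 0] the form is affine along [y], and this multiple of [y] gives it the value -1. *)
have := psd_ge0 ((- (b x x + 1) / (2 * b x y)) *: y + x); rewrite psd_sqrD y0.
have -> : (- (b x x + 1) / (2 * b x y)) ^+ 2 * 0 +
  2 * (- (b x x + 1) / (2 * b x y)) * b x y + b x x = -1 by field.
lra.
Qed.

Definition gram : 'M[R]_N := \matrix_(i, j) b (delta_mx 0 i) (delta_mx 0 j).

Lemma gramE x y : b x y = (x *m gram *m y^T) 0 0.
Proof.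
rewrite -mulmxA mxE (lin_formE x (psd_lin y)); apply: eq_bigr => i _.
congr (_ * _); rewrite mxE (lin_formE y (psd_linr _)); apply: eq_bigr => j _.
by rewrite !mxE mulrC.
Qed.

Lemma psd_bound : exists2 C, 0 <= C &
  forall x, b x x <= C * \sum_k x 0 k ^+ 2.
Proof.
exists (\sum_i \sum_j `|b (delta_mx 0 i) (delta_mx 0 j)|).
  by apply: sumr_ge0 => i _; apply: sumr_ge0.
move=> x; rewrite {1}(lin_formE x (psd_lin x)) mulr_suml; apply: ler_sum => i _.
rewrite {1}(lin_formE x (psd_linr _)) mulr_sumr mulr_suml; apply: ler_sum => j _.
rewrite mulrA mulrC.
have le1 k : x 0 k ^+ 2 <= \sum_k x 0 k ^+ 2.
  by rewrite (bigD1 k)//= lerDl sumr_ge0// => l _; apply: sqr_ge0.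
have := le1 i; have := le1 j; set S := \sum_k _ => hj hi.
apply: le_trans (ler_norm _) _; rewrite normrM ler_wpM2l// normrM.
rewrite -!(real_normK (num_real (x 0 _))) in hi hj.
have := sqr_ge0 (`|x 0 i| - `|x 0 j|); nra.
Qed.

End OneForm.

(** Replaces compactness of the unit sphere by linear algebra: for every estimate on the reference
    cube only an inclusion of kernels remains to be checked. *)
Lemma psd_dominate a b : psd_form a -> psd_form b ->
  (forall x, b x x = 0 -> a x x = 0) ->
  exists2 C, 0 <= C & forall x, a x x <= C * b x x.
Proof.
move=> aP bP ker; pose G := gram b.
(* [G *m pinvmx G] is a projection with the same kernel as [b], and its
   coordinates are the functionals [b^~ (d k)], controlled by Cauchy-Schwarz. *)
pose d k := (col k (pinvmx G))^T.
have [A A0 hA] := psd_bound aP.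
exists (A * \sum_k b (d k) (d k)).
  by rewrite mulr_ge0// sumr_ge0// => k _; apply: psd_ge0.
move=> x; pose y := x *m G *m pinvmx G.
have zG : (x - y) *m G = 0 by rewrite mulmxBl mulmxKpV ?submxMl// subrr.
have az w : a (x - y) w = 0.
  apply/eqP; rewrite -sqrf_eq0 eq_le sqr_ge0 andbT.
  apply: le_trans (psd_cauchy aP _ _) _.
  by rewrite ker ?mul0r// (gramE bP) zG mul0mx mxE.
have -> : a x x = a y y.
  have {1 2}-> : x = 1 *: (x - y) + y by rewrite scale1r subrK.
  by rewrite (psd_sqrD aP) az (psd_sym aP y) az; ring.
apply: (le_trans (hA y)); rewrite -mulrA ler_wpM2l// mulr_suml.
apply: ler_sum => k _.
have -> : y 0 k = b x (d k).
  by rewrite (gramE bP) trmxK !mxE; apply: eq_bigr => j _; rewrite !mxE.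
by rewrite mulrC; apply: psd_cauchy.
Qed.

Lemma psdD a b : psd_form a -> psd_form b ->
  psd_form (fun x y => a x y + b x y).
Proof.
move=> [al as_ a0] [bl bs b0]; split=> [y c x x'|x y|x].
- by rewrite al bl; ring.
- by rewrite as_ bs.
- by rewrite addr_ge0.
Qed.

Lemma psd_sum (I : Type) (r : seq I) (P : pred I) (F : I -> _) :
  (forall i, P i -> psd_form (F i)) ->
  psd_form (fun x y => \sum_(i <- r | P i) F i x y).
Proof.
move=> FP; split=> [y c x x'|x y|x].
- rewrite mulr_sumr -big_split; apply: eq_bigr => i Pi.
  by have [-> _ _] := FP i Pi.
- by apply: eq_bigr => i Pi; have [_ -> _] := FP i Pi.
- by apply: sumr_ge0 => i Pi; have [_ _ ->] := FP i Pi.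
Qed.

Lemma psd_sqr f : lin_form f -> psd_form (fun x y => f x * f y).
Proof.
move=> lf; split=> [y c x x'|x y|x].
- by rewrite lf; ring.
- by rewrite mulrC.
- by rewrite -expr2 sqr_ge0.
Qed.

End PsdForms.

(** * Polynomials and their integrals over cubes *)

Section Univariate.
Variable R : realType.
Implicit Types (g G : {poly R}) (a b : R).

Lemma poly_primitive g : exists G, G^`() = g.
Proof.
exists (\poly_(i < (size g).+1) (g`_i.-1 / i%:R)).
apply/polyP => i; rewrite coef_deriv coef_poly ltnS.
have [ig|gi] := ltnP i (size g); last by rewrite mul0rn nth_default.
by rewrite -[LHS]mulr_natr divfK// pnatr_eq0.
Qed.

Lemma integrable_poly g a b :
  lebesgue_measure.-integrable `[a, b] (EFin \o horner g).
Proof.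
apply: continuous_compact_integrable; first exact: segment_compact.
by apply: continuous_subspaceT => x; apply: continuous_horner.
Qed.

Lemma Rintegral_poly g G a b : a < b -> G^`() = g ->
  \int[lebesgue_measure]_(t in `[a, b]) g.[t] = G.[b] - G.[a].
Proof.
move=> ab Gg; rewrite /Rintegral (@continuous_FTC2 _ (horner g) (horner G))//.
- by apply: continuous_subspaceT => x; apply: continuous_horner.
- split=> [x _||].
  + exact: derivable_horner.
  + by apply: cvg_at_right_filter; apply: continuous_horner.
  + by apply: cvg_at_left_filter; apply: continuous_horner.
- by move=> x _; rewrite -Gg -derivE.
Qed.

Lemma poly_zero_segment g a b : a < b ->
  (forall t, a <= t <= b -> g.[t] = 0) -> g = 0.
Proof.
move=> ab g0; apply: contrapT => /eqP gn0.
(* [size g] distinct points of the segment, more than the degree of [g]. *)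
pose s := [seq a + (b - a) / k.+1%:R | k <- iota 0 (size g)].
have /(max_poly_roots gn0) : all (root g) s.
  apply/allP => _ /mapP[k _ ->]; apply/rootP/g0.
  have k0 : (0 : R) < k.+1%:R by rewrite ltr0n.
  rewrite lerDl divr_ge0 ?subr_ge0 ?(ltW ab)//=.
  rewrite addrC -lerBrDr ler_pdivrMr// ler_peMr ?subr_ge0 ?(ltW ab)//.
  by rewrite ler1n.
rewrite size_map size_iota ltnn => H0; suff: false by []; apply: H0.
rewrite map_inj_uniq ?iota_uniq// => k l /addrI/(mulfI _) H.
have /H /invr_inj /(@mulrIn R 1) : b - a != 0 by rewrite subr_eq0 gt_eqF.
by rewrite oner_eq0 => /(_ isT) [].
Qed.

(** A primitive is nondecreasing with equal values at both ends, hence constant on the segment,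
    hence constant as a polynomial. *)
Lemma Rintegral_poly_eq0 g a b : a < b ->
  (forall t, a <= t <= b -> 0 <= g.[t]) ->
  \int[lebesgue_measure]_(t in `[a, b]) g.[t] = 0 -> g = 0.
Proof.
move=> ab g0; have [G Gg] := poly_primitive g.
rewrite (Rintegral_poly ab Gg) => /eqP; rewrite subr_eq0 => /eqP GG.
have mono x y : a <= x -> x <= y -> y <= b -> G.[x] <= G.[y].
  move=> ax; rewrite le_eqVlt => /predU1P[->//|xy] yb.
  rewrite -subr_ge0 -(Rintegral_poly xy Gg); apply: Rintegral_ge0 => t /=.
  rewrite in_itv /= => /andP[xt ty]; apply: g0.
  by rewrite (le_trans ax xt) (le_trans ty yb).
have /eqP : G - G.[a]%:P = 0.
  apply: (poly_zero_segment ab) => t /andP[at_ tb].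
  rewrite !hornerE; apply/eqP; rewrite subr_eq0 eq_le.
  by rewrite -{1}GG !mono// ltW.
by rewrite subr_eq0 => /eqP GC; rewrite -Gg GC derivC.
Qed.

(** Both sides are evaluated through a primitive. The interval keeps the form [0 + 1] in which
    [iterint] over the unit cube presents it. *)
Lemma Rintegral_poly_scale g a e : 0 < e ->
  \int[lebesgue_measure]_(t in `[a, a + e]) g.[t] =
  e * \int[lebesgue_measure]_(t in `[0, 0 + 1]) g.[a + e * t].
Proof.
move=> e0; have [G Gg] := poly_primitive g.
rewrite (Rintegral_poly _ Gg); last by rewrite ltrDl.
pose l : {poly R} := a%:P + e *: 'X.
have lE t : l.[t] = a + e * t by rewrite !hornerE.
have -> : (fun t => g.[a + e * t]) = (fun t => (g \Po l).[t]).
  by apply/funext => t; rewrite horner_comp lE.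
rewrite (@Rintegral_poly _ (e^-1 *: (G \Po l))); last 2 first.
- by rewrite add0r.
- rewrite derivZ deriv_comp Gg derivD derivC add0r derivZ derivX.
  by rewrite -scalerAr mulr1 scalerA mulVf ?gt_eqF// scale1r.
rewrite !hornerZ !horner_comp !lE mulr0 add0r mulr1 addr0.
by rewrite -mulrBr mulrA divff ?gt_eqF// mul1r.
Qed.

End Univariate.

Section Multivariate.
Variables (R : realType) (n : nat).
Implicit Types (p q : mpoly n R) (x y : 'rV[R]_n) (i j : 'I_n).

Lemma mpoly_ring_ind (P : mpoly n R -> Prop) :
  (forall c, P (mpolyC n c)) -> (forall i, P (pvar i)) ->
  (forall p q, P p -> P q -> P (p + q)) ->
  (forall p q, P p -> P q -> P (p * q)) -> forall p, P p.
Proof.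
move=> PC PX PD PM p; rewrite [p]mpolyE.
apply: (big_ind P); [by rewrite -mpolyC0; apply: PC|exact: PD|move=> m _].
rewrite -mul_mpolyC mpolyXE_id; apply: (PM _ _ (PC _)).
apply: (big_ind P); [by rewrite -mpolyC1; apply: PC|exact: PM|move=> i _].
elim: (m i) => [|k IH]; first by rewrite expr0 -mpolyC1.
by rewrite exprS; apply: PM => //; apply: PX.
Qed.

Lemma pevalD p q x : peval (p + q) x = peval p x + peval q x.
Proof. exact: mevalD. Qed.
Lemma pevalM p q x : peval (p * q) x = peval p x * peval q x.
Proof. exact: mevalM. Qed.
Lemma pevalC c x : peval (mpolyC n c) x = c.
Proof. exact: mevalC. Qed.
Lemma pevalZ c p x : peval (c *: p) x = c * peval p x.
Proof. exact: mevalZ. Qed.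
Lemma peval_var i x : peval (pvar i) x = x 0 i.
Proof. exact: mevalXU. Qed.

(** The restriction of [p] to the line through [x] parallel to the [i]-th axis; it carries calculus
    in one variable over to iterated integrals. *)
Definition line p x i : {poly R} :=
  mmap (@polyC R) (fun j => if j == i then 'X else (x 0 j)%:P) p.

Lemma lineD p q x i : line (p + q) x i = line p x i + line q x i.
Proof. exact: mmapD. Qed.

Lemma lineM p q x i : line (p * q) x i = line p x i * line q x i.
Proof. exact: rmorphM. Qed.

Lemma line_horner p x i t : (line p x i).[t] = peval p (upd x i t).
Proof.
elim/mpoly_ring_ind: p => [c|j|p q hp hq|p q hp hq].
- by rewrite /line mmapC pevalC hornerC.
- rewrite /line mmapX mmap1U peval_var mxE.
  by case: ifP; rewrite ?hornerX ?hornerC.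
- by rewrite lineD hornerD hp hq pevalD.
- by rewrite lineM hornerM pevalM -hp -hq.
Qed.

Lemma mderiv_var i j : mderiv i (pvar j) = mpolyC n (j == i)%:R :> mpoly n R.
Proof.
rewrite /pvar mderivX mnm1E; have [->|_] := eqVneq j i; last first.
  by rewrite scale0r mpolyC0.
rewrite scale1r; suff -> : mnm_sub (mnm1 i) (mnm1 i) = mnm0.
  by rewrite mpolyX0 mpolyC1.
by apply/mnmP => k; rewrite mnmBE mnm0E subnn.
Qed.

Lemma line_deriv p x i : (line p x i)^`() = line (mderiv i p) x i.
Proof.
elim/mpoly_ring_ind: p => [c|j|p q hp hq|p q hp hq].
- by rewrite mderivC /line mmapC derivC mmap0.
- rewrite mderiv_var /line mmapX mmap1U mmapC.
  by have [_|_] := eqVneq j i; rewrite ?derivX ?derivC ?polyC1 ?polyC0.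
- by rewrite mderivD !lineD derivD hp hq.
- by rewrite mderivM lineD !lineM derivM hp hq.
Qed.

Lemma Ptot_mono k l p : (k <= l)%N -> Ptot k p -> Ptot l p.
Proof. by move=> kl hp m /hp /leq_trans; apply. Qed.

Lemma Ptot_D k p q : Ptot k p -> Ptot k q -> Ptot k (p + q).
Proof.
by move=> hp hq m /msuppD_le; rewrite mem_cat => /orP[/hp|/hq].
Qed.

Lemma Ptot_N k p : Ptot k p -> Ptot k (- p).
Proof. by move=> hp m; rewrite (perm_mem (msuppN p)); apply: hp. Qed.

Lemma Ptot_M k l p q : Ptot k p -> Ptot l q -> Ptot (k + l) (p * q).
Proof.
move=> hp hq m /msuppM_le /allpairsP[[m1 m2] /= [/hp h1 /hq h2 ->]].
by rewrite mdegD leq_add.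
Qed.

Lemma Ptot_C k c : Ptot k (mpolyC n c : mpoly n R).
Proof.
move=> m; rewrite msuppC; case: ifP => // _; rewrite inE => /eqP->.
by rewrite mdeg0.
Qed.

Lemma Ptot_Z k c p : Ptot k p -> Ptot k (c *: p).
Proof. by rewrite -mul_mpolyC -[k]add0n; apply: Ptot_M; apply: Ptot_C. Qed.

Lemma Ptot_var i : Ptot 1 (pvar i : mpoly n R).
Proof. by move=> m /mem_msuppXP <-; rewrite mdeg1. Qed.

Lemma Ptot_deriv k i p : Ptot k p -> Ptot k.-1 (mderiv i p).
Proof.
move=> hp m; rewrite mcoeff_msupp mcoeff_deriv => h.
have /hp : mnm_add m (mnm1 i) \in msupp p.
  by rewrite mcoeff_msupp; apply: contraNneq h => ->; rewrite mul0rn.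
by rewrite mdegD mdeg1 addn1; case: (k).
Qed.

Lemma Ptot_sum k (I : Type) (r : seq I) (P : pred I) (F : I -> mpoly n R) :
  (forall l, P l -> Ptot k (F l)) -> Ptot k (\sum_(l <- r | P l) F l).
Proof.
move=> h; apply: (big_ind (Ptot k)) => //; last exact: Ptot_D.
by rewrite -mpolyC0; apply: Ptot_C.
Qed.

Lemma Ptot_exp k l p : Ptot k p -> Ptot (k * l) (p ^+ l).
Proof.
move=> hp; elim: l => [|l IH]; first by rewrite expr0 -mpolyC1; apply: Ptot_C.
by rewrite exprS mulnS; apply: Ptot_M.
Qed.

Lemma Ptot_msize k p : Ptot k p -> (msize p <= k.+1)%N.
Proof.
by move=> hp; rewrite msizeE; apply/bigmax_leqP_seq => m /hp.
Qed.

Lemma Ptot_ex p : exists k, Ptot k p.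
Proof.
by exists (msize p) => m /msize_mdeg_lt /ltnW.
Qed.

Lemma deriv0_const p : (forall i, mderiv i p = 0) -> p = mpolyC n (mcoeff mnm0 p).
Proof.
move=> dp; apply/mpolyP => m; rewrite mcoeffC.
have [->|mn0] := eqVneq m mnm0; first by rewrite mulr1.
rewrite mulr0.
have [i mi] : exists i, (0 < m i)%N.
  apply/existsP; apply: contraR mn0; rewrite negb_exists => /forallP h.
  by apply/eqP/mnmP => i; rewrite mnm0E; apply/eqP; rewrite -leqn0 leqNgt.
have : mcoeff (mnm_sub m (mnm1 i)) (mderiv i p) = 0 by rewrite dp mcoeff0.
rewrite mcoeff_deriv.
have -> : mnm_add (mnm_sub m (mnm1 i)) (mnm1 i) = m.
  apply/mnmP => j; rewrite mnmDE mnmBE mnm1E subnK//.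
  by case: eqP => // <-.
by move/eqP; rewrite mulrn_eq0 => /orP[//|/eqP->].
Qed.

Lemma upd_id x i : upd x i (x 0 i) = x.
Proof.
by apply/rowP => j; rewrite mxE; case: eqP => // ->.
Qed.

(** Induction on the degree: each partial derivative also vanishes on the box, because [p] vanishes
    on whole segments there. A polynomial without derivatives is constant. *)
Lemma mpoly_zero_box p :
  (forall x, (forall i, 0 <= x 0 i <= 1) -> peval p x = 0) -> p = 0.
Proof.
have const0 q : (forall i, mderiv i q = 0) ->
    (forall x, (forall i, 0 <= x 0 i <= 1) -> peval q x = 0) -> q = 0.
  move=> dq q0; have E := deriv0_const dq; rewrite E.
  rewrite -[X in mpolyC n X](pevalC _ 0) -E q0 ?mpolyC0// => i.
  by rewrite mxE lexx ler01.
have [k hp] := Ptot_ex p; elim: k => [|k IH] in p hp *; move=> p0.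
  have dp i : mderiv i p = 0.
    apply/mpolyP => m; rewrite mcoeff0 mcoeff_deriv memN_msupp_eq0 ?mul0rn//.
    by apply/negP => /hp; rewrite mdegD mdeg1 addn1.
  exact: const0.
have dp i : mderiv i p = 0.
  apply: IH; first exact: (Ptot_deriv (k := k.+1)).
  move=> x hx; rewrite -[x](upd_id x i) -line_horner -line_deriv.
  rewrite (poly_zero_segment (g := line p x i) ltr01) ?deriv0 ?horner0//.
  move=> t ht; rewrite line_horner; apply: p0 => j; rewrite mxE.
  by case: eqP.
exact: const0.
Qed.

Lemma strain0_rigid (v : 'rV[mpoly n R]_n) : (forall i j, strain v i j = 0) ->
  exists c a, [/\ forall i j, a i j = - a j i,
    forall i j, mderiv j (v 0 i) = mpolyC n (a i j) &
    forall i, v 0 i = mpolyC n (c i) + \sum_j a i j *: pvar j].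
Proof.
move=> v0.
have anti i j : mderiv i (v 0 j) = - mderiv j (v 0 i).
  have /eqP := v0 i j; rewrite /strain scaler_eq0 invr_eq0 pnatr_eq0 /=.
  by rewrite addr_eq0 => /eqP.
have d2 i k l : mderiv k (mderiv l (v 0 i)) = 0.
  (* Second derivatives are symmetric in the derivative indices and change sign when one of these is
     exchanged with the component; three such exchanges return the same term with the opposite
     sign. *)
  have E : mderiv k (mderiv l (v 0 i)) = - mderiv k (mderiv l (v 0 i)).
    rewrite {1}anti mderivN mderiv_comm anti mderivN opprK mderiv_comm.
    by rewrite anti mderivN mderiv_comm.
  have /eqP : (2 : R) *: mderiv k (mderiv l (v 0 i)) = 0.
    by rewrite scaler_nat mulr2n {2}E subrr.
  by rewrite scaler_eq0 pnatr_eq0 /= => /eqP.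
pose a i j := mcoeff mnm0 (mderiv j (v 0 i)).
have dE i j : mderiv j (v 0 i) = mpolyC n (a i j).
  by apply: deriv0_const => k; apply: d2.
exists (fun i => mcoeff mnm0 (v 0 i - \sum_j a i j *: pvar j)), a; split => //.
- move=> i j; rewrite /a anti.
  by rewrite mcoeffN.
- move=> i; rewrite -deriv0_const ?subrK// => j.
  rewrite mderivB dE.
  have -> : mderiv j (\sum_l a i l *: pvar l) = \sum_l mderiv j (a i l *: pvar l).
    exact: raddf_sum.
  rewrite (bigD1 j)//= big1 => [|k kj].
    by rewrite addr0 mderivZ mderiv_var eqxx mpolyC1 alg_mpolyC subrr.
  by rewrite mderivZ mderiv_var (negPf kj) mpolyC0 scaler0.
Qed.

End Multivariate.

Section Integrals.
Variables (R : realType) (n : nat).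
Implicit Types (p q : mpoly n R) (x y : 'rV[R]_n) (i j : 'I_n) (T : cube R n).

(** Keeps the integrand polynomial at every stage of [iterint], so that integrability is available
    at once and the univariate results apply. *)
Lemma integral_poly1 p i (a b : R) : exists q, forall x,
  \int[lebesgue_measure]_(t in `[a, b]) peval p (upd x i t) = peval q x.
Proof.
elim/mpolyind: p => [|c m p _ _ [q IH]].
  exists 0 => x; rewrite (_ : (fun t => _) = fun=> 0); last first.
    by apply/funext => t; rewrite -mpolyC0 pevalC.
  by rewrite Rintegral_cst// mul0r -mpolyC0 pevalC.
pose M : mpoly n R := \prod_(j | j != i) pvar j ^+ m j.
pose I := \int[lebesgue_measure]_(t in `[a, b]) ('X ^+ m i : {poly R}).[t].
exists ((c * I) *: M + q) => x.
pose g : {poly R} := (c * peval M x) *: 'X ^+ m i.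
have gE t : peval (c *: mpolyX R m) (upd x i t) = g.[t].
  rewrite pevalZ /g hornerZ -mulrA; congr (_ * _).
  rewrite mpolyXE_id /M (bigD1 i)//= pevalM mulrC; congr (_ * _).
    rewrite /peval !rmorph_prod /=; apply: eq_bigr => j ji.
    by rewrite !rmorphXn /= !mevalXU mxE (negPf ji).
  by rewrite /peval rmorphXn /= mevalXU mxE eqxx hornerXn.
rewrite (_ : (fun t => _) = fun t => g.[t] + (line p x i).[t]); last first.
  by apply/funext => t; rewrite pevalD gE line_horner.
rewrite RintegralD//; [|exact: integrable_poly..].
rewrite pevalD -IH; congr (_ + _); last first.
  by congr Rintegral; apply/funext => t; rewrite line_horner.
rewrite pevalZ /g (_ : horner _ = fun t => c * peval M x * ('X ^+ m i : {poly R}).[t]); last first.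
  by apply/funext => t; rewrite hornerZ.
rewrite RintegralZl//; last exact: integrable_poly.
by rewrite -/I; ring.
Qed.

Lemma iterint_poly T s p : exists q, forall x,
  iterint T s (peval p) x = peval q x.
Proof.
elim: s => [|i s [q IH]] /=; first by exists p.
have [r hr] := integral_poly1 q i (T.1 0 i) (T.1 0 i + T.2).
exists r => x; rewrite -hr; congr Rintegral.
by apply/funext => t; rewrite IH.
Qed.

Lemma iterint_line T s p x i : exists g : {poly R}, forall t,
  iterint T s (peval p) (upd x i t) = g.[t].
Proof.
have [q hq] := iterint_poly T s p.
by exists (line q x i) => t; rewrite hq line_horner.
Qed.

Lemma iterint_lin T s c p q x :
  iterint T s (peval (c *: p + q)) x =
  c * iterint T s (peval p) x + iterint T s (peval q) x.
Proof.
elim: s x => [|i s IH] x /=; first by rewrite pevalD pevalZ.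
have [g hg] := iterint_line T s p x i.
have [h hh] := iterint_line T s q x i.
rewrite (_ : (fun t => _) = fun t => c * g.[t] + h.[t]); last first.
  by apply/funext => t; rewrite IH hg hh.
rewrite RintegralD//; last 2 first.
- have /= := integrable_poly (c *: g) (T.1 0 i) (T.1 0 i + T.2).
  by apply: eq_integrable => // t _; rewrite /= hornerZ.
- exact: integrable_poly.
rewrite RintegralZl//; last exact: integrable_poly.
by congr (_ * _ + _); congr Rintegral; apply/funext => t; rewrite ?hg ?hh.
Qed.

Lemma iterint_ge0 T s (f : 'rV[R]_n -> R) x : (forall y, 0 <= f y) ->
  0 <= iterint T s f x.
Proof.
by move=> f0; elim: s x => [|i s IH] x //=; apply: Rintegral_ge0.
Qed.

(** The inner integral is a nonnegative polynomial in the outermost variable, so a vanishing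
    integral makes it vanish everywhere and not merely almost everywhere; the other coordinates
    follow by induction. *)
Lemma iterint_eq0 T s p x : 0 < T.2 -> (forall y, 0 <= peval p y) ->
  iterint T s (peval p) x = 0 ->
  forall y, (forall i, i \in s -> T.1 0 i <= y 0 i <= T.1 0 i + T.2) ->
    (forall i, i \notin s -> y 0 i = x 0 i) -> peval p y = 0.
Proof.
move=> T0 p0; elim: s x => [|i s IH] x /= I0 y ys yx.
  rewrite -I0; congr peval; apply/rowP => i; exact: yx.
have [g hg] := iterint_line T s p x i.
apply: (IH (upd x i (y 0 i))) => [|j js|j js].
- rewrite hg (_ : g = 0) ?horner0//.
  apply: (@Rintegral_poly_eq0 _ g (T.1 0 i) (T.1 0 i + T.2)).
  + by rewrite ltrDl.
  + by move=> t _; rewrite -hg; apply: iterint_ge0.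
  + rewrite -[RHS]I0; congr Rintegral; apply/funext => t; rewrite -hg//.
- by apply: ys; rewrite inE js orbT.
- rewrite mxE; case: eqP => [->//|/eqP ji]; apply: yx.
  by rewrite inE negb_or ji.
Qed.

Definition aff T x : 'rV[R]_n := \row_i (T.1 0 i + T.2 * x 0 i).

Definition pull T p : mpoly n R :=
  comp_mpoly [tuple mpolyC n (T.1 0 i) + T.2 *: pvar i | i < n] p.

Definition unit_cube : cube R n := (0, 1).

Lemma pullE T p x : peval (pull T p) x = peval p (aff T x).
Proof.
rewrite /peval comp_mpoly_meval; apply: meval_eq => i.
by rewrite tnth_mktuple -/(peval _ _) pevalD pevalC pevalZ peval_var mxE.
Qed.

Lemma pullD T p q : pull T (p + q) = pull T p + pull T q.
Proof. exact: raddfD. Qed.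

Lemma pullM T p q : pull T (p * q) = pull T p * pull T q.
Proof. exact: rmorphM. Qed.

Lemma pullZ T c p : pull T (c *: p) = c *: pull T p.
Proof. exact: linearZ. Qed.

Lemma pullC T c : pull T (mpolyC n c) = mpolyC n c.
Proof. exact: comp_mpolyC. Qed.

Lemma pull_var T i : pull T (pvar i) = mpolyC n (T.1 0 i) + T.2 *: pvar i.
Proof. by rewrite /pull comp_mpolyXU (nth_mktuple _ _ i). Qed.

Lemma pull_deriv T p i : mderiv i (pull T p) = T.2 *: pull T (mderiv i p).
Proof.
elim/mpoly_ring_ind: p => [c|j|p q hp hq|p q hp hq].
- by rewrite pullC !mderivC -mpolyC0 pullC mpolyC0 scaler0.
- rewrite pull_var mderivD mderivC add0r mderivZ mderiv_var.
  by rewrite pullC.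
- by rewrite pullD !mderivD hp hq pullD scalerDr.
- by rewrite pullM !mderivM hp hq pullD !pullM scalerDr -scalerAl -scalerAr.
Qed.

Lemma Ptot_pull T k p : Ptot k p -> Ptot k (pull T p).
Proof.
move=> hp; rewrite /pull comp_mpolyE.
rewrite big_seq; apply: Ptot_sum => m /hp hm; apply: Ptot_Z.
apply: (Ptot_mono hm); rewrite mdegE.
elim/big_rec2: _ => [|i q d _ hd]; first by rewrite -mpolyC1; apply: Ptot_C.
apply: Ptot_M => //; rewrite tnth_mktuple -[X in Ptot X]mul1n; apply: Ptot_exp.
by apply: Ptot_D; [apply: Ptot_C|apply/Ptot_Z/Ptot_var].
Qed.

Lemma iterint_scale T s p x : 0 < T.2 ->
  iterint T s (peval p) (aff T x) =
  T.2 ^+ size s * iterint unit_cube s (peval (pull T p)) x.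
Proof.
move=> T0; elim: s x => [|i s IH] x /=; first by rewrite mul1r pullE.
have [g hg] := iterint_line T s p (aff T x) i.
rewrite (_ : (fun t => _) = horner g); last by apply/funext => t; rewrite hg.
rewrite (Rintegral_poly_scale g _ T0) exprS -mulrA; congr (_ * _).
have [h hh] := iterint_line unit_cube s (pull T p) x i.
rewrite (_ : (fun t => g.[_]) = fun t => T.2 ^+ size s * h.[t]); last first.
  apply/funext => t; rewrite -hg -hh -IH; congr iterint.
  by apply/rowP => j; rewrite !mxE; case: eqP => // ->.
rewrite RintegralZl//; last exact: integrable_poly.
rewrite mxE; congr (_ * _); congr Rintegral.
by apply/funext => t; rewrite hh.
Qed.

Definition cell_form T p q : R := cell_int T (peval (p * q)).

Lemma L2sqE T p : L2sq T p = cell_form T p p.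
Proof.
by rewrite /L2sq /cell_form; congr cell_int; apply/funext => x; rewrite pevalM.
Qed.

Lemma peval_sqr_ge0 p y : 0 <= peval (p * p) y.
Proof. by rewrite pevalM -expr2 sqr_ge0. Qed.

Lemma L2sq_ge0 T p : 0 <= L2sq T p.
Proof. by apply: iterint_ge0 => y; apply: sqr_ge0. Qed.

Lemma aff0 T : aff T 0 = T.1.
Proof. by apply/rowP => i; rewrite !mxE mulr0 addr0. Qed.

Lemma L2sq_scale T p : 0 < T.2 ->
  L2sq T p = T.2 ^+ n * L2sq unit_cube (pull T p).
Proof.
move=> T0; rewrite !L2sqE /cell_form /cell_int -(aff0 T) iterint_scale//.
by rewrite size_enum_ord pullM.
Qed.

Lemma L2sq_unit_eq0 p : L2sq unit_cube p = 0 -> p = 0.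
Proof.
rewrite L2sqE /cell_form /cell_int => h; apply: mpoly_zero_box => x hx.
have /eqP : peval (p * p) x = 0.
  apply: (iterint_eq0 (T := unit_cube) _ (@peval_sqr_ge0 p) h) => [|i _|i].
  - exact: ltr01.
  - by rewrite mxE /= add0r.
  - by rewrite mem_enum.
by rewrite pevalM mulf_eq0 orbb => /eqP.
Qed.

Lemma facet_int_scale T i b p : 0 < T.2 ->
  facet_int T i b (fun x => peval p x ^+ 2) =
  T.2 ^+ n.-1 * facet_int unit_cube i b (fun x => peval (pull T p) x ^+ 2).
Proof.
move=> T0; rewrite /facet_int.
have sq (q : mpoly n R) : (fun x => peval q x ^+ 2) = peval (q * q).
  by apply/funext => x; rewrite pevalM.
rewrite !sq.
have -> : upd T.1 i (endpoint T i b) =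
    aff T (upd unit_cube.1 i (endpoint unit_cube i b)).
  apply/rowP => j; rewrite !mxE /endpoint /= !mxE; case: eqP => [->|_].
    by rewrite add0r mulr1 mulrC.
  by rewrite mulr0 addr0.
rewrite iterint_scale// -pullM; congr (_ ^+ _ * _).
by rewrite size_rem ?mem_enum// size_enum_ord.
Qed.

End Integrals.

(** * Local estimates on one cell *)

Section LocalEstimates.
Variables (R : realType) (n : nat).
Local Notation W := ('rV[mpoly n R]_n).
Implicit Types (p q : mpoly n R) (x y : 'rV[R]_n) (i j : 'I_n) (T : cube R n).
Implicit Types (v w : W).

Section Coefficients.
Variable k : nat.
Local Notation idx := (bmultinom n k * 'I_n)%type.

(** Turns fields of bounded degree into coefficient rows, to which [psd_dominate] applies.
    [bmultinom n k] holds the exponents of degree below [k], whence [d.+1] in [local_bound]. *)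
Definition vec (c : 'rV[R]_#|{: idx}|) : W :=
  \row_i \sum_(m : bmultinom n k) c 0 (enum_rank (m, i)) *: mpolyX R m.

Lemma vec_lin a c c' i : vec (a *: c + c') 0 i = a *: vec c 0 i + vec c' 0 i.
Proof.
rewrite !mxE scaler_sumr -big_split; apply: eq_bigr => m _.
by rewrite !mxE scalerDl scalerA.
Qed.

Lemma vec_surj v : (forall i, (msize (v 0%R i) <= k)%N) -> exists c, vec c = v.
Proof.
move=> vk; exists (\row_(l < #|{: idx}|) mcoeff (enum_val l : idx).1 (v 0 (enum_val l : idx).2)).
apply/rowP => i; rewrite mxE [RHS](mpolywE (vk i)); apply: eq_bigr => m _.
by rewrite mxE enum_rankK.
Qed.

End Coefficients.

Definition lin_fun (f : W -> R) : Prop :=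
  forall k, lin_form (fun c : 'rV_#|{: bmultinom n k * 'I_n}| => f (vec c)).

Definition lin_poly (L : W -> mpoly n R) : Prop :=
  forall k a (c c' : 'rV_#|{: bmultinom n k * 'I_n}|),
    L (vec (a *: c + c')) = a *: L (vec c) + L (vec c').

Definition psd_on (b : W -> W -> R) : Prop :=
  forall k, psd_form (fun c c' : 'rV_#|{: bmultinom n k * 'I_n}| =>
    b (vec c) (vec c')).

Lemma lin_poly_comp i : lin_poly (fun v => v 0 i).
Proof. by move=> k a c c'; apply: vec_lin. Qed.

Lemma lin_poly_deriv L i : lin_poly L -> lin_poly (fun v => mderiv i (L v)).
Proof. by move=> hL k a c c'; rewrite hL mderivD mderivZ. Qed.

Lemma lin_poly_strain i j : lin_poly (fun v => strain v i j).
Proof.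
move=> k a c c'; rewrite /strain !vec_lin !mderivD !mderivZ.
by rewrite scalerA mulrC -scalerA -scalerDr; congr (_ *: _); rewrite scalerDr addrACA.
Qed.

Lemma lin_fun_eval i x : lin_fun (fun v => peval (v 0 i) x).
Proof. by move=> k a c c'; rewrite vec_lin pevalD pevalZ. Qed.

Lemma lin_funD f g : lin_fun f -> lin_fun g -> lin_fun (fun v => f v + g v).
Proof. by move=> hf hg k a c c'; rewrite hf hg; ring. Qed.

Lemma lin_funB f g : lin_fun f -> lin_fun g -> lin_fun (fun v => f v - g v).
Proof. by move=> hf hg k a c c'; rewrite hf hg; ring. Qed.

Lemma psd_on_sqr f : lin_fun f -> psd_on (fun v w => f v * f w).
Proof. by move=> hf k; apply: (psd_sqr (hf k)). Qed.

Lemma psd_onD a b : psd_on a -> psd_on b -> psd_on (fun v w => a v w + b v w).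
Proof. by move=> ha hb k; apply: psdD (ha k) (hb k). Qed.

Lemma psd_on_sum (I : Type) (r : seq I) (P : pred I) (F : I -> W -> W -> R) :
  (forall l, P l -> psd_on (F l)) ->
  psd_on (fun v w => \sum_(l <- r | P l) F l v w).
Proof. by move=> hF k; apply: psd_sum => l Pl; apply: hF. Qed.

Lemma iterint0 T s x : iterint T s (peval (0 : mpoly n R)) x = 0.
Proof.
rewrite -[0 : mpoly n R](addNr 0) -scaleN1r iterint_lin.
by rewrite mulN1r addNr.
Qed.

Lemma cell_form0 T : cell_form T 0 0 = 0 :> R.
Proof. by rewrite /cell_form mul0r /cell_int iterint0. Qed.

Lemma psd_on_iterint T s x L : lin_poly L ->
  psd_on (fun v w => iterint T s (peval (L v * L w)) x).
Proof.
move=> hL k; split=> [c' a c1 c2|c c'|c].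
- by rewrite hL mulrDl -scalerAl iterint_lin.
- by rewrite mulrC.
- by apply: iterint_ge0 => y; apply: peval_sqr_ge0.
Qed.

Lemma psd_on_cell T L : lin_poly L ->
  psd_on (fun v w => cell_form T (L v) (L w)).
Proof. exact: psd_on_iterint. Qed.

Lemma local_bound d a b : psd_on a -> psd_on b ->
  (forall v, b v v = 0 -> a v v = 0) ->
  exists2 C, 0 <= C & forall v, (forall i, Ptot d (v 0 i)) ->
    a v v <= C * b v v.
Proof.
move=> ha hb ker.
have [C C0 hC] := psd_dominate (ha d.+1) (hb d.+1) (fun c => ker (vec c)).
exists C => // v hv.
have [c <-] : exists c, @vec d.+1 c = v.
  by apply: vec_surj => i; apply/Ptot_msize/hv.
exact: hC.
Qed.

Notation corners := {ffun 'I_n -> bool}.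

Definition corner T (s : corners) : 'rV[R]_n := \row_i endpoint T i (s i).

Definition set_corner (s : corners) i (b : bool) : corners :=
  [ffun j => if j == i then b else s j].

Definition corner0 : corners := [ffun=> false].
Definition corner1 j : corners := set_corner corner0 j true.

Definition cval T v i s : R := peval (v 0 i) (corner T s).

Definition edge_diff T v i s : R :=
  cval T v i (set_corner s i true) - cval T v i (set_corner s i false).

Definition incr T v i j : R := cval T v i (corner1 j) - cval T v i corner0.

Definition cell_strain T v : R := \sum_i \sum_j L2sq T (strain v i j).

Definition cell_mass T v : R := \sum_i L2sq T (v 0 i).

Definition cell_grad T v : R := \sum_i \sum_j L2sq T (mderiv j (v 0 i)).

Definition corner_mass T v : R := \sum_i \sum_s cval T v i s ^+ 2.

(* These corner values already determine a rigid motion, and the walk in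
   direction [e_i] that bounds them only meets facets with outer normal [e_i]. *)
Definition normal_mass T v : R := \sum_i \sum_(s : corners | s i) cval T v i s ^+ 2.

(** Gathers the differences that [cell_ctl] has to bound on the slices: [v_i] along every edge in
    direction [i], and the shears at the lower corner. All vanish on rigid motions. *)
Definition rigid_defect T v : R :=
  \sum_i \sum_s edge_diff T v i s ^+ 2 +
  \sum_i \sum_j (incr T v i j + incr T v j i) ^+ 2.

Definition incr_sq T v : R := \sum_i \sum_j incr T v i j ^+ 2.

Lemma lin_fun_cval T i s : lin_fun (fun v => cval T v i s).
Proof. exact: lin_fun_eval. Qed.

Lemma lin_fun_edge T i s : lin_fun (fun v => edge_diff T v i s).
Proof. by apply: lin_funB; apply: lin_fun_cval. Qed.

Lemma lin_fun_incr T i j : lin_fun (fun v => incr T v i j).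
Proof. by apply: lin_funB; apply: lin_fun_cval. Qed.

Let strain_form T v w : R :=
  \sum_i \sum_j cell_form T (strain v i j) (strain w i j).

Let psd_strain_form T : psd_on (strain_form T).
Proof.
apply: psd_on_sum => i _; apply: psd_on_sum => j _; apply: psd_on_cell.
exact: lin_poly_strain.
Qed.

Let strain_formE T v : strain_form T v v = cell_strain T v.
Proof.
by apply: eq_bigr => i _; apply: eq_bigr => j _; rewrite L2sqE.
Qed.

Lemma sumr2_eq0 (F : 'I_n -> 'I_n -> R) :
  (forall i j, 0 <= F i j) -> \sum_i \sum_j F i j = 0 -> forall i j, F i j = 0.
Proof.
move=> F0 /eqP; rewrite psumr_eq0 => [/allP h i j|i _]; last exact: sumr_ge0.
have := h i (mem_index_enum i); rewrite implyTb psumr_eq0//.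
by move=> /allP /(_ j (mem_index_enum j)) /eqP.
Qed.

Lemma cell_strain_eq0 v : cell_strain (unit_cube R n) v = 0 ->
  forall i j, strain v i j = 0.
Proof.
by move=> h i j; apply/L2sq_unit_eq0/(sumr2_eq0 _ h) => *; apply: L2sq_ge0.
Qed.

Lemma cell_strain_ge0 T v : 0 <= cell_strain T v.
Proof. by apply: sumr_ge0 => i _; apply: sumr_ge0 => j _; apply: L2sq_ge0. Qed.

Lemma peval_affine c (a : 'I_n -> R) x :
  peval (mpolyC n c + \sum_j a j *: pvar j) x = c + \sum_j a j * x 0 j.
Proof.
rewrite pevalD pevalC; congr (_ + _); rewrite /peval raddf_sum /=.
by apply: eq_bigr => j _; rewrite mevalZ mevalXU.
Qed.

Local Notation U := (unit_cube R n).

Lemma corner_unit s i : corner U s 0 i = (s i)%:R.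
Proof. by rewrite mxE /endpoint /= mxE add0r mulr1. Qed.

Lemma affine_incr c (a : 'I_n -> R) s i :
  (c + \sum_j a j * corner U (set_corner s i true) 0 j) -
  (c + \sum_j a j * corner U (set_corner s i false) 0 j) = a i.
Proof.
rewrite opprD addrACA subrr add0r -sumrB (bigD1 i)//= big1 => [|j ji].
  by rewrite !corner_unit !ffunE eqxx mulr1 mulr0 subr0 addr0.
by rewrite !corner_unit !ffunE (negPf ji) subrr.
Qed.

Lemma incrE T v i j : incr T v i j =
  cval T v i (set_corner corner0 j true) - cval T v i (set_corner corner0 j false).
Proof.
rewrite /incr; congr (_ - cval _ _ _ _).
by apply/ffunP => l; rewrite !ffunE if_same.
Qed.

Lemma rigid_bound_unit d : exists2 C, 0 <= C &
  forall v, (forall i, Ptot d (v 0 i)) ->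
    rigid_defect U v <= C * cell_strain U v.
Proof.
have psd : psd_on (fun v w =>
    \sum_i \sum_s edge_diff U v i s * edge_diff U w i s +
    \sum_i \sum_j (incr U v i j + incr U v j i) * (incr U w i j + incr U w j i)).
  apply: psd_onD; apply: psd_on_sum => i _; apply: psd_on_sum => j _.
    exact/psd_on_sqr/lin_fun_edge.
  apply: (psd_on_sqr (f := fun v => incr U v i j + incr U v j i)).
  by apply: lin_funD; apply: lin_fun_incr.
have [|C C0 hC] := local_bound d psd (psd_strain_form U).
  move=> v; rewrite strain_formE => /cell_strain_eq0 /strain0_rigid.
  move=> [c [a [aN _ vE]]].
  have eE i s : edge_diff U v i s = 0.
    rewrite /edge_diff /cval vE !peval_affine affine_incr.
    by have := aN i i; lra.
  have iE i j : incr U v i j + incr U v j i = 0.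
    by rewrite !incrE /cval !vE !peval_affine !affine_incr aN addNr.
  rewrite !big1 ?addr0// => i _; rewrite big1// => j _.
    by rewrite iE mul0r.
  by rewrite eE mul0r.
exists C => // v /hC; rewrite strain_formE; apply: le_trans.
by rewrite le_eqVlt; apply/orP; left; apply/eqP; congr (_ + _);
  apply: eq_bigr => i _; apply: eq_bigr => j _; rewrite expr2.
Qed.

Lemma grad_bound_unit d : exists2 C, 0 <= C &
  forall v, (forall i, Ptot d (v 0 i)) ->
    cell_grad U v <= C * (cell_strain U v + incr_sq U v).
Proof.
have psda : psd_on (fun v w => \sum_i \sum_j
    cell_form U (mderiv j (v 0 i)) (mderiv j (w 0 i))).
  apply: psd_on_sum => i _; apply: psd_on_sum => j _; apply: psd_on_cell.
  exact/lin_poly_deriv/lin_poly_comp.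
have psdb : psd_on (fun v w => strain_form U v w +
    \sum_i \sum_j incr U v i j * incr U w i j).
  apply: psd_onD => //; apply: psd_on_sum => i _; apply: psd_on_sum => j _.
  exact/psd_on_sqr/lin_fun_incr.
have iE v : \sum_i \sum_j incr U v i j * incr U v i j = incr_sq U v.
  by apply: eq_bigr => i _; apply: eq_bigr => j _; rewrite expr2.
have i0 v : 0 <= incr_sq U v.
  by apply: sumr_ge0 => i _; apply: sumr_ge0 => j _; apply: sqr_ge0.
have [|C C0 hC] := local_bound d psda psdb.
  move=> v; rewrite strain_formE iE => /eqP.
  rewrite paddr_eq0 ?cell_strain_ge0// => /andP[/eqP E0 /eqP I0].
  have [c [a [aN dE vE]]] := strain0_rigid (cell_strain_eq0 E0).
  apply: big1 => i _; apply: big1 => j _; rewrite dE.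
  have : incr U v i j ^+ 2 = 0.
    by apply: (sumr2_eq0 _ I0) => k l; apply: sqr_ge0.
  rewrite incrE /cval vE !peval_affine affine_incr => /eqP.
  by rewrite sqrf_eq0 => /eqP ->; rewrite mpolyC0 cell_form0.
exists C => // v /hC; rewrite strain_formE iE; apply: le_trans.
by apply: ler_sum => i _; apply: ler_sum => j _; rewrite L2sqE.
Qed.

Lemma mass_bound_unit d : exists2 C, 0 <= C &
  forall v, (forall i, Ptot d (v 0 i)) ->
    cell_mass U v <= C * (cell_strain U v + normal_mass U v).
Proof.
have psda : psd_on (fun v w => \sum_i cell_form U (v 0 i) (w 0 i)).
  apply: psd_on_sum => i _; apply: (@psd_on_cell _ (fun v => v 0 i)).
  exact: lin_poly_comp.
have psdb : psd_on (fun v w => strain_form U v w +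
    \sum_i \sum_(s : corners | s i) cval U v i s * cval U w i s).
  apply: psd_onD => //; apply: psd_on_sum => i _; apply: psd_on_sum => j _.
  exact/psd_on_sqr/lin_fun_cval.
have nE v : \sum_i \sum_(s : corners | s i) cval U v i s * cval U v i s =
    normal_mass U v.
  by apply: eq_bigr => i _; apply: eq_bigr => j _; rewrite expr2.
have n0 v : 0 <= normal_mass U v.
  by apply: sumr_ge0 => i _; apply: sumr_ge0 => j _; apply: sqr_ge0.
have [|C C0 hC] := local_bound d psda psdb.
  move=> v; rewrite strain_formE nE => /eqP.
  rewrite paddr_eq0 ?cell_strain_ge0// => /andP[/eqP E0 /eqP N0].
  have [c [a [aN dE vE]]] := strain0_rigid (cell_strain_eq0 E0).
  have ns i (s : corners) : s i -> c i + \sum_j a i j * corner U s 0 j = 0.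
    move=> si; move/eqP: N0; rewrite psumr_eq0 => [/allP h|k _]; last first.
      by apply: sumr_ge0 => l _; apply: sqr_ge0.
    have := h i (mem_index_enum i); rewrite implyTb psumr_eq0; last first.
      by move=> l _; apply: sqr_ge0.
    move=> /allP /(_ s (mem_index_enum s)); rewrite si /= sqrf_eq0.
    by rewrite /cval vE peval_affine => /eqP.
  have aii i : a i i = 0 by have := aN i i; lra.
  (* For [i != j], the corner [corner1 i] and its neighbour in direction [j] both lie on the upper
     facet orthogonal to [e_i]; the component [i] vanishes at both, and the difference of its values
     is [a i j]. *)
  have aij i j : a i j = 0.
    have [->//|ij] := eqVneq i j.
    rewrite -(affine_incr (c i) (a i) (corner1 i) j) !ns ?subrr// ffunE.
      by rewrite (negPf ij) !ffunE eqxx.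
    by rewrite (negPf ij) !ffunE eqxx.
  have ci i : c i = 0.
    rewrite -(ns i (corner1 i)) ?ffunE ?eqxx// big1 ?addr0// => j _.
    by rewrite aij mul0r.
  apply: big1 => i _; rewrite vE ci mpolyC0 add0r big1 ?cell_form0// => j _.
  by rewrite aij scale0r.
exists C => // v /hC; rewrite strain_formE nE; apply: le_trans.
by apply: ler_sum => i _; rewrite L2sqE.
Qed.

Lemma corner_bound_unit d : exists2 C, 0 <= C &
  forall v, (forall i, Ptot d (v 0 i)) ->
    corner_mass U v <= C * cell_mass U v.
Proof.
have psda : psd_on (fun v w => \sum_i \sum_s cval U v i s * cval U w i s).
  apply: psd_on_sum => i _; apply: psd_on_sum => j _.
  exact/psd_on_sqr/lin_fun_cval.
have psdb : psd_on (fun v w => \sum_i cell_form U (v 0 i) (w 0 i)).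
  apply: psd_on_sum => i _; apply: (@psd_on_cell _ (fun v => v 0 i)).
  exact: lin_poly_comp.
have mE v : \sum_i cell_form U (v 0 i) (v 0 i) = cell_mass U v.
  by apply: eq_bigr => i _; rewrite L2sqE.
have [|C C0 hC] := local_bound d psda psdb.
  move=> v; rewrite mE => /eqP; rewrite psumr_eq0 => [/allP h|i _]; last first.
    exact: L2sq_ge0.
  apply: big1 => i _; apply: big1 => s _.
  have := h i (mem_index_enum i); rewrite implyTb => /eqP /L2sq_unit_eq0 v0.
  by rewrite /cval v0 -mpolyC0 pevalC mul0r.
exists C => // v /hC; rewrite mE; apply: le_trans.
by apply: ler_sum => i _; apply: ler_sum => s _; rewrite expr2.
Qed.

Lemma facet_bound_unit d : exists2 C, 0 <= C &
  forall v i, (forall i, Ptot d (v 0 i)) ->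
    \sum_(s : corners | s i) cval U v i s ^+ 2 <=
    C * facet_int U i true (fun x => peval (v 0 i) x ^+ 2).
Proof.
suff /choice[C hC] : forall i, exists C, 0 <= C /\
  forall v, (forall i, Ptot d (v 0 i)) ->
    \sum_(s : corners | s i) cval U v i s ^+ 2 <=
    C * facet_int U i true (fun x => peval (v 0 i) x ^+ 2).
  exists (\sum_i C i); first by apply: sumr_ge0 => i _; have [] := hC i.
  move=> v i hv; have [Ci h] := hC i; apply: (le_trans (h v hv)).
  rewrite ler_wpM2r//; first by apply: iterint_ge0 => y; apply: sqr_ge0.
  rewrite (bigD1 i)//= lerDl sumr_ge0// => j _.
  by have [] := hC j.
move=> i.
have psda : psd_on (fun v w => \sum_(s : corners | s i) cval U v i s * cval U w i s).
  by apply: psd_on_sum => j _; apply/psd_on_sqr/lin_fun_cval.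
have psdb : psd_on (fun v w => facet_int U i true (peval (v 0 i * w 0 i))).
  apply: (@psd_on_iterint _ _ _ (fun v => v 0 i)).
  exact: lin_poly_comp.
have fE v : facet_int U i true (peval (v 0 i * v 0 i)) =
    facet_int U i true (fun x => peval (v 0 i) x ^+ 2).
  by congr facet_int; apply/funext => x; rewrite pevalM.
have [|C C0 hC] := local_bound d psda psdb.
  move=> v h; apply: big1 => s si; rewrite /cval.
  have := iterint_eq0 (T := U) ltr01 (@peval_sqr_ge0 _ _ (v 0 i)) h.
  move=> /(_ (corner U s)); rewrite pevalM; apply=> j.
    rewrite mem_rem_uniq ?enum_uniq// => _.
    by rewrite corner_unit mxE add0r ler0n lern1 leq_b1.
  rewrite mem_rem_uniq ?enum_uniq// !inE mem_enum andbT negbK => /eqP ->.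
  by rewrite !mxE eqxx si.
exists C; split=> // v /hC; rewrite fE; apply: le_trans.
by apply: ler_sum => s _; rewrite expr2.
Qed.

End LocalEstimates.

(** * Scaling of the local estimates to arbitrary cubes *)

Section ScaledEstimates.
Variables (R : realType) (n : nat).
Local Notation W := ('rV[mpoly n R]_n).
Implicit Types (p q : mpoly n R) (x y : 'rV[R]_n) (i j : 'I_n) (T : cube R n).
Implicit Types (v w : W).
Local Notation U := (unit_cube R n).

Definition pullv T v : W := \row_i pull T (v 0 i).

Lemma pullv_Ptot T d v : (forall i, Ptot d (v 0 i)) ->
  forall i, Ptot d (pullv T v 0 i).
Proof. by move=> hv i; rewrite mxE; apply: Ptot_pull. Qed.

Lemma cval_pull T v i s : cval U (pullv T v) i s = cval T v i s.
Proof.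
rewrite /cval mxE pullE; congr peval; apply/rowP => j.
by rewrite !mxE /endpoint /= mxE add0r mulr1 mulrC.
Qed.

Lemma L2sqZ T c p : L2sq T (c *: p) = c ^+ 2 * L2sq T p.
Proof.
rewrite !L2sqE /cell_form -scalerAl -scalerAr /cell_int.
rewrite -[c *: _]addr0 iterint_lin iterint0 -[c *: _]addr0 iterint_lin iterint0.
by ring.
Qed.

Lemma rigid_defect_pull T v : rigid_defect U (pullv T v) = rigid_defect T v.
Proof.
congr (_ + _); apply: eq_bigr => i _; apply: eq_bigr => j _.
  by rewrite /edge_diff !cval_pull.
by rewrite /incr !cval_pull.
Qed.

Lemma incr_sq_pull T v : incr_sq U (pullv T v) = incr_sq T v.
Proof.
by apply: eq_bigr => i _; apply: eq_bigr => j _; rewrite /incr !cval_pull.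
Qed.

Lemma normal_mass_pull T v : normal_mass U (pullv T v) = normal_mass T v.
Proof. by apply: eq_bigr => i _; apply: eq_bigr => j _; rewrite !cval_pull. Qed.

Lemma corner_mass_pull T v : corner_mass U (pullv T v) = corner_mass T v.
Proof. by apply: eq_bigr => i _; apply: eq_bigr => j _; rewrite !cval_pull. Qed.

Lemma cell_mass_pull T v : 0 < T.2 ->
  T.2 ^+ n * cell_mass U (pullv T v) = cell_mass T v.
Proof.
move=> T0; rewrite mulr_sumr; apply: eq_bigr => i _.
by rewrite mxE (L2sq_scale _ T0).
Qed.

(** Integration contributes [T.2 ^+ n] and each derivative of the pull-back a factor [T.2]. Powers
    on both sides avoid the exponent [n - 2]. *)
Lemma cell_grad_pull T v : 0 < T.2 ->
  T.2 ^+ n * cell_grad U (pullv T v) = T.2 ^+ 2 * cell_grad T v.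
Proof.
move=> T0; rewrite !mulr_sumr; apply: eq_bigr => i _.
rewrite !mulr_sumr; apply: eq_bigr => j _.
by rewrite mxE pull_deriv L2sqZ (L2sq_scale _ T0) mulrCA.
Qed.

Lemma cell_strain_pull T v : 0 < T.2 ->
  T.2 ^+ n * cell_strain U (pullv T v) = T.2 ^+ 2 * cell_strain T v.
Proof.
move=> T0; rewrite !mulr_sumr; apply: eq_bigr => i _.
rewrite !mulr_sumr; apply: eq_bigr => j _.
have -> : strain (pullv T v) i j = T.2 *: pull T (strain v i j).
  by rewrite /strain !mxE !pull_deriv -scalerDr -pullD pullZ !scalerA mulrC.
by rewrite L2sqZ (L2sq_scale _ T0) mulrCA.
Qed.

Section Bounds.
Variable d : nat.

Lemma rigid_bound : exists2 C, 0 <= C &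
  forall T v, 0 < T.2 -> (forall i, Ptot d (v 0 i)) ->
    T.2 ^+ n * rigid_defect T v <= C * (T.2 ^+ 2 * cell_strain T v).
Proof.
have [C C0 hC] := rigid_bound_unit R n d; exists C => // T v T0 hv.
rewrite -cell_strain_pull// -rigid_defect_pull mulrCA ler_wpM2l ?exprn_ge0 ?(ltW T0)//.
exact/hC/pullv_Ptot.
Qed.

Lemma grad_bound : exists2 C, 0 <= C &
  forall T v, 0 < T.2 -> (forall i, Ptot d (v 0 i)) ->
    T.2 ^+ 2 * cell_grad T v <=
    C * (T.2 ^+ 2 * cell_strain T v + T.2 ^+ n * incr_sq T v).
Proof.
have [C C0 hC] := grad_bound_unit R n d; exists C => // T v T0 hv.
rewrite -cell_strain_pull// -incr_sq_pull -mulrDr mulrCA -cell_grad_pull//.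
by rewrite ler_wpM2l ?exprn_ge0 ?(ltW T0)//; apply/hC/pullv_Ptot.
Qed.

Lemma mass_bound : exists2 C, 0 <= C &
  forall T v, 0 < T.2 -> (forall i, Ptot d (v 0 i)) ->
    cell_mass T v <=
    C * (T.2 ^+ 2 * cell_strain T v + T.2 ^+ n * normal_mass T v).
Proof.
have [C C0 hC] := mass_bound_unit R n d; exists C => // T v T0 hv.
rewrite -cell_strain_pull// -normal_mass_pull -mulrDr mulrCA -cell_mass_pull//.
by rewrite ler_wpM2l ?exprn_ge0 ?(ltW T0)//; apply/hC/pullv_Ptot.
Qed.

Lemma corner_bound : exists2 C, 0 <= C &
  forall T v, 0 < T.2 -> (forall i, Ptot d (v 0 i)) ->
    T.2 ^+ n * corner_mass T v <= C * cell_mass T v.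
Proof.
have [C C0 hC] := corner_bound_unit R n d; exists C => // T v T0 hv.
rewrite -cell_mass_pull// -corner_mass_pull mulrCA.
by rewrite ler_wpM2l ?exprn_ge0 ?(ltW T0)//; apply/hC/pullv_Ptot.
Qed.

(** A facet integral scales with the power [n.-1]; the additional [T.2] is the factor that later
    pairs with the number of steps of a walk. *)
Lemma facet_bound : exists2 C, 0 <= C &
  forall T v i, 0 < T.2 -> (forall i, Ptot d (v 0 i)) ->
    T.2 ^+ n * \sum_(s : {ffun 'I_n -> bool} | s i) cval T v i s ^+ 2 <=
    C * (T.2 * facet_int T i true (fun x => peval (v 0 i) x ^+ 2)).
Proof.
have [C C0 hC] := facet_bound_unit R n d; exists C => // T v i T0 hv.
rewrite (facet_int_scale _ _ _ T0) mulrA -exprS prednK ?(leq_ltn_trans _ (ltn_ord i))//.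
rewrite mulrCA ler_wpM2l ?exprn_ge0 ?(ltW T0)//.
have := hC (pullv T v) i (pullv_Ptot hv); rewrite mxE; apply: le_trans.
by rewrite le_eqVlt; apply/orP; left; apply/eqP/eq_bigr => s _; rewrite cval_pull.
Qed.

End Bounds.
End ScaledEstimates.

(** * Finite element spaces *)

Section DegreeBounds.
Variable R : realType.

Lemma Ppart_Ptot n (d : 'I_n -> nat) r (p : mpoly n R) :
  (forall i, (d i <= r)%N) -> Ppart d p -> Ptot (n * r) p.
Proof.
move=> dr hp m /hp hm; rewrite mdegE -[X in (X * _)%N]card_ord -sum_nat_const.
by apply: leq_sum => i _; apply: leq_trans (hm i) (dr i).
Qed.

(** The variables outside the superlinear part enter with power at most 1 and number at most [n]. *)
Lemma Sser_Ptot n r (p : mpoly n R) : Sser r p -> Ptot (r + n) p.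
Proof.
move=> hp m /hp hm; rewrite mdegE (bigID (fun i => 2 <= m i)%N) /=.
apply: leq_add => //; rewrite -[X in (_ <= X)%N]card_ord -sum1_card.
rewrite [X in (_ <= X)%N](bigID (fun i => 2 <= m i)%N) /= -[X in (X <= _)%N]add0n.
by apply: leq_add => //; apply: leq_sum => i; rewrite -ltnNge.
Qed.

Lemma Ptot_B n k (p q : mpoly n R) : Ptot k p -> Ptot k q -> Ptot k (p - q).
Proof. by move=> hp hq; apply: Ptot_D => //; apply: Ptot_N. Qed.

Lemma Ptot_deriv_le n k i (p : mpoly n R) : Ptot k p -> Ptot k (mderiv i p).
Proof. by move/(Ptot_deriv (i := i)); apply: Ptot_mono; apply: leq_pred. Qed.

Lemma Pvec_mono n k l (v : 'rV[mpoly n R]_n) : (k <= l)%N ->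
  Pvec k v -> Pvec l v.
Proof. by move=> kl hv i; apply: Ptot_mono (hv i). Qed.

Lemma Pvec_D n k (v w : 'rV[mpoly n R]_n) : Pvec k v -> Pvec k w ->
  Pvec k (v + w).
Proof. by move=> hv hw i; rewrite mxE; apply: Ptot_D. Qed.

Lemma Pvec_Z n k l c (v : 'rV[mpoly n R]_n) : Ptot k c -> Pvec l v ->
  Pvec (k + l) (c *: v).
Proof. by move=> hc hv i; rewrite mxE; apply: Ptot_M. Qed.

Lemma Pvec_vec2 k (a b : mpoly 2 R) : Ptot k a -> Ptot k b ->
  Pvec k (vec2 a b).
Proof. by move=> ha hb i; rewrite mxE; case: i => [[|[|]]]. Qed.

Lemma Pvec_vec3 k (a b c : mpoly 3 R) : Ptot k a -> Ptot k b -> Ptot k c ->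
  Pvec k (vec3 a b c).
Proof. by move=> ha hb hc i; rewrite mxE; case: i => [[|[|[|]]]]. Qed.

Lemma Pvec_curl2 k (p : mpoly 2 R) : Ptot k p -> Pvec k (curl2 p).
Proof.
by move=> hp; apply: Pvec_vec2; [apply: Ptot_N|]; apply: Ptot_deriv_le.
Qed.

Lemma Pvec_curl3 k (v : 'rV[mpoly 3 R]_3) : Pvec k v -> Pvec k (curl3 v).
Proof.
by move=> hv; apply: Pvec_vec3; apply: Ptot_B; apply: Ptot_deriv_le.
Qed.

Lemma Pvec_pcross k l (v w : 'rV[mpoly 3 R]_3) : Pvec k v -> Pvec l w ->
  Pvec (k + l) (pcross v w).
Proof. by move=> hv hw; apply: Pvec_vec3; apply: Ptot_B; apply: Ptot_M. Qed.

Lemma Pvec_position n : Pvec 1 (position : 'rV[mpoly n R]_n).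
Proof. by move=> i; rewrite mxE; apply: Ptot_var. Qed.

Lemma Pvec_pgrad n k (p : mpoly n R) : Ptot k p -> Pvec k (pgrad p).
Proof. by move=> hp i; rewrite mxE; apply: Ptot_deriv_le. Qed.

Lemma Pvec_Phi k (w : 'rV[mpoly 3 R]_3) : Pvec k w -> Pvec (2 + k) (Phi w).
Proof.
move=> hw; apply: Pvec_vec3; apply: Ptot_M; try exact: Ptot_B;
by rewrite -[2%N]/(1 + 1)%N; apply: Ptot_M; apply: Ptot_var.
Qed.

Lemma Pvec_S1_2 r (v : 'rV[mpoly 2 R]_2) : S1_2 r v -> Pvec (r + 4) v.
Proof.
case=> p [a] [b] [hp ->].
have X i k : Ptot k (pvar i ^+ k : mpoly 2 R).
  by rewrite -[X in Ptot X]mul1n; apply: Ptot_exp; apply: Ptot_var.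
apply: Pvec_D; first apply: Pvec_D.
- by apply: Pvec_mono hp; lia.
- apply: (@Pvec_mono _ (0 + (r.+1 + 1))); first lia.
  apply: Pvec_Z; first exact: Ptot_C.
  by apply: Pvec_curl2; apply: Ptot_M => //; apply: Ptot_var.
- apply: (@Pvec_mono _ (0 + (1 + r.+1))); first lia.
  apply: Pvec_Z; first exact: Ptot_C.
  by apply: Pvec_curl2; apply: Ptot_M => //; apply: Ptot_var.
Qed.

Lemma Pvec_S1_3 r (v : 'rV[mpoly 3 R]_3) : S1_3 r v -> Pvec (r + 4) v.
Proof.
case=> p [w] [q] [hp [hw _] hq ->].
apply: Pvec_D; first apply: Pvec_D.
- by apply: Pvec_mono hp; lia.
- by apply: Pvec_mono (Pvec_Phi hw); lia.
- by apply: Pvec_mono (Pvec_pgrad (Sser_Ptot hq)); lia.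
Qed.

Lemma Pvec_S2_3 r (v : 'rV[mpoly 3 R]_3) : S2_3 r v -> Pvec (r + 4) v.
Proof.
case=> p [w] [hp [hw _] ->].
apply: Pvec_D; first by apply: Pvec_mono hp; lia.
by apply: Pvec_mono (Pvec_curl3 (Pvec_Phi hw)); lia.
Qed.

(** A crude bound common to all families and both kinds of forms; it matters only that it depends on
    [n] and [r] alone. *)
Lemma shape0_Ptot n F r (p : mpoly n R) : shape0 F r p ->
  Ptot (n * r + r + n + 10) p.
Proof.
case: F => /= [/(Ppart_Ptot (r := r))|/Sser_Ptot|/Sser_Ptot];
  [move=> /(_ (fun=> leqnn r))| |]; by apply: Ptot_mono; lia.
Qed.

Lemma shape1_Pvec n F r (v : 'rV[mpoly n R]_n) : shape1 F r v ->
  Pvec (n * r + r + n + 10) v.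
Proof.
case: n v => [|[|[|[|n]]]] v //=; case: F => /=.
- move=> hv i; apply: Ptot_mono (Ppart_Ptot (r := r) _ (hv i)); first lia.
  by move=> j; case: ifP => // _; apply: leq_pred.
- by move/Pvec_S1_2; apply: Pvec_mono; lia.
- case=> u [w] [/Pvec_S1_2 hu hw ->]; apply: Pvec_D.
    by apply: Pvec_mono hu; lia.
  apply: (@Pvec_mono _ (r.-1 + 1)); first lia.
  by apply: Pvec_Z => //; apply: Pvec_position.
- move=> hv i; apply: Ptot_mono (Ppart_Ptot (r := r) _ (hv i)); first lia.
  by move=> j; case: ifP => // _; apply: leq_pred.
- by move/Pvec_S1_3; apply: Pvec_mono; lia.
- case=> u [w] [/Pvec_S1_3 hu /Pvec_S2_3 hw ->]; apply: Pvec_D.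
    by apply: Pvec_mono hu; lia.
  apply: (@Pvec_mono _ (r.-1 + 4 + 1)); first lia.
  by apply: Pvec_pcross => //; apply: Pvec_position.
Qed.

Section Vh.
Variables (n : nat) (S : fe_space) (r : nat).
Variables (Omega : set 'rV[R]_n) (Th : seq (cube R n)) (v : pwvec R n).

Lemma Vh_degree : Vh S r Th v ->
  forall T, T \in Th -> forall i, Ptot (n * r + r + n + 10) (v T 0 i).
Proof.
case: S => F /=.
- by move=> hv T TT i; have [h _ _] := hv i; apply: shape0_Ptot (h T TT).
- by case=> h _ _ T TT; apply: shape1_Pvec (h T TT).
Qed.

Lemma vertex_cell (T : cube R n) x : 0 < T.2 -> vertex T x -> cell T x.
Proof.
move=> T0 vx i; have [b ->] := vx i; rewrite /endpoint.
by case: b; rewrite ?mul1r ?mul0r ?addr0 !lexx ?lerDl ?(ltW T0)// andbT.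
Qed.

Lemma Vh_vertex : (forall T, T \in Th -> 0 < T.2) -> Vh S r Th v ->
  forall T T', T \in Th -> T' \in Th -> forall x, vertex T x -> vertex T' x ->
  forall i, peval (v T 0 i) x = peval (v T' 0 i) x.
Proof.
move=> Th0; case: S => F /=.
- move=> hv T T' TT TT' x xT xT' i; have [_ h _] := hv i.
  by apply: h => //; apply: vertex_cell => //; apply: Th0.
- by case=> _ h _; apply: h.
Qed.

Lemma Vh0_vertex : (forall T, T \in Th -> 0 < T.2) -> Vh0 S r Omega Th v ->
  forall T, T \in Th -> forall x, vertex T x -> boundary Omega x ->
  forall i, peval (v T 0 i) x = 0.
Proof.
move=> Th0 [_]; case: S => F /=.
- move=> hv T TT x xT bx i; have [h _] := hv i T TT.
  by apply: h => //; apply: vertex_cell => //; apply: Th0.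
- by move=> hv T TT x xT bx i; have [_ h] := hv T TT; apply: h.
Qed.

End Vh.
End DegreeBounds.

(** * Geometry of cube meshes *)

Section Topology.
Variables (R : realType) (n : nat).
Implicit Types (x y : 'rV[R]_n) (i j : 'I_n) (T : cube R n).

Lemma connected_closed_cover (X : topologicalType) (A F G : set X) :
  connected A -> closed F -> closed G -> A `<=` F `|` G ->
  A `&` F !=set0 -> A `&` G !=set0 -> A `&` (F `&` G) !=set0.
Proof.
move=> cA cF cG AFG AF [g [Ag Gg]]; apply: contrapT => N.
(* If no point of [A] lies in both sets, [F] cuts out a part of [A] that is relatively closed and,
   as the complement of [G], relatively open. *)
have E : A `&` F = A.
  apply: cA => //; last by exists F.
  exists (~` G); first exact: closed_openC.
  apply/seteqP; split=> x [Ax]; last by case: (AFG x Ax).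
  by move=> Fx; split => // Gx; apply: N; exists x.
by move: (Ag); rewrite -E => -[_ Fg]; apply: N; exists g.
Qed.

Lemma open_box (A : set 'rV[R]_n) x : open A -> A x ->
  exists2 d, 0 < d & forall y, (forall i, `|y 0 i - x 0 i| < d) -> A y.
Proof.
move=> oA Ax; have /nbhs_ballP[d d0 hd] : nbhs x A by apply: open_nbhs_nbhs.
exists d => // y hy; apply: hd; split=> // i j.
by rewrite /ball /= distrC (ord1 i); apply: hy.
Qed.

Lemma closure_box (A : set 'rV[R]_n) x d : closure A x -> 0 < d ->
  exists2 y, A y & forall i, `|y 0 i - x 0 i| < d.
Proof.
move=> cA d0; have [y [Ay hy]] := cA _ (nbhsx_ballx x _ d0).
exists y => // i; have [_ /(_ 0 i)] := hy.
by rewrite /ball /= distrC.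
Qed.

Lemma closed_coord (D : set R) i : closed D -> closed [set x : 'rV[R]_n | D (x 0 i)].
Proof.
move=> cD; apply: (@preimage_closed _ _ (fun x : 'rV[R]_n => x 0 i)) => //.
by move=> x _; apply: coord_continuous.
Qed.

Lemma closed_cell T : closed (cell T).
Proof.
have -> : cell T = \bigcap_(i in [set: 'I_n])
    [set x | `[T.1 0 i, T.1 0 i + T.2]%classic (x 0 i)].
  by apply/seteqP; split=> x h i => [_|]; have := h i;
    rewrite /= ?in_itv //=; apply.
by apply: closed_bigI => i _; apply: closed_coord; apply: itv_closed.
Qed.

Lemma closed_cells (Th : seq (cube R n)) (P : cube R n -> Prop) :
  closed [set x | exists2 T, T \in Th & P T /\ cell T x].
Proof.
have -> : [set x | exists2 T, T \in Th & P T /\ cell T x] =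
    \big[setU/set0]_(T <- [seq T <- Th | `[< P T >]]) cell T.
  rewrite -bigcup_seq; apply/seteqP; split=> x [T].
    move=> TT [PT Tx]; exists T => //.
    by rewrite /= mem_filter TT andbT; apply/asboolP.
  by rewrite /= mem_filter => /andP[/asboolP PT TT] Tx; exists T.
by apply: closed_bigsetU => T _; apply: closed_cell.
Qed.

Lemma connected_upd x i (a b : R) :
  connected [set upd x i t | t in `[a, b]%classic].
Proof.
apply: connected_continuous_connected; first exact: segment_connected.
apply: continuous_subspaceT.
have -> : upd x i = fun t => upd x i 0 + t *: delta_mx 0 i.
  apply/funext => t; apply/rowP => j; rewrite !mxE eqxx /=.
  by case: eqP => _; rewrite ?mulr1 ?mulr0 ?add0r ?addr0.
move=> t; apply: cvgD; first exact: cvg_cst.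
by apply: cvgZr_tmp; apply: cvg_id.
Qed.

Lemma avoid_seq (s : seq R) (a b : R) : a < b ->
  exists2 c, a < c < b & c \notin s.
Proof.
elim: s a b => [|u s IH] a b ab.
  by exists ((a + b) / 2) => //; lra.
have [/andP[au ub]|nu] := boolP (a < u < b).
  have [c /andP[ac cu] cs] := IH a u au; exists c.
    by rewrite ac (lt_trans cu ub).
  by rewrite inE negb_or cs lt_eqF.
have [c cab cs] := IH a b ab; exists c => //.
by rewrite inE negb_or cs andbT; apply: contraNneq nu => <-.
Qed.

End Topology.

(** * All cells of a mesh lie on one lattice *)

Section Lattice.
Variables (R : realType) (n : nat).
Implicit Types (x y : 'rV[R]_n) (i j : 'I_n) (T : cube R n).

Definition aligned T T' : Prop :=
  T'.2 = T.2 /\ forall i, exists z : int, T'.1 0 i = T.1 0 i + z%:~R * T.2.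

Lemma aligned_refl T : aligned T T.
Proof. by split=> // i; exists 0; rewrite mul0r addr0. Qed.

Lemma aligned_trans T T' T'' : aligned T T' -> aligned T' T'' -> aligned T T''.
Proof.
case=> e h [e' h']; split=> [|i]; first by rewrite e' e.
have [z hz] := h i; have [z' hz'] := h' i; exists (z + z').
by rewrite hz' hz e intrD mulrDl addrA.
Qed.

Variables (Omega : set 'rV[R]_n) (Th : seq (cube R n)).
Hypotheses (n1 : (1 < n)%N) (oO : open Omega) (cO : connected Omega).
Hypothesis pos : forall T, T \in Th -> 0 < T.2.
Hypothesis cover : closure Omega = [set x | exists2 T, T \in Th & cell T x].
Hypothesis conf : conforming Th.

Definition generic x i : Prop :=
  forall T b, T \in Th -> x 0 i <> endpoint T i b.

Lemma face_free T s x i : T \in Th -> generic x i -> face T s x -> s i = None.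
Proof.
move=> TT gx [_ h]; case E : (s i) => [b|//].
by case: (gx T b TT); apply: h.
Qed.

Lemma face_upd T s x i t : face T s x -> s i = None ->
  T.1 0 i <= t <= T.1 0 i + T.2 -> face T s (upd x i t).
Proof.
move=> [Tx h] si ht; split=> [j|j b sj]; rewrite mxE; case: eqP => [ji|_].
- by rewrite ji.
- exact: Tx.
- by move: sj; rewrite ji si.
- exact: h.
Qed.

(** A point of the common face can slide along a free direction of [T] over the whole edge without
    leaving [T']. *)
Lemma face_range T T' s s' x i : T \in Th -> T' \in Th ->
  cell T `&` cell T' = face T s -> cell T `&` cell T' = face T' s' ->
  face T s x -> s i = None -> T'.1 0 i <= T.1 0 i /\ T.1 0 i + T.2 <= T'.1 0 i + T'.2.
Proof.
move=> TT TT' E E' fx si; have T0 := ltW (pos TT).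
have sub t : T.1 0 i <= t <= T.1 0 i + T.2 ->
    T'.1 0 i <= t <= T'.1 0 i + T'.2.
  move=> ht; have : (cell T `&` cell T') (upd x i t).
    by rewrite E; apply: face_upd.
  by case=> _ /(_ i); rewrite mxE eqxx.
split.
  by have /andP[] := sub (T.1 0 i) ltac:(by rewrite lexx lerDl T0).
by have /andP[] := sub (T.1 0 i + T.2) ltac:(by rewrite lexx lerDl T0).
Qed.

(** A generic coordinate cannot be fixed by a face, so the common face is free in all directions but
    [i], and there the two cells have equal ranges. Since [n > 1] there is such a direction, which
    equates the edge lengths. *)
Lemma common_point_aligned T T' x i : T \in Th -> T' \in Th ->
  cell T x -> cell T' x -> (forall j, j != i -> generic x j) -> aligned T T'.
Proof.
move=> TT TT' Tx T'x gx.
have [I0|[s [s' [E E']]]] := conf TT TT'.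
  by have : (cell T `&` cell T') x by []; rewrite I0.
have fx : face T s x by rewrite -E.
have fx' : face T' s' x by rewrite -E'.
have range j (sj : s j = None) (sj' : s' j = None) :
    T.1 0 j = T'.1 0 j /\ T.2 = T'.2.
  have [h1 h2] := face_range TT TT' E E' fx sj.
  rewrite setIC in E E'.
  have [h3 h4] := face_range TT' TT E' E fx' sj'.
  have E1 : T.1 0 j = T'.1 0 j by apply/eqP; rewrite eq_le h1 h3.
  by split=> //; move: h2 h4; rewrite E1 !lerD2l => *; apply/eqP; rewrite eq_le; apply/andP.
have other j : j != i -> T.1 0 j = T'.1 0 j /\ T.2 = T'.2.
  move=> ji; apply: range; first exact: face_free (gx j ji) fx.
  exact: face_free (gx j ji) fx'.
have [j ji] : exists j, j != i.
  have n0 : (0 < n)%N by apply: ltnW.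
  have [E0|ni] := eqVneq (i : nat) 0%N.
    by exists (Ordinal n1); rewrite -val_eqE /= E0.
  by exists (Ordinal n0); rewrite -val_eqE /= eq_sym.
have [_ e] := other j ji.
split=> // k; have [->|ki] := eqVneq k i; last first.
  by have [-> _] := other k ki; exists 0; rewrite mul0r addr0.
(* If both cells fix direction [i], the fixed endpoints agree and the shift is [b - b']; if one of
   them is free there, nested ranges of equal length coincide. *)
case si : (s i) => [b|]; case si' : (s' i) => [b'|].
- have [_ h] := fx; have [_ h'] := fx'.
  have := h i b si; rewrite (h' i b' si') /endpoint -e => H.
  exists (b%:Z - b'%:Z); rewrite intrB -!pmulrn.
  have -> : T'.1 0 i = T.1 0 i + b%:R * T.2 - b'%:R * T.2 by rewrite -H addrK.
  by ring.
- have [h1 h2] : T.1 0 i <= T'.1 0 i /\ T'.1 0 i + T'.2 <= T.1 0 i + T.2.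
    by rewrite setIC in E E'; apply: (face_range TT' TT E' E fx' si').
  exists 0; rewrite mul0r addr0; apply/eqP; rewrite eq_le h1 andbT.
  by move: h2; rewrite -e lerD2r.
- have [h1 h2] := face_range TT TT' E E' fx si.
  exists 0; rewrite mul0r addr0; apply/eqP; rewrite eq_le h1 /=.
  by move: h2; rewrite -e lerD2r.
- by have [-> _] := range i si si'; exists 0; rewrite mul0r addr0.
Qed.

Lemma in_closure x : Omega x -> exists2 T, T \in Th & cell T x.
Proof. by move=> /subset_closure; rewrite cover. Qed.

(** Otherwise the segment is covered by the closed unions of aligned and of non-aligned cells and
    meets both, so it contains a common point; the generic coordinates then force alignment. *)
Lemma upd_aligned T0 x i t1 T : T0 \in Th -> T \in Th -> aligned T0 T ->
  cell T x ->
  (forall j, j != i -> generic x j) ->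
  (forall t, Num.min (x 0 i) t1 <= t <= Num.max (x 0 i) t1 -> Omega (upd x i t)) ->
  exists2 T', T' \in Th & aligned T0 T' /\ cell T' (upd x i t1).
Proof.
move=> TT0 TT T0T Tx gx seg; apply: contrapT => N.
pose F := [set y | exists2 T, T \in Th & aligned T0 T /\ cell T y].
pose G := [set y | exists2 T, T \in Th & ~ aligned T0 T /\ cell T y].
pose a := Num.min (x 0 i) t1; pose b := Num.max (x 0 i) t1.
have segO t : a <= t <= b -> Omega (upd x i t) by exact: seg.
have [p [[t /= tab <-] [[T1 TT1 [al1 T1p]] [T2 TT2 [al2 T2p]]]]] :
    [set upd x i t | t in `[a, b]%classic] `&` (F `&` G) !=set0.
  apply: connected_closed_cover.
  - exact: connected_upd.
  - exact: closed_cells.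
  - exact: closed_cells.
  - move=> _ [t /= tab <-]; rewrite in_itv /= in tab.
    have [T' TT' T'y] := in_closure (segO t tab).
    by have [al|al] := pselect (aligned T0 T'); [left|right]; exists T'.
  - exists (upd x i (x 0 i)); split; last by rewrite upd_id; exists T.
    exists (x 0 i) => //=; rewrite in_itv /=.
    by rewrite ge_min le_max lexx.
  - exists (upd x i t1); have tab : a <= t1 <= b.
      by rewrite ge_min le_max lexx !orbT.
    split; first by exists t1 => //=; rewrite in_itv.
    have [T' TT' T'y] := in_closure (segO t1 tab).
    by exists T' => //; split=> // al; apply: N; exists T'.
apply: al2; apply: aligned_trans al1 _.
apply: (common_point_aligned (i := i) TT1 TT2 T1p T2p) => j ji T' b' TT'.
by rewrite mxE (negPf ji); apply: gx.
Qed.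

Lemma endpoints_seq i : exists s : seq R, forall T b, T \in Th ->
  endpoint T i b \in s.
Proof.
exists ([seq endpoint T i true | T <- Th] ++ [seq endpoint T i false | T <- Th]).
move=> T b TT; rewrite mem_cat; apply/orP.
by case: b; [left|right]; apply/mapP; exists T.
Qed.

Lemma generic_near T x d : T \in Th -> cell T x -> 0 < d ->
  exists y, [/\ cell T y, forall i, generic y i & forall i, `|y 0 i - x 0 i| < d].
Proof.
move=> TT Tx d0; have T0 := pos TT.
have /choice[f hf] : forall i, exists t : R,
    [/\ T.1 0 i <= t <= T.1 0 i + T.2, `|t - x 0 i| < d &
        forall T' b, T' \in Th -> t <> endpoint T' i b].
  move=> i; have [s hs] := endpoints_seq i.
  have /andP[x1 x2] := Tx i.
  have [|c /andP[c1 c2] cs] := @avoid_seq R s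
      (Num.max (T.1 0 i) (x 0 i - d)) (Num.min (T.1 0 i + T.2) (x 0 i + d)).
    by rewrite gt_max !lt_min; apply/andP; split; apply/andP; split; lra.
  exists c; move: c1 c2; rewrite gt_max lt_min => /andP[a1 a2] /andP[b1 b2].
  split; first by rewrite !ltW.
  - by rewrite ltr_distl; apply/andP; split; lra.
  - by move=> T' b TT' E; move/negP: cs; apply; rewrite E; apply: hs.
exists (\row_i f i); split=> i; rewrite ?mxE.
- by have [] := hf i.
- by move=> T' b TT'; rewrite mxE; have [_ _] := hf i; apply.
- by have [] := hf i.
Qed.

(** Connectedness of Omega only yields a point shared by an aligned and a non-aligned cell. They may
    meet in a single vertex, which relates neither their edges nor their positions; hence the detour
    through generic points in a box inside Omega. *)
Lemma mesh_aligned T0 T : T0 \in Th -> T \in Th -> aligned T0 T.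
Proof.
move=> TT0 TT; apply: contrapT => nal.
pose F := [set y | exists2 T, T \in Th & aligned T0 T /\ cell T y].
pose G := [set y | exists2 T, T \in Th & ~ aligned T0 T /\ cell T y].
have meets T1 (TT1 : T1 \in Th) : exists2 y, Omega y & cell T1 y.
  pose c : 'rV[R]_n := \row_i (T1.1 0 i + T1.2 / 2).
  have T10 := pos TT1.
  have cc : closure Omega c.
    by rewrite cover; exists T1 => // i; rewrite mxE; apply/andP; split; lra.
  have [|y Oy hy] := @closure_box _ _ Omega c (T1.2 / 2) cc; first lra.
  exists y => // i; have := hy i; rewrite mxE ltr_distl => /andP[*].
  by apply/andP; split; lra.
have [x [Ox [[T1 TT1 [al1 T1x]] [T2 TT2 [al2 T2x]]]]] : Omega `&` (F `&` G) !=set0.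
  apply: connected_closed_cover => //.
  - exact: closed_cells.
  - exact: closed_cells.
  - move=> y /in_closure[T' TT' T'y].
    by have [al|al] := pselect (aligned T0 T'); [left|right]; exists T'.
  - have [y Oy T0y] := meets _ TT0; exists y; split=> //.
    by exists T0 => //; split=> //; apply: aligned_refl.
  - by have [y Oy Ty] := meets _ TT; exists y; split=> //; exists T.
have [d d0 hd] := open_box oO Ox.
have [z [T1z gz zx]] := generic_near TT1 T1x d0.
have [y [T2y gy yx]] := generic_near TT2 T2x d0.
(* From z to y inside the box, one coordinate at a time: generic segments pass
   from cell to cell through facets only, never through smaller faces. *)
pose h k : 'rV[R]_n := \row_(i < n) if (i < k)%N then y 0 i else z 0 i.
have gh k i : generic (h k) i.
  by move=> T' b TT'; rewrite mxE; case: ifP => _; [apply: gy|apply: gz].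
have hn : h n = y by apply/rowP => i; rewrite mxE ltn_ord.
have path k : (k <= n)%N -> exists2 T', T' \in Th & aligned T0 T' /\ cell T' (h k).
  elim: k => [|k IH] kn.
    have -> : h 0%N = z by apply/rowP => i; rewrite mxE.
    by exists T1.
  have [T' TT' [al' T'h]] := IH (ltnW kn).
  pose i := Ordinal kn.
  have -> : h k.+1 = upd (h k) i (y 0 i).
    apply/rowP => j; rewrite !mxE ltnS leq_eqVlt -val_eqE /=.
    by case: eqP => // E; congr (y _ _); apply: val_inj.
  apply: (upd_aligned TT0 TT' al' T'h (fun j _ => gh k j)) => t.
  rewrite mxE /= ltnn => /andP[t1 t2]; apply: hd => j; rewrite !mxE.
  case: eqP => [->|_]; last by case: ifP.
  move: t1 t2 (zx i) (yx i); rewrite ge_min le_max !ltr_distl.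
  by move=> /orP[?|?] /orP[?|?] /andP[? ?] /andP[? ?]; apply/andP; split; lra.
have [T' TT' [al' T'y]] := path n (leqnn n); rewrite hn in T'y.
apply: al2; apply: aligned_trans al' _.
exact: (common_point_aligned (i := Ordinal n1) TT' TT2 T'y T2y (fun j _ => gy j)).
Qed.

End Lattice.

(** * Blocks of lattice cells and facets on the boundary *)

Section Blocks.
Variables (R : realType) (n : nat).
Implicit Types (x y : 'rV[R]_n) (i j : 'I_n) (T : cube R n).

Definition lattice_cell x (e : R) (z : 'I_n -> int) : cube R n :=
  (\row_i (x 0 i + (z i)%:~R * e), e).

Definition block_cell x (e : R) (k : 'I_n -> nat) : cube R n :=
  (\row_i (x 0 i + (k i)%:R * e), e).

Definition shift_cell T i (k : nat) : cube R n :=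
  (\row_j (T.1 0 j + (if j == i then k%:R * T.2 else 0)), T.2).

Lemma cube_eq T T' : T.2 = T'.2 -> (forall i, T.1 0 i = T'.1 0 i) -> T = T'.
Proof. by case: T T' => [a e] [b f] /= -> h; congr pair; apply/rowP. Qed.

Lemma shift_cell0 T i : shift_cell T i 0 = T.
Proof.
by apply: cube_eq => // j; rewrite mxE; case: eqP => _; rewrite ?mul0r addr0.
Qed.

Lemma shift_cellD T i k l : shift_cell (shift_cell T i k) i l = shift_cell T i (k + l).
Proof.
apply: cube_eq => // j; rewrite !mxE /=; case: eqP => _; last by rewrite !addr0.
by rewrite natrD mulrDl addrA.
Qed.

Lemma shift_cell_inj i k : injective (fun T => shift_cell T i k).
Proof.
move=> T T' E; have e : T.2 = T'.2 by have := congr1 snd E.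
apply: cube_eq => // j; have := congr1 (fun T : cube R n => T.1 0 j) E.
by rewrite !mxE e; move/addIr.
Qed.

Variables (Omega : set 'rV[R]_n) (Th : seq (cube R n)).
Variables (x0 : 'rV[R]_n) (e : R).
Hypotheses (e0 : 0 < e) (oO : open Omega).
Hypothesis cover : closure Omega = [set x | exists2 T, T \in Th & cell T x].
Hypothesis lattice : forall T, T \in Th -> exists z, T = lattice_cell x0 e z.

(** Some mesh cell contains [y]; it is a lattice cell, and an interior point of a lattice cell lies
    in no other one. *)
Lemma lattice_fill z y : closure Omega y ->
  (forall i, x0 0 i + (z i)%:~R * e < y 0 i < x0 0 i + ((z i)%:~R + 1) * e) ->
  lattice_cell x0 e z \in Th.
Proof.
rewrite cover => -[T TT Ty] hy; have [z' E] := lattice TT.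
suff zz i : z i = z' i.
  by move: TT; rewrite E; congr (_ \in Th); apply: cube_eq => //= i; rewrite !mxE zz.
have := Ty i; have := hy i; rewrite E /= mxE => /andP[h1 h2] /andP[h3 h4].
have l1 : (z i)%:~R < (z' i + 1)%:~R :> R.
  by rewrite -(ltr_pM2r e0) intrD mulrDl mul1r; lra.
have l2 : (z' i)%:~R < (z i + 1)%:~R :> R.
  by rewrite -(ltr_pM2r e0) intrD; lra.
by move: l1 l2; rewrite !ltr_int; lia.
Qed.

(** A block cell that sticks out of [Q] still belongs to the mesh, since its interior meets the
    closure of Omega. The last clause makes the blocks exhaust a mesh: the centre of every cell lies
    in some [Q]. *)
Lemma block_exists (Q : cube R n) : 0 < Q.2 -> cell Q `<=` closure Omega ->
  exists b m, [/\ forall i, (0 < m i)%N,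
    forall i, Q.2 <= (m i)%:R * e,
    forall k, (forall i, (k i < m i)%N) -> block_cell b e k \in Th &
    forall T, T \in Th -> cell Q (\row_i (T.1 0 i + T.2 / 2)) ->
      exists2 k, (forall i, (k i < m i)%N) & T = block_cell b e k].
Proof.
have e1 := e0; move=> Q0 QO.
(* Rounding outwards gives the smallest lattice box that contains [Q]. *)
pose lo i := Num.floor ((Q.1 0 i - x0 0 i) / e).
pose hi i := Num.ceil ((Q.1 0 i + Q.2 - x0 0 i) / e).
have lo1 i : (lo i)%:~R * e <= Q.1 0 i - x0 0 i.
  by rewrite -ler_pdivlMr//; apply: floor_le.
have lo2 i : Q.1 0 i - x0 0 i < ((lo i)%:~R + 1) * e.
  by rewrite -ltr_pdivrMr// -[1]/(1%:~R) -intrD; apply: floorD1_gt.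
have hi1 i : Q.1 0 i + Q.2 - x0 0 i <= (hi i)%:~R * e.
  by rewrite -ler_pdivrMr//; apply: ceil_ge.
have hi2 i : ((hi i)%:~R - 1) * e < Q.1 0 i + Q.2 - x0 0 i.
  by rewrite -ltr_pdivlMr// -[1]/(1%:~R) -intrB; apply: ceilB1_lt.
pose m i := `|hi i - lo i|%N.
have lohi i : lo i < hi i.
  have : (lo i)%:~R < (hi i)%:~R :> R.
    by rewrite -(ltr_pM2r e0); have := lo1 i; have := hi1 i; lra.
  by rewrite ltr_int.
have mE i : (m i)%:Z = hi i - lo i by have := lohi i; rewrite /m; lia.
have mR i : (m i)%:R = (hi i)%:~R - (lo i)%:~R :> R.
  by rewrite -intrB -mE.
pose b : 'rV[R]_n := \row_i (x0 0 i + (lo i)%:~R * e).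
have blockE k : block_cell b e k = lattice_cell x0 e (fun i => lo i + (k i)%:Z).
  by apply: cube_eq => // i; rewrite !mxE intrD mulrDl addrA.
exists b, m; split.
- by move=> i; have := lohi i; rewrite /m; lia.
- by move=> i; rewrite mR mulrBl; have := lo1 i; have := hi1 i; lra.
- move=> k km.
  (* The midpoint of the overlap of [Q] with the block cell of index [k]. *)
  pose y : 'rV[R]_n := \row_i
    ((Num.max (Q.1 0 i) (x0 0 i + ((lo i)%:~R + (k i)%:R) * e) +
      Num.min (Q.1 0 i + Q.2) (x0 0 i + ((lo i)%:~R + (k i)%:R + 1) * e)) / 2).
  have yP i : [/\ Q.1 0 i < y 0 i, y 0 i < Q.1 0 i + Q.2,
      x0 0 i + ((lo i)%:~R + (k i)%:R) * e < y 0 i &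
      y 0 i < x0 0 i + ((lo i)%:~R + (k i)%:R + 1) * e].
    have k0 : 0 <= (k i)%:R * e by rewrite mulr_ge0// ltW.
    have kh : ((lo i)%:~R + (k i)%:R) * e <= ((hi i)%:~R - 1) * e.
      rewrite ler_pM2r// -[1]/(1%:~R) -intrB -[(k i)%:R]/((k i)%:Z%:~R) -intrD.
      by rewrite ler_int; have := km i; have := mE i; lia.
    have h1 : Q.1 0 i < x0 0 i + ((lo i)%:~R + (k i)%:R + 1) * e.
      by have := lo2 i; rewrite !mulrDl; lra.
    have h2 : x0 0 i + ((lo i)%:~R + (k i)%:R) * e < Q.1 0 i + Q.2.
      by have := hi2 i; lra.
    have h3 : x0 0 i + ((lo i)%:~R + (k i)%:R) * e <
       x0 0 i + ((lo i)%:~R + (k i)%:R + 1) * e.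
      by rewrite ltrD2l ltr_pM2r// ltrDl ltr01.
    rewrite mxE; move: h1 h2 h3.
    set w := x0 0 i + _; set u := x0 0 i + _ => h1 h2 h3.
    by split; case: (leP (Q.1 0 i) u) => ?; case: (leP (Q.1 0 i + Q.2) w) => ?; lra.
  rewrite blockE; apply: (@lattice_fill _ y).
    apply: QO => i; have [h1 h2 _ _] := yP i.
    by rewrite !ltW.
  move=> i; have [_ _ h3 h4] := yP i; rewrite intrD.
  by apply/andP; split.
- move=> T TT Qc; have [z E] := lattice TT.
  have zP i : lo i <= z i < hi i.
    have := Qc i; rewrite E /= !mxE => /andP[h1 h2].
    apply/andP; split.
      rewrite -ltzD1 -(ltr_int R) -(ltr_pM2r e0) intrD mulrDl mul1r.
      by have := lo1 i; lra.
    by rewrite -(ltr_int R) -(ltr_pM2r e0); have := hi1 i; lra.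
  exists (fun i => `|z i - lo i|%N).
    by move=> i; have := zP i; have := mE i; lia.
  rewrite blockE E; apply: cube_eq => //= i; rewrite !mxE; congr (_ + _%:~R * _).
  by have := zP i; lia.
Qed.

(** If a point of the facet were interior to Omega, nearby points of Omega would lie in the interior
    of the neighbouring lattice cell, which [lattice_fill] would put into the mesh. *)
Lemma facet_boundary T i : T \in Th -> shift_cell T i 1 \notin Th ->
  facet T i true `<=` boundary Omega.
Proof.
have e1 := e0; move=> TT nT x [Tx fx]; split.
  by rewrite cover; exists T.
move=> /(@interior_subset _ _ _) Ox.
have [z E] := lattice TT; have T2 : T.2 = e by rewrite E.
have [d d0 hd] := open_box oO Ox.
have xi : x 0 i = T.1 0 i + e.
  by have := fx i true; rewrite eqxx => /(_ erefl) ->; rewrite /endpoint mul1r T2.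
have /choice[f hf] : forall j, exists t : R, `|t - x 0 j| < d /\
   (shift_cell T i 1).1 0 j < t < (shift_cell T i 1).1 0 j + e.
  move=> j; rewrite mxE; have /andP[x1 x2] := Tx j; rewrite T2 in x2.
  have [|c /andP[c1 c2] _] := @avoid_seq R [::]
      (Num.max ((shift_cell T i 1).1 0 j) (x 0 j - d)) (Num.min ((shift_cell T i 1).1 0 j + e) (x 0 j + d)).
    rewrite gt_max !lt_min mxE T2; case: eqP => [->|_]; rewrite ?xi ?mul1r;
    by apply/andP; split; apply/andP; split; lra.
  move: c1 c2; rewrite gt_max lt_min mxE => /andP[a1 a2] /andP[b1 b2].
  exists c; split; first by rewrite ltr_distl; apply/andP; split; lra.
  by rewrite a1 b1.
have Oy : Omega (\row_j f j).
  by apply: hd => j; rewrite mxE; have [] := hf j.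
move/negP: nT; apply.
have -> : shift_cell T i 1 = lattice_cell x0 e (fun j => z j + (j == i)%:Z).
  apply: cube_eq => //= j; rewrite !mxE E /= mxE intrD mulrDl addrA.
  by congr (_ + _); case: eqP; rewrite ?mul0r.
apply: (@lattice_fill _ (\row_j f j)); first exact: subset_closure.
move=> j; have [_] := hf j; rewrite !mxE E /= mxE intrD !mulrDl mul1r.
by case: eqP => _; rewrite ?mul0r ?mul1r !addrA.
Qed.

End Blocks.

(** * Korn and Poincare estimates on the mesh *)

Lemma ler_sum_subseq (R : realDomainType) (I : eqType) (s t : seq I) (F : I -> R) :
  uniq s -> {subset s <= t} -> (forall x, x \in t -> 0 <= F x) ->
  \sum_(x <- s) F x <= \sum_(x <- t) F x.
Proof.
elim: s t => [|x s IH] t /=.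
  by move=> _ _ F0; rewrite big_nil big_seq; apply: sumr_ge0.
move=> /andP[xs us] st F0.
have xt : x \in t by apply: st; rewrite inE eqxx.
rewrite big_cons [leRHS](big_rem x xt) lerD2l; apply: IH => // [y ys|y].
  have := st y; rewrite inE ys orbT => /(_ isT).
  rewrite (perm_mem (perm_to_rem xt)) inE => /predU1P[E|//].
  by rewrite -E ys in xs.
by move=> /mem_rem; apply: F0.
Qed.

(** * Averaging over two-dimensional slices *)

Section Averaging.
Variables (R : realDomainType) (n M : nat) (m : 'I_n -> nat).
Hypothesis mM : forall i, (m i <= M)%N.
Local Notation K := {ffun 'I_n -> 'I_M}.
Implicit Types (k : K) (i j : 'I_n).

(** The number of cells varies with the direction; a common bound [M] gives one index type, from
    which [inbox] cuts out the block. *)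
Definition inbox k := [forall i, k i < m i]%N.
Definition updk k i a : K := [ffun j => if j == i then a else k j].

Lemma updk_inbox k i a : inbox (updk k i a) && (k i < m i)%N =
  inbox k && (a < m i)%N.
Proof.
apply/andP/andP => -[/forallP h1 h2]; split.
- apply/forallP => j; have := h1 j; rewrite ffunE.
  by case: eqP => [->|].
- by have := h1 i; rewrite ffunE eqxx.
- apply/forallP => j; have := h1 j; rewrite ffunE.
  by case: eqP => [->|].
- exact: h1.
Qed.

Lemma sum_updk i (F : K -> R) :
  \sum_(k | inbox k) \sum_(a < M | (a < m i)%N) F (updk k i a) =
  (m i)%:R * \sum_(k | inbox k) F k.
Proof.
rewrite (pair_big_dep inbox (fun _ (a : 'I_M) => (a < m i)%N) (fun k a => F (updk k i a))) /=.
(* Exchanges the [i]-th coordinate of the index with the separate value. *)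
pose phi (u : K * 'I_M) := (updk u.1 i u.2, u.1 i).
have phiK : involutive phi.
  move=> [k a]; congr pair; rewrite /= ?ffunE ?eqxx//.
  by apply/ffunP => j; rewrite !ffunE; case: eqP => // ->.
rewrite (reindex_inj (inv_inj phiK)) /=.
transitivity (\sum_(u : K * 'I_M | inbox u.1 && (u.2 < m i)%N) F u.1).
  apply: eq_big => [[k a]|[k a] _] /=; first exact: updk_inbox.
  by congr F; apply/ffunP => j; rewrite !ffunE; case: eqP => // ->.
rewrite -(pair_big_dep inbox (fun _ (a : 'I_M) => (a < m i)%N) (fun k a => F k)) /=.
rewrite mulr_sumr; apply: eq_bigr => k _.
rewrite (big_ord_narrow (mM i)) sumr_const card_ord mulr_natl //.
Qed.

(** Summing over the slices through all points of the box counts every index [m i * m j] times on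
    both sides, so the indices need not be split into slice and remaining directions. *)
Lemma le_sum_slices i j (F H : K -> R) (c : R) :
  (0 < m i)%N -> (0 < m j)%N ->
  (forall k, inbox k ->
    \sum_(a < M | (a < m i)%N) \sum_(b < M | (b < m j)%N) F (updk (updk k i a) j b)
    <= c * \sum_(a < M | (a < m i)%N) \sum_(b < M | (b < m j)%N)
      H (updk (updk k i a) j b)) ->
  \sum_(k | inbox k) F k <= c * \sum_(k | inbox k) H k.
Proof.
move=> mi mj h.
have E (G : K -> R) : (m i)%:R * (m j)%:R * \sum_(k | inbox k) G k =
   \sum_(k | inbox k) \sum_(a < M | (a < m i)%N) \sum_(b < M | (b < m j)%N)
     G (updk (updk k i a) j b).
  rewrite -mulrA -(sum_updk j G).
  by rewrite -(sum_updk i (fun k => \sum_(b < M | (b < m j)%N) G (updk k j b))).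
have p : 0 < (m i)%:R * (m j)%:R :> R by rewrite mulr_gt0 ?ltr0n.
rewrite -(ler_pM2l p) mulrCA !E mulr_sumr.
by apply: ler_sum => k /h.
Qed.

End Averaging.

Section BlockKorn.
Variables (R : realType) (n : nat).
Implicit Types (i j : 'I_n) (T : cube R n).
Variables (Th : seq (cube R n)) (v : pwvec R n).
Hypothesis vertexP : forall T T', T \in Th -> T' \in Th -> forall x,
  vertex T x -> vertex T' x -> forall i, peval (v T 0 i) x = peval (v T' 0 i) x.

Lemma corner_vertex T s : vertex T (corner T s).
Proof. by move=> i; exists (s i); rewrite mxE. Qed.

Lemma cval_eq T T' i s s' : T \in Th -> T' \in Th -> corner T s = corner T' s' ->
  cval T (v T) i s = cval T' (v T') i s'.
Proof.
move=> TT TT' E; rewrite /cval E; apply: vertexP => //.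
  by rewrite -E; apply: corner_vertex.
exact: corner_vertex.
Qed.

Lemma sumr_sqr_ge (I J : finType) (F : I -> J -> R) (k : I) (l : J) :
  F k l ^+ 2 <= \sum_k \sum_l F k l ^+ 2.
Proof.
rewrite (bigD1 k)//= (bigD1 l)//= -addrA lerDl addr_ge0//.
  by apply: sumr_ge0 => *; apply: sqr_ge0.
by apply: sumr_ge0 => *; apply: sumr_ge0 => *; apply: sqr_ge0.
Qed.

Lemma edge_diff_le T w i s : edge_diff T w i s ^+ 2 <= rigid_defect T w.
Proof.
apply: le_trans (sumr_sqr_ge (edge_diff T w) i s) _.
by rewrite lerDl; apply: sumr_ge0 => *; apply: sumr_ge0 => *; apply: sqr_ge0.
Qed.

Lemma shear_le T w i j : (incr T w i j + incr T w j i) ^+ 2 <= rigid_defect T w.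
Proof.
apply: le_trans (sumr_sqr_ge (fun i j => incr T w i j + incr T w j i) i j) _.
by rewrite lerDr; apply: sumr_ge0 => *; apply: sumr_ge0 => *; apply: sqr_ge0.
Qed.

Lemma cval_le T w i s : cval T w i s ^+ 2 <= corner_mass T w.
Proof. exact: (sumr_sqr_ge (cval T w)). Qed.

Section Slice.
Variables (b : 'rV[R]_n) (e : R) (m : 'I_n -> nat) (k : 'I_n -> nat) (i j : 'I_n).
Hypotheses (ij : i != j) (km : forall l, (k l < m l)%N).
Hypothesis inTh : forall k, (forall l, (k l < m l)%N) -> block_cell b e k \in Th.

Definition slice_cell (a c : nat) : cube R n :=
  block_cell b e (fun l => if l == j then c else if l == i then a else k l).

Lemma slice_inTh a c : (a < m i)%N -> (c < m j)%N -> slice_cell a c \in Th.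
Proof.
move=> am cm; apply: inTh => l; case: eqP => [->//|_].
by case: eqP => [->//|_].
Qed.

(* The lattice points with index [m i] are not lower corners of cells of the
   block, whence the detour through the last cell. *)
Let slice_corner (a c : nat) : {ffun 'I_n -> bool} :=
  [ffun l => if l == j then (m j <= c)%N else (l == i) && (m i <= a)%N].

Definition slice_val (l : 'I_n) (a c : nat) : R :=
  let T := slice_cell (minn a (m i).-1) (minn c (m j).-1) in
  cval T (v T) l (slice_corner a c).

Definition corner2 (s t : bool) : {ffun 'I_n -> bool} :=
  [ffun l => if l == j then t else (l == i) && s].

(** Single-valuedness at the vertices allows a lattice value to be read off in any cell of the slice
    with that vertex. *)
Lemma slice_valE l a c (s t : bool) : (a < m i)%N -> (c < m j)%N ->
  slice_val l (a + s) (c + t) =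
  cval (slice_cell a c) (v (slice_cell a c)) l (corner2 s t).
Proof.
move=> am cm; apply: cval_eq.
- by apply: slice_inTh; have := km i; have := km j; lia.
- exact: slice_inTh.
- apply/rowP => u; rewrite !mxE /endpoint /= !mxE !ffunE -!addrA -!mulrDl -!natrD.
  congr (_ + _%:R * _); case: eqP => [_|_].
    by case: t; case: leqP => /=; lia.
  by case: eqP => [_|_] //=; case: s; case: leqP => /=; lia.
Qed.

(** An instance of [korn_grid] with [v_i] and [v_j] as the two components, restricted to lower
    corners in the remaining directions. *)
Lemma korn_slice :
  \sum_(a < m i) \sum_(c < m j)
    incr (slice_cell a c) (v (slice_cell a c)) i j ^+ 2 <=
  grid_const R * \sum_(a < m i) \sum_(c < m j)
    (rigid_defect (slice_cell a c) (v (slice_cell a c)) +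
     ((m i)%:R^-1 ^+ 2 + (m j)%:R^-1 ^+ 2) *
       corner_mass (slice_cell a c) (v (slice_cell a c))).
Proof.
have mi0 : (0 < m i)%N by apply: leq_ltn_trans (km i).
have mj0 : (0 < m j)%N by apply: leq_ltn_trans (km j).
pose K a c := rigid_defect (slice_cell a c) (v (slice_cell a c)).
pose N a c := corner_mass (slice_cell a c) (v (slice_cell a c)).
have ji : (j == i) = false by rewrite eq_sym; apply: negbTE.
have v00 l a c (am : (a < m i)%N) (cm : (c < m j)%N) :
    slice_val l a c = cval (slice_cell a c) (v (slice_cell a c)) l (corner2 false false).
  by rewrite -slice_valE// !addn0.
have v10 l a c (am : (a < m i)%N) (cm : (c < m j)%N) :
    slice_val l a.+1 c = cval (slice_cell a c) (v (slice_cell a c)) l (corner2 true false).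
  by rewrite -slice_valE// addn0 addn1.
have v01 l a c (am : (a < m i)%N) (cm : (c < m j)%N) :
    slice_val l a c.+1 = cval (slice_cell a c) (v (slice_cell a c)) l (corner2 false true).
  by rewrite -slice_valE// addn0 addn1.
have v11 l a c (am : (a < m i)%N) (cm : (c < m j)%N) :
    slice_val l a.+1 c.+1 = cval (slice_cell a c) (v (slice_cell a c)) l (corner2 true true).
  by rewrite -slice_valE// !addn1.
have sti s s' t : set_corner (corner2 s' t) i s = corner2 s t.
  apply/ffunP => u; rewrite !ffunE; case: eqP => [->|//].
  by rewrite (negbTE ij).
have stj s t t' : set_corner (corner2 s t') j t = corner2 s t.
  by apply/ffunP => u; rewrite !ffunE; case: eqP.
have c0 : corner0 n = corner2 false false.
  by apply/ffunP => u; rewrite !ffunE andbF if_same.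
have ci : corner1 i = corner2 true false by rewrite /corner1 c0 sti.
have cj : corner1 j = corner2 false true by rewrite /corner1 c0 stj.
have bnd l a c : (a < m i)%N -> (c < m j)%N -> node_bound (slice_val l) N a c.
  by move=> am cm; rewrite /node_bound v00// v10// v01// v11//; split; apply: cval_le.
have := korn_grid mi0 mj0 (p := slice_val i) (q := slice_val j) (K := K) (N := N) _
   (bnd i) (bnd j).
rewrite /vdiff_sq /gsum /node_ctl => H; apply: le_trans (H _); last first.
  move=> a c am cm; rewrite /cell_ctl !(v00 _ a c)// !(v10 _ a c)//.
  rewrite !(v01 _ a c)// !(v11 _ a c)//; split.
  - by rewrite -(sti true false false) -{2}(sti false false false); apply: edge_diff_le.
  - by rewrite -(sti true false true) -{2}(sti false false true); apply: edge_diff_le.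
  - by rewrite -(stj false true false) -{2}(stj false false false); apply: edge_diff_le.
  - by rewrite -(stj true true false) -{2}(stj true false false); apply: edge_diff_le.
  - by rewrite -c0 -ci -cj; apply: shear_le.
rewrite le_eqVlt; apply/orP; left; apply/eqP.
apply: eq_bigr => a _; apply: eq_bigr => c _.
by rewrite (v00 i a c)// (v01 i a c)// /incr c0 cj.
Qed.

End Slice.
End BlockKorn.

Lemma grid_const_ge0 (R : realFieldType) : 0 <= grid_const R.
Proof. by rewrite /grid_const mulr_ge0// addr_ge0// mulr_ge0// corner_const_ge0. Qed.

(** * From blocks to the whole mesh *)

Section MeshKorn.
Variables (R : realType) (n : nat).
Implicit Types (i j : 'I_n) (T : cube R n).
Variables (Th : seq (cube R n)) (v : pwvec R n) (e : R).
Hypothesis uTh : uniq Th.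
Hypothesis e0 : 0 < e.
Hypothesis edge : forall T, T \in Th -> T.2 = e.
Hypothesis vertexP : forall T T', T \in Th -> T' \in Th -> forall x,
  vertex T x -> vertex T' x -> forall i, peval (v T 0 i) x = peval (v T' 0 i) x.
Variables Cr Cc : R.
Hypotheses (Cr0 : 0 <= Cr) (Cc0 : 0 <= Cc).
Hypothesis rigidP : forall T, T \in Th ->
  e ^+ n * rigid_defect T (v T) <= Cr * (e ^+ 2 * cell_strain T (v T)).
Hypothesis cornerP : forall T, T \in Th ->
  e ^+ n * corner_mass T (v T) <= Cc * cell_mass T (v T).

Lemma cell_mass_ge0 T (w : 'rV[mpoly n R]_n) : 0 <= cell_mass T w.
Proof. by apply: sumr_ge0 => *; apply: L2sq_ge0. Qed.

Definition mesh_strain : R := \sum_(T <- Th) cell_strain T (v T).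
Definition mesh_mass : R := \sum_(T <- Th) cell_mass T (v T).

Variable d : R.
Hypothesis d0 : 0 < d.

(** A block has sides at least [d], so the weights [(m l)%:R^-1 ^+ 2] of the mass are at most
    [(e / d) ^+ 2]. The strain carries the same factor [e ^+ 2], and therefore the mesh size cancels
    in the end. *)
Definition korn_rhs T : R :=
  e ^+ 2 * (Cr * cell_strain T (v T) + 2 * d^-1 ^+ 2 * (Cc * cell_mass T (v T))).

Lemma korn_rhs_ge0 T : 0 <= korn_rhs T.
Proof.
rewrite mulr_ge0 ?sqr_ge0// addr_ge0//; first by rewrite mulr_ge0// cell_strain_ge0.
apply: mulr_ge0; last by rewrite mulr_ge0// cell_mass_ge0.
by apply: mulr_ge0 => //; apply: sqr_ge0.
Qed.

Definition box_cell M (b : 'rV[R]_n) (k : {ffun 'I_n -> 'I_M}) : cube R n :=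
  block_cell b e (fun l => k l).

Lemma box_cell_inj M b (k l : {ffun 'I_n -> 'I_M}) :
  box_cell b k = box_cell b l -> k = l.
Proof.
move=> E; apply/ffunP => i; apply: val_inj => /=.
have := congr1 (fun T : cube R n => T.1 0 i) E.
rewrite !mxE => /addrI /(mulIf (lt0r_neq0 e0)) /eqP.
by rewrite eqr_nat => /eqP.
Qed.

Section Block.
Variables (b : 'rV[R]_n) (m : 'I_n -> nat) (M : nat) (i j : 'I_n).
Hypothesis ij : i != j.
Hypothesis mM : forall l, (m l <= M)%N.
Hypothesis m0 : forall l, (0 < m l)%N.
Hypothesis dm : forall l, d <= (m l)%:R * e.
Hypothesis inTh : forall k, (forall l, (k l < m l)%N) -> block_cell b e k \in Th.

Lemma inv_le l : (m l)%:R^-1 <= e / d.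
Proof.
have ml : 0 < (m l)%:R :> R by rewrite ltr0n.
by rewrite ler_pdivlMr// ler_pdivrMl.
Qed.

Lemma block_rhs T : T \in Th ->
  e ^+ n * (rigid_defect T (v T) + ((m i)%:R^-1 ^+ 2 + (m j)%:R^-1 ^+ 2) *
       corner_mass T (v T)) <= korn_rhs T.
Proof.
move=> TT; rewrite mulrDr /korn_rhs [leRHS]mulrDr; apply: lerD.
  by rewrite mulrCA; apply: rigidP.
have sq l : (m l)%:R^-1 ^+ 2 <= e ^+ 2 * d^-1 ^+ 2.
  rewrite -exprMn lerXn2r ?nnegrE ?invr_ge0 ?inv_le//.
  by rewrite mulr_ge0 ?invr_ge0 ?ltW.
rewrite mulrCA [leRHS]mulrA; apply: ler_pM.
- by rewrite addr_ge0 ?sqr_ge0.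
- rewrite mulr_ge0 ?exprn_ge0 ?(ltW e0)//.
  by apply: sumr_ge0 => *; apply: sumr_ge0 => *; apply: sqr_ge0.
- by have := sq i; have := sq j; lra.
- exact: cornerP.
Qed.

Lemma korn_block :
  \sum_(k : {ffun 'I_n -> 'I_M} | inbox m k)
     e ^+ n * incr (box_cell b k) (v (box_cell b k)) i j ^+ 2 <=
  grid_const R *
  \sum_(k : {ffun 'I_n -> 'I_M} | inbox m k) korn_rhs (box_cell b k).
Proof.
pose F (k : {ffun 'I_n -> 'I_M}) :=
  e ^+ n * incr (box_cell b k) (v (box_cell b k)) i j ^+ 2.
apply: (@le_sum_slices _ _ _ _ mM i j F) => // k /forallP km.
have en : 0 <= e ^+ n by rewrite exprn_ge0// ltW.
pose kn l : nat := k l.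
rewrite !(big_ord_narrow (mM i)).
have cellE (a : 'I_(m i)) (c : 'I_(m j)) : box_cell b
   (updk (updk k i (widen_ord (mM i) a)) j (widen_ord (mM j) c)) =
   slice_cell b e kn i j a c.
  rewrite /box_cell; congr block_cell; apply/funext => l; rewrite !ffunE.
  by case: eqP => // _; case: eqP.
rewrite /F.
under eq_bigr do rewrite (big_ord_narrow (mM j)).
under eq_bigr do under eq_bigr do rewrite cellE.
under [in leRHS]eq_bigr do rewrite (big_ord_narrow (mM j)).
under [in leRHS]eq_bigr do under eq_bigr do rewrite cellE.
have := korn_slice vertexP ij (k := kn) km inTh.
move=> /(ler_wpM2l en); rewrite mulrCA !mulr_sumr => H.
apply: le_trans (le_trans H _).
  by apply: ler_sum => a _; rewrite mulr_sumr.
rewrite -!mulr_sumr ler_wpM2l ?grid_const_ge0// mulr_sumr.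
apply: ler_sum => a _; rewrite mulr_sumr; apply: ler_sum => c _.
by apply: block_rhs => //; apply: (slice_inTh (m := m)) => //; apply: km.
Qed.

Lemma sum_block_le : \sum_(k : {ffun 'I_n -> 'I_M} | inbox m k)
   korn_rhs (box_cell b k) <= \sum_(T <- Th) korn_rhs T.
Proof.
rewrite -big_filter.
rewrite -(big_map (fun k : {ffun 'I_n -> 'I_M} => box_cell b k) xpredT korn_rhs).
apply: ler_sum_subseq.
- rewrite map_inj_in_uniq ?filter_uniq ?index_enum_uniq// => k l _ _.
  exact: box_cell_inj.
- move=> T /mapP[k]; rewrite mem_filter => /andP[/forallP kb _] ->.
  exact: inTh.
- by move=> T _; apply: korn_rhs_ge0.
Qed.

End Block.

Variables (Omega : set 'rV[R]_n) (x0 : 'rV[R]_n) (Th0 : seq (cube R n)).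
Hypothesis cover : closure Omega = [set x | exists2 T, T \in Th & cell T x].
Hypothesis lattice : forall T, T \in Th -> exists z, T = lattice_cell x0 e z.
Hypothesis cover0 : closure Omega = [set x | exists2 T, T \in Th0 & cell T x].
Hypothesis dTh0 : forall Q, Q \in Th0 -> d <= Q.2.

(** Each cell is charged to a cube of the fixed mesh that contains its centre. Each block sum is at
    most the sum over the mesh, so the overlaps cost only the factor [size Th0]. *)
Lemma korn_offdiag i j : i != j ->
  \sum_(T <- Th) e ^+ n * incr T (v T) i j ^+ 2 <=
  (size Th0)%:R * grid_const R * \sum_(T <- Th) korn_rhs T.
Proof.
move=> ij; pose F T := e ^+ n * incr T (v T) i j ^+ 2.
have F0 T : 0 <= F T by rewrite mulr_ge0 ?sqr_ge0// exprn_ge0// ltW.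
pose inQ Q T := `[< cell Q (\row_l (T.1 0 l + T.2 / 2)) >].
have step Q : Q \in Th0 -> \sum_(T <- Th | inQ Q T) F T <=
    grid_const R * \sum_(T <- Th) korn_rhs T.
  move=> QQ; have Q0 : 0 < Q.2 by apply: lt_le_trans d0 (dTh0 QQ).
  have QO : cell Q `<=` closure Omega by move=> x Qx; rewrite cover0; exists Q.
  have [b [m [m0 Qm inTh block]]] := block_exists e0 cover lattice Q0 QO.
  pose M := \max_l m l.
  have mM l : (m l <= M)%N by apply: leq_bigmax.
  have dm l : d <= (m l)%:R * e by apply: le_trans (dTh0 QQ) (Qm l).
  apply: le_trans (_ : _ <= \sum_(k : {ffun 'I_n -> 'I_M} | inbox m k)
     F (box_cell b k)) _; last first.
    apply: le_trans (korn_block ij mM m0 dm inTh) _.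
    by rewrite ler_wpM2l ?grid_const_ge0//; apply: sum_block_le.
  rewrite -big_filter -[leRHS]big_filter.
  rewrite -(big_map (fun k : {ffun 'I_n -> 'I_M} => box_cell b k) xpredT F).
  apply: ler_sum_subseq => //; first exact: filter_uniq.
  move=> T; rewrite mem_filter => /andP[/asboolP cT TT].
  have [k km E] := block T TT cT.
  have kM l : (k l < M)%N by apply: leq_trans (km l) (mM l).
  apply/mapP; exists [ffun l => Ordinal (kM l)].
    rewrite mem_filter mem_index_enum andbT; apply/forallP => l.
    by rewrite ffunE /=.
  rewrite E /box_cell; congr block_cell; apply/funext => l; by rewrite ffunE.
have sumQ : \sum_(T <- Th) F T <= \sum_(Q <- Th0) \sum_(T <- Th | inQ Q T) F T.
  rewrite (exchange_big_dep xpredT)//= big_seq [leRHS]big_seq.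
  apply: ler_sum => T TT.
  have : closure Omega (\row_l (T.1 0 l + T.2 / 2)).
    rewrite cover; exists T => // l; rewrite mxE.
    by have := e0; rewrite (edge TT) => ?; apply/andP; split; lra.
  rewrite cover0 => -[Q QQ Qc].
  rewrite -big_filter.
  have QF : Q \in [seq Q' <- Th0 | inQ Q' T].
    by rewrite mem_filter QQ andbT; apply/asboolP.
  by rewrite (big_rem Q QF) /= lerDl sumr_ge0.
apply: (le_trans sumQ); rewrite -mulrA mulr_natl.
apply: le_trans (_ : _ <= \sum_(Q <- Th0) grid_const R * \sum_(T <- Th) korn_rhs T) _.
  by rewrite big_seq [leRHS]big_seq; apply: ler_sum => Q QQ; apply: step.
by rewrite big_const_seq count_predT iter_addr_0.
Qed.

End MeshKorn.

Lemma sqr_sum_le (R : realFieldType) (K : nat) (z : nat -> R) :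
  (\sum_(k < K) z k) ^+ 2 <= K%:R * \sum_(k < K) z k ^+ 2.
Proof.
elim: K => [|K IH]; first by rewrite !big_ord0 mul0r expr0n.
rewrite !big_ord_recr /= -natr1.
move: IH; set S := \sum_(k < K) z k; set Q := \sum_(k < K) _ => IH.
have [K0|K0] := posnP K.
  have S0 : S = 0 by rewrite /S K0 big_ord0.
  have Q0 : Q = 0 by rewrite /Q K0 big_ord0.
  by rewrite S0 Q0 !add0r K0 add0r mul1r.
have k0 : 0 < K%:R :> R by rewrite ltr0n.
move: (K%:R : R) k0 IH => c c0 IH.
have h : 2 * S * z K <= Q + c * z K ^+ 2.
  rewrite -(ler_pM2l c0); have := sqr_ge0 (S - c * z K); nra.
nra.
Qed.

Section MeshKornTotal.
Variables (R : realType) (n : nat).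
Implicit Types (i j : 'I_n) (T : cube R n).
Variables (Th : seq (cube R n)) (v : pwvec R n) (e : R).
Hypothesis uTh : uniq Th.
Hypothesis e0 : 0 < e.
Hypothesis edge : forall T, T \in Th -> T.2 = e.
Hypothesis vertexP : forall T T', T \in Th -> T' \in Th -> forall x,
  vertex T x -> vertex T' x -> forall i, peval (v T 0 i) x = peval (v T' 0 i) x.
Variables Cr : R.
Hypotheses (Cr0 : 0 <= Cr).
Hypothesis rigidP : forall T, T \in Th ->
  e ^+ n * rigid_defect T (v T) <= Cr * (e ^+ 2 * cell_strain T (v T)).

Section Gradient.
Variables Cc Cg d : R.
Hypotheses (Cc0 : 0 <= Cc) (Cg0 : 0 <= Cg) (d0 : 0 < d).
Hypothesis cornerP : forall T, T \in Th ->
  e ^+ n * corner_mass T (v T) <= Cc * cell_mass T (v T).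
Hypothesis gradP : forall T, T \in Th ->
  e ^+ 2 * cell_grad T (v T) <=
    Cg * (e ^+ 2 * cell_strain T (v T) + e ^+ n * incr_sq T (v T)).
Variables (Omega : set 'rV[R]_n) (x0 : 'rV[R]_n) (Th0 : seq (cube R n)).
Hypothesis cover : closure Omega = [set x | exists2 T, T \in Th & cell T x].
Hypothesis lattice : forall T, T \in Th -> exists z, T = lattice_cell x0 e z.
Hypothesis cover0 : closure Omega = [set x | exists2 T, T \in Th0 & cell T x].
Hypothesis dTh0 : forall Q, Q \in Th0 -> d <= Q.2.

Local Notation strainTh := (mesh_strain Th v).
Local Notation massTh := (mesh_mass Th v).
Local Notation rhs := (korn_rhs v e Cr Cc d).

(** [n * n] counts the entries of the discrete gradient, and the extra 1 covers the diagonal ones,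
    which are edge differences already present in [rigid_defect]. *)
Definition grad_const : R :=
  Cg * (1 + (n * n)%:R * ((size Th0)%:R * grid_const R + 1) *
    (Cr + 2 * d^-1 ^+ 2 * Cc)).

Lemma mesh_strain_ge0 : 0 <= strainTh.
Proof. by apply: sumr_ge0 => T _; apply: cell_strain_ge0. Qed.

Lemma mesh_mass_ge0 : 0 <= massTh.
Proof. by apply: sumr_ge0 => T _; apply: cell_mass_ge0. Qed.

Lemma sum_rhsE : \sum_(T <- Th) rhs T =
  e ^+ 2 * (Cr * strainTh + 2 * d^-1 ^+ 2 * (Cc * massTh)).
Proof.
rewrite -mulr_sumr; congr (_ * _); rewrite big_split /= -mulr_sumr.
by congr (_ + _); rewrite -mulr_sumr; congr (_ * _); rewrite -mulr_sumr.
Qed.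

Lemma korn_incr i j : \sum_(T <- Th) e ^+ n * incr T (v T) i j ^+ 2 <=
  ((size Th0)%:R * grid_const R + 1) * \sum_(T <- Th) rhs T.
Proof.
have rhs0 : 0 <= \sum_(T <- Th) rhs T.
  by apply: sumr_ge0 => T _; apply: korn_rhs_ge0.
rewrite mulrDl mul1r.
have [<-|ij] := eqVneq i j; last first.
  apply: le_trans (korn_offdiag uTh e0 edge vertexP Cr0 Cc0 rigidP cornerP d0
    cover lattice cover0 dTh0 ij) _.
  by rewrite lerDl.
apply: le_trans (_ : \sum_(T <- Th) rhs T <= _); last first.
  by rewrite lerDr; apply: mulr_ge0 => //; rewrite mulr_ge0// grid_const_ge0.
rewrite big_seq [leRHS]big_seq; apply: ler_sum => T TT.
apply: le_trans (_ : e ^+ n * rigid_defect T (v T) <= _).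
  rewrite ler_wpM2l ?exprn_ge0 ?(ltW e0)//.
  by rewrite incrE; apply: edge_diff_le.
apply: (le_trans (rigidP TT)); rewrite /korn_rhs [leRHS]mulrDr mulrCA lerDl.
rewrite mulr_ge0 ?sqr_ge0// mulr_ge0//; last by rewrite mulr_ge0// cell_mass_ge0.
by rewrite mulr_ge0// sqr_ge0.
Qed.

Lemma korn_mesh : \sum_(T <- Th) cell_grad T (v T) <=
  grad_const * (strainTh + massTh).
Proof.
have e2 : 0 < e ^+ 2 by rewrite exprn_gt0.
rewrite -(ler_pM2l e2) mulr_sumr.
apply: le_trans (_ : _ <= \sum_(T <- Th)
   Cg * (e ^+ 2 * cell_strain T (v T) + e ^+ n * incr_sq T (v T))) _.
  by rewrite big_seq [leRHS]big_seq; apply: ler_sum => T TT; apply: gradP.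
rewrite -mulr_sumr /grad_const -mulrA [leRHS]mulrCA ler_wpM2l//.
rewrite big_split /= -mulr_sumr -/strainTh.
set A := (size Th0)%:R * grid_const R + 1.
have A0 : 0 <= A by rewrite addr_ge0// mulr_ge0// grid_const_ge0.
have hincr : \sum_(T <- Th) e ^+ n * incr_sq T (v T) <=
    (n * n)%:R * (A * \sum_(T <- Th) rhs T).
  under eq_bigr do rewrite mulr_sumr.
  rewrite exchange_big /=.
  under eq_bigr do under eq_bigr do rewrite mulr_sumr.
  under eq_bigr do rewrite exchange_big /=.
  apply: le_trans (_ : _ <= \sum_(i < n) \sum_(j < n) A * \sum_(T <- Th) rhs T) _.
    by apply: ler_sum => i _; apply: ler_sum => j _; apply: korn_incr.
  by rewrite !sumr_const !card_ord -mulrnA -[leLHS]mulr_natl.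
apply: le_trans (lerD (lexx _) hincr) _.
rewrite sum_rhsE.
have h1 := mesh_strain_ge0; have h2 := mesh_mass_ge0.
set B := (n * n)%:R; have B0 : 0 <= B :> R by [].
have D0 : 0 <= 2 * d^-1 ^+ 2 * Cc :> R.
  by rewrite mulr_ge0// mulr_ge0// sqr_ge0.
have -> : B * (A * (e ^+ 2 * (Cr * strainTh + 2 * d^-1 ^+ 2 * (Cc * massTh)))) =
  e ^+ 2 * (B * A * (Cr * strainTh + 2 * d^-1 ^+ 2 * Cc * massTh)) by ring.
rewrite -mulrDr ler_wpM2l ?(ltW e2)//.
have BA : 0 <= B * A by rewrite mulr_ge0.
rewrite [leRHS]mulrDl [X in _ <= X + _]mul1r; apply: lerD; first by rewrite lerDl.
rewrite -[leRHS]mulrA ler_wpM2l//.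
rewrite [leRHS]mulrDl; apply: lerD; first by rewrite ler_wpM2l// lerDl.
by rewrite ler_wpM2l// lerDr.
Qed.

End Gradient.

(** * Poincare estimate along columns of cells *)

Section Poincare.
Variables (M : R) (Omega : set 'rV[R]_n).
Hypothesis cover : closure Omega = [set x | exists2 T, T \in Th & cell T x].
Hypothesis bounded : forall x, Omega x -> forall i, `|x 0 i| <= M.

Lemma closure_bounded x i : closure Omega x -> `|x 0 i| <= M.
Proof.
move=> cx.
have cl : closed [set y : 'rV[R]_n | `[- M, M]%classic (y 0 i)].
  by apply: closed_coord; apply: itv_closed.
have : [set y : 'rV[R]_n | `[- M, M]%classic (y 0 i)] x.
  rewrite ((closure_id _).1 cl); apply: closure_subset cx => y /bounded/(_ i).
  by rewrite /= in_itv /= ler_norml.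
by rewrite /= in_itv /= ler_norml.
Qed.

Lemma shift_length T i k : T \in Th -> shift_cell T i k \in Th -> (k.+1)%:R * e <= 2 * M.
Proof.
move=> TT ST; have T2 := edge TT.
have in_cl S x : S \in Th -> cell S x -> closure Omega x.
  by move=> SS Sx; rewrite cover; exists S.
have h1 : closure Omega T.1.
  by apply: (in_cl T) => // j; rewrite T2 lexx lerDl ltW.
have h2 : closure Omega (\row_j ((shift_cell T i k).1 0 j + e)).
  apply: (in_cl (shift_cell T i k)) => // j.
  by rewrite [X in _ <= X <= _]mxE (edge ST) lexx andbT lerDl ltW.
have := closure_bounded i h1; have := closure_bounded i h2.
rewrite !mxE eqxx T2 !ler_norml -natr1 mulrDl mul1r => /andP[_ a] /andP[b _].
lra.
Qed.

(** A cell and its [k]-th shift together span [k.+1] edges within the width [2 * M]; truncation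
    makes [steps] shifts too many for every cell. *)
Definition steps : nat := Num.truncn (2 * M / e).

Lemma M_ge0 T i : T \in Th -> 0 <= 2 * M.
Proof.
move=> TT; have ST : shift_cell T i 0 \in Th by rewrite shift_cell0.
by apply: le_trans (shift_length TT ST); rewrite mulr_ge0// ltW.
Qed.

Lemma shift_steps T i : T \in Th -> shift_cell T i steps \notin Th.
Proof.
move=> TT; apply/negP => ST; have := shift_length TT ST.
rewrite leNgt -ltr_pdivrMr// => /negP; apply.
by apply: truncnS_gt.
Qed.

Lemma steps_le T i : T \in Th -> steps%:R * e <= 2 * M.
Proof.
move=> TT; rewrite -ler_pdivlMr//; rewrite truncn_le.
by rewrite divr_ge0 ?(M_ge0 i TT)// ltW.
Qed.

Lemma shift_value T i (s : {ffun 'I_n -> bool}) : s i -> T \in Th ->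
  shift_cell T i 1 \in Th ->
  cval T (v T) i s = cval (shift_cell T i 1) (v (shift_cell T i 1)) i (set_corner s i false).
Proof.
move=> si TT ST; apply: (cval_eq vertexP) => //.
apply/rowP => j; rewrite !mxE /endpoint /= !mxE !ffunE.
by case: eqP => [->|_]; rewrite ?si ?mul0r ?addr0.
Qed.

Section Column.
Variables (i : 'I_n) (s : {ffun 'I_n -> bool}).
Hypothesis si : s i.

Let g T : R := cval T (v T) i s.
Let dlt T : R := edge_diff T (v T) i s.

Lemma set_corner_id : set_corner s i true = s.
Proof. by apply/ffunP => j; rewrite ffunE; case: eqP => // ->. Qed.

(** The value on [T] is that on the next cell minus the difference across the next cell; the term
    [|dlt T|] on the left makes the induction carry this difference. The walk stops at the first
    exit [L], while the column may enter the mesh again, so indices outside the mesh contribute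
    0. *)
Lemma column_walk K T : T \in Th -> shift_cell T i K \notin Th ->
  exists2 L, (L < K)%N & [/\ shift_cell T i L \in Th, shift_cell T i L.+1 \notin Th &
    `|g T| + `|dlt T| <= `|g (shift_cell T i L)| +
      \sum_(k < K) if shift_cell T i k \in Th then `|dlt (shift_cell T i k)| else 0].
Proof.
elim: K T => [|K IH] T TT; first by rewrite shift_cell0 TT.
move=> SK; have [ST|ST] := boolP (shift_cell T i 1 \in Th); last first.
  exists 0%N => //; split=> //; first by rewrite shift_cell0.
  rewrite shift_cell0 lerD2l big_ord_recl /= shift_cell0 TT lerDl.
  by apply: sumr_ge0 => k _; case: ifP.
have [|L LK [h1 h2 h3]] := IH _ ST; first by rewrite shift_cellD add1n.
exists L.+1 => //; move: h1 h2 h3; rewrite !shift_cellD !add1n => h1 h2 h3.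
split=> //; rewrite big_ord_recl /= shift_cell0 TT addrCA.
rewrite [leLHS]addrC lerD2l; apply: le_trans (_ : `|g (shift_cell T i 1)| + `|dlt (shift_cell T i 1)| <= _).
  have -> : g T = g (shift_cell T i 1) - dlt (shift_cell T i 1).
    rewrite /g (shift_value si TT ST) /dlt /edge_diff set_corner_id.
    by ring.
  exact: ler_normB.
apply: (le_trans h3); rewrite lerD2l; apply: ler_sum => k _.
by rewrite shift_cellD add1n.
Qed.

Lemma sum_shift_le (F : cube R n -> R) k : (forall T, 0 <= F T) ->
  \sum_(T <- Th) (if shift_cell T i k \in Th then F (shift_cell T i k) else 0) <=
  \sum_(T <- Th) F T.
Proof.
move=> F0; rewrite -big_mkcond /= -big_filter.
rewrite -(big_map (fun T => shift_cell T i k) xpredT F).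
apply: ler_sum_subseq => //.
  by rewrite map_inj_uniq ?filter_uniq//; apply: shift_cell_inj.
by move=> T /mapP[T']; rewrite mem_filter => /andP[ST _] ->.
Qed.

(** Cauchy-Schwarz along each walk gives one factor [steps]. Shifts are injective, so summing over
    the starting cells first gives [steps] copies of a sum over the mesh. *)
Lemma column_poincare : \sum_(T <- Th) g T ^+ 2 <=
  2 * steps%:R * \sum_(T <- Th | shift_cell T i 1 \notin Th) g T ^+ 2 +
  2 * steps%:R ^+ 2 * \sum_(T <- Th) dlt T ^+ 2.
Proof.
pose G T := if shift_cell T i 1 \notin Th then g T ^+ 2 else 0.
have G0 T : 0 <= G T by rewrite /G; case: ifP => // _; apply: sqr_ge0.
pose N := steps.
have cell T : T \in Th -> g T ^+ 2 <=
   2 * \sum_(k < N) (if shift_cell T i k \in Th then G (shift_cell T i k) else 0) +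
   2 * N%:R * \sum_(k < N) (if shift_cell T i k \in Th then dlt (shift_cell T i k) ^+ 2 else 0).
  move=> TT; have [L LN [h1 h2 h3]] := column_walk TT (shift_steps i TT).
  pose y k := if shift_cell T i k \in Th then `|dlt (shift_cell T i k)| else 0.
  have hg : `|g T| <= `|g (shift_cell T i L)| + \sum_(k < N) y k.
    by apply: le_trans h3; rewrite lerDl.
  have sum0 : 0 <= \sum_(k < N) y k.
    by apply: sumr_ge0 => k _; rewrite /y; case: ifP.
  have sq : g T ^+ 2 <= 2 * (g (shift_cell T i L) ^+ 2 + (\sum_(k < N) y k) ^+ 2).
    rewrite -(real_normK (num_real (g T))) -(real_normK (num_real (g (shift_cell T i L)))).
    apply: le_trans (sqrD_le2 _ _); rewrite lerXn2r ?nnegrE//.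
    by rewrite addr_ge0.
  apply: (le_trans sq); rewrite mulrDr; apply: lerD.
    rewrite ler_wpM2l// (bigD1 (Ordinal LN))//= h1 /G shift_cellD addn1 h2.
    by rewrite lerDl; apply: sumr_ge0 => k _; case: ifP => // _; apply: G0.
  rewrite -mulrA ler_wpM2l//; apply: le_trans (sqr_sum_le _ _) _.
  rewrite ler_wpM2l//; apply: ler_sum => k _; rewrite /y.
  case: ifP => _; last by rewrite expr0n.
  by rewrite real_normK ?num_real.
rewrite big_seq; apply: le_trans (ler_sum _ cell) _; rewrite -big_seq.
rewrite big_split /= -!mulr_sumr; apply: lerD.
  rewrite -mulrA ler_wpM2l// exchange_big /= [X in _ <= _ * X]big_mkcond /=.
  apply: le_trans (_ : _ <= \sum_(k < N) \sum_(T <- Th) G T) _.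
    by apply: ler_sum => k _; apply: sum_shift_le.
  by rewrite sumr_const card_ord mulr_natl.
rewrite expr2 -!mulrA ler_wpM2l// ler_wpM2l// exchange_big /=.
apply: le_trans (_ : _ <= \sum_(k < N) \sum_(T <- Th) dlt T ^+ 2) _.
  apply: ler_sum => k _; apply: (@sum_shift_le (fun T => dlt T ^+ 2)) => T.
  exact: sqr_ge0.
by rewrite sumr_const card_ord mulr_natl.
Qed.

End Column.

(** The corner values at which walks end: a missing neighbour in direction [i] puts the upper facet
    on the boundary, by [facet_boundary]. *)
Definition exit_mass : R := \sum_i \sum_(T <- Th | shift_cell T i 1 \notin Th)
  e ^+ n * \sum_(s : {ffun 'I_n -> bool} | s i) cval T (v T) i s ^+ 2.

Lemma mesh_poincare : \sum_(T <- Th) e ^+ n * normal_mass T (v T) <=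
  2 * steps%:R * exit_mass +
  2 * steps%:R ^+ 2 * (Cr * (e ^+ 2 * mesh_strain Th v)).
Proof.
have en : 0 <= e ^+ n by rewrite exprn_ge0// ltW.
have E : \sum_(T <- Th) e ^+ n * normal_mass T (v T) =
   e ^+ n * \sum_i \sum_(s : {ffun 'I_n -> bool} | s i)
     \sum_(T <- Th) cval T (v T) i s ^+ 2.
  rewrite -mulr_sumr; congr (_ * _); rewrite exchange_big /=.
  by apply: eq_bigr => i _; rewrite exchange_big.
have rig : e ^+ n * \sum_(T <- Th) rigid_defect T (v T) <=
    Cr * (e ^+ 2 * mesh_strain Th v).
  rewrite mulr_sumr [X in _ <= _ * X]mulr_sumr mulr_sumr.
  by rewrite big_seq [leRHS]big_seq; apply: ler_sum => T TT; apply: rigidP.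
apply: le_trans (_ : _ <= 2 * steps%:R * exit_mass +
   2 * steps%:R ^+ 2 * (e ^+ n * \sum_(T <- Th) rigid_defect T (v T))) _; last first.
  by rewrite lerD2l ler_wpM2l// mulr_ge0// sqr_ge0.
rewrite E.
have exE : exit_mass = e ^+ n * \sum_i \sum_(s : {ffun 'I_n -> bool} | s i)
    \sum_(T <- Th | shift_cell T i 1 \notin Th) cval T (v T) i s ^+ 2.
  rewrite /exit_mass mulr_sumr; apply: eq_bigr => i _.
  by rewrite -mulr_sumr exchange_big.
rewrite exE [X in _ <= X + _]mulrCA [X in _ <= _ + X]mulrCA -mulrDr ler_wpM2l//.
apply: le_trans (_ : _ <= \sum_i \sum_(s : {ffun 'I_n -> bool} | s i)
   (2 * steps%:R * \sum_(T <- Th | shift_cell T i 1 \notin Th) cval T (v T) i s ^+ 2 +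
    2 * steps%:R ^+ 2 * \sum_(T <- Th) edge_diff T (v T) i s ^+ 2)) _.
  by apply: ler_sum => i _; apply: ler_sum => s si; apply: column_poincare.
under eq_bigr do rewrite big_split /= -!mulr_sumr.
rewrite big_split /= -!mulr_sumr lerD2l ler_wpM2l//.
apply: le_trans (_ : _ <= \sum_(T <- Th) \sum_i
   \sum_(s : {ffun 'I_n -> bool} | s i) edge_diff T (v T) i s ^+ 2) _.
  rewrite [leRHS]exchange_big /=; apply: ler_sum => i _.
  by rewrite [leRHS]exchange_big.
apply: ler_sum => T _.
apply: le_trans (_ : _ <= \sum_i \sum_s edge_diff T (v T) i s ^+ 2) _.
  apply: ler_sum => i _; rewrite [leRHS](bigID (fun s : {ffun 'I_n -> bool} => s i)) /=.
  by rewrite lerDl; apply: sumr_ge0 => *; apply: sqr_ge0.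
by rewrite lerDl; apply: sumr_ge0 => *; apply: sumr_ge0 => *; apply: sqr_ge0.
Qed.

End Poincare.
End MeshKornTotal.

(** * Assembly of the three inequalities *)

Section Main.
Variables (R : realType) (n : nat).
Hypothesis n1 : (1 < n)%N.
Variable Omega : set 'rV[R]_n.
Hypothesis hOmega : polyhedral_domain Omega.

Lemma domain_open : open Omega.
Proof. by case: hOmega => _ _ _ [Ps ->]; apply: open_interior. Qed.

Lemma mesh_lattice h Th : cube_mesh Omega h Th -> exists e x0,
  [/\ 0 < e, forall T, T \in Th -> T.2 = e &
      forall T, T \in Th -> exists z, T = lattice_cell x0 e z].
Proof.
case=> _ pos cover conf _; have [[x Ox] cO _ _] := hOmega.
have [T0 TT0 _] : [set x | exists2 T, T \in Th & cell T x] x.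
  by rewrite -cover; apply: subset_closure.
have al T := mesh_aligned n1 domain_open cO pos cover conf TT0 (T := T).
exists T0.2, T0.1; split; first exact: pos.
- by move=> T /al[].
- move=> T /al[E /choice[z hz]]; exists z.
  by apply: cube_eq => // i; rewrite mxE hz.
Qed.

Lemma norm1h_sqE (Th : seq (cube R n)) (v : pwvec R n) : norm1h_sq Th v =
  mesh_mass Th v + \sum_(T <- Th) cell_grad T (v T).
Proof.
rewrite -big_split; apply: eq_bigr => T _.
by rewrite -big_split; apply: eq_bigr.
Qed.

(** Of all boundary terms only the component [j] on upper facets orthogonal to [e_j] is kept; the
    others are nonnegative. *)
Lemma boundary_sq_ge (Th : seq (cube R n)) (v : pwvec R n) (P : cube R n -> 'I_n -> bool) :
  (forall T i, T \in Th -> P T i -> facet T i true `<=` boundary Omega) ->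
  \sum_i \sum_(T <- Th | P T i) facet_int T i true (fun x => peval (v T 0 i) x ^+ 2)
  <= boundary_sq Omega Th v.
Proof.
move=> PB; apply: ler_sum => j _; rewrite big_mkcond /= big_seq [leRHS]big_seq.
apply: ler_sum => T TT.
have f0 i b : 0 <= facet_int T i b (fun x => peval (v T 0 j) x ^+ 2).
  by apply: iterint_ge0 => y; apply: sqr_ge0.
case: ifP => [Pj|_]; last by apply: sumr_ge0 => i _; apply: sumr_ge0.
rewrite (bigD1 j)//= (bigD1 true)/=; last by apply/asboolP; apply: PB.
rewrite -addrA lerDl addr_ge0//; first exact: sumr_ge0.
by apply: sumr_ge0 => i _; apply: sumr_ge0.
Qed.

Lemma facet_corner (T : cube R n) i (s : {ffun 'I_n -> bool}) : 0 < T.2 -> s i ->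
  facet T i true (corner T s).
Proof.
move=> T0 si; split; first by apply: vertex_cell => //; apply: corner_vertex.
by move=> j b; case: eqP => // -> [<-]; rewrite mxE si.
Qed.

Lemma korn_main (S : fe_space) (r : nat) h0 Th0 : cube_mesh Omega h0 Th0 ->
  exists2 C : R, 0 < C &
    forall (h : R) (Th : seq (cube R n)), cube_mesh Omega h Th ->
      [/\ forall v, Vh S r Th v ->
            norm1h_sq Th v <= C * (strain_sq Th v + norm0_sq Th v),
          forall v, Vh S r Th v ->
            norm1h_sq Th v <= C * (strain_sq Th v + boundary_sq Omega Th v) &
          forall v, Vh0 S r Omega Th v ->
            norm1h_sq Th v <= C * strain_sq Th v].
Proof.
(* The edge length [d] and the number of cubes of the fixed mesh, together with [M], are all that
   the constants retain of Omega. *)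
move=> mesh0; have [d [x1 [d0 edge0 _]]] := mesh_lattice mesh0.
have [_ _ cover0 _ _] := mesh0.
have [[x Ox] cO [M hM] _] := hOmega.
have M0 : 0 <= M by apply: le_trans (hM x Ox (Ordinal n1)).
pose D := (n * r + r + n + 10)%N.
have [Cr Cr0 hr] := rigid_bound R n D.
have [Cg Cg0 hg] := grad_bound R n D.
have [Cm Cm0 hm] := mass_bound R n D.
have [Cc Cc0 hc] := corner_bound R n D.
have [Cf Cf0 hf] := facet_bound R n D.
pose G := grad_const Cr Cc Cg d Th0.
have G0 : 0 <= G.
  rewrite mulr_ge0// addr_ge0// mulr_ge0//.
    by rewrite mulr_ge0// addr_ge0// mulr_ge0// grid_const_ge0.
  by rewrite addr_ge0// mulr_ge0// mulr_ge0// sqr_ge0.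
(* From [mass_bound] and [mesh_poincare]: both [e] and [steps * e] are at most [2 * M]. Their
   squares give [A]; [B] comes from [2 * steps * (Cf * e)]. *)
pose A := Cm * (4 * M ^+ 2 * (1 + 2 * Cr)).
pose B := Cm * (4 * M * Cf).
have A0 : 0 <= A.
  by rewrite mulr_ge0// mulr_ge0 ?addr_ge0 ?mulr_ge0 ?sqr_ge0.
have B0 : 0 <= B by rewrite mulr_ge0// mulr_ge0// mulr_ge0.
exists ((1 + G) * (1 + A + B)).
  by rewrite mulr_gt0 ?ltr_wpDr// addr_gt0// ltr_wpDr.
move=> h Th mesh.
have [e [x0 [e0 edge lat]]] := mesh_lattice mesh.
have [uTh pos cover _ _] := mesh.
have key v : Vh S r Th v ->
  norm1h_sq Th v <= (1 + G) * (strain_sq Th v + norm0_sq Th v) /\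
  norm0_sq Th v <= A * strain_sq Th v +
    Cm * (2 * (steps e M)%:R * exit_mass Th v e).
  move=> hv.
  have deg T (TT : T \in Th) : forall i, Ptot D (v T 0 i) by move=> i; apply: (Vh_degree hv TT).
  have vP := Vh_vertex pos hv.
  have rigidP T : T \in Th ->
      e ^+ n * rigid_defect T (v T) <= Cr * (e ^+ 2 * cell_strain T (v T)).
    by move=> TT; rewrite -(edge _ TT); apply: hr; [apply: pos|apply: deg].
  have cornerP T : T \in Th -> e ^+ n * corner_mass T (v T) <= Cc * cell_mass T (v T).
    by move=> TT; rewrite -(edge _ TT); apply: hc; [apply: pos|apply: deg].
  have gradP T : T \in Th -> e ^+ 2 * cell_grad T (v T) <=
      Cg * (e ^+ 2 * cell_strain T (v T) + e ^+ n * incr_sq T (v T)).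
    by move=> TT; rewrite -(edge _ TT); apply: hg; [apply: pos|apply: deg].
  have s0 : 0 <= mesh_strain Th v by apply: mesh_strain_ge0.
  have m0 : 0 <= mesh_mass Th v by apply: mesh_mass_ge0.
  split.
    rewrite norm1h_sqE -/(mesh_mass Th v) -/(mesh_strain Th v).
    have K := korn_mesh uTh e0 edge vP Cr0 rigidP Cc0 Cg0 d0 cornerP gradP
      cover lat cover0 (fun Q QQ => eq_ind_r (fun t => d <= t) (lexx d) (edge0 Q QQ)).
    rewrite [leRHS]mulrDl mul1r; apply: lerD => //.
    by rewrite lerDr.
  have P := mesh_poincare uTh e0 edge vP rigidP cover hM.
  have massP : mesh_mass Th v <= Cm * (e ^+ 2 * mesh_strain Th v +
      \sum_(T <- Th) e ^+ n * normal_mass T (v T)).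
    rewrite mulr_sumr -big_split /= mulr_sumr /mesh_mass big_seq [leRHS]big_seq.
    apply: ler_sum => T TT; rewrite -(edge _ TT).
    by apply: hm; [apply: pos|apply: deg].
  apply: (le_trans massP); rewrite /A -[X in _ <= X + _]mulrA -mulrDr ler_wpM2l//.
  have [T0 TT0 _] : [set x | exists2 T, T \in Th & cell T x] x.
    by rewrite -cover; apply: subset_closure.
  have eM : e <= 2 * M.
    have ST : shift_cell T0 (Ordinal n1) 0 \in Th by rewrite shift_cell0.
    by have := shift_length e0 edge cover hM TT0 ST; rewrite mul1r.
  have NM : (steps e M)%:R * e <= 2 * M.
    by have := steps_le e0 edge cover hM (Ordinal n1) TT0; apply.
  have e2 : e ^+ 2 <= 4 * M ^+ 2.
    have -> : 4 * M ^+ 2 = (2 * M) ^+ 2 by ring.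
    by rewrite lerXn2r ?nnegrE ?mulr_ge0// ltW.
  have N2 : (steps e M)%:R ^+ 2 * e ^+ 2 <= 4 * M ^+ 2.
    have -> : 4 * M ^+ 2 = (2 * M) ^+ 2 by ring.
    by rewrite -exprMn lerXn2r ?nnegrE ?mulr_ge0// ltW.
  apply: (le_trans (lerD (lexx _) P)).
  rewrite -/(mesh_strain Th v).
  have -> : 2 * (steps e M)%:R ^+ 2 * (Cr * (e ^+ 2 * mesh_strain Th v)) =
    (steps e M)%:R ^+ 2 * e ^+ 2 * (2 * Cr * mesh_strain Th v) by ring.
  have h1 := ler_wpM2r s0 e2.
  have c0 : 0 <= 2 * Cr * mesh_strain Th v by rewrite mulr_ge0// mulr_ge0.
  have h2 := ler_wpM2r c0 N2.
  apply: le_trans (lerD h1 (lerD (lexx _) h2)) _.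
  rewrite -[strain_sq Th v]/(mesh_strain Th v) le_eqVlt; apply/orP; left.
  by apply/eqP; ring.
have s0 v : 0 <= strain_sq Th v by apply: (mesh_strain_ge0 Th v).
have b0 v : 0 <= boundary_sq Omega Th v.
  apply: sumr_ge0 => j _; apply: sumr_ge0 => T _; apply: sumr_ge0 => i _.
  by apply: sumr_ge0 => b _; apply: iterint_ge0 => y; apply: sqr_ge0.
(* [Z] is the boundary term in the second inequality and 0 in the third. *)
have fin v Z : norm1h_sq Th v <= (1 + G) * (strain_sq Th v + norm0_sq Th v) ->
    0 <= Z -> norm0_sq Th v <= A * strain_sq Th v + B * Z ->
    norm1h_sq Th v <= (1 + G) * (1 + A + B) * (strain_sq Th v + Z).
  move=> h1 Z0 h2; apply: (le_trans h1); rewrite -mulrA ler_wpM2l ?addr_ge0//.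
  have h3 := mulr_ge0 A0 Z0; have h4 := mulr_ge0 B0 (s0 v).
  have -> : (1 + A + B) * (strain_sq Th v + Z) = strain_sq Th v +
    (A * strain_sq Th v + B * Z) + (Z + A * Z + B * strain_sq Th v) by ring.
  apply: le_trans (lerD (lexx _) h2) _.
  by rewrite lerDl !addr_ge0.
split=> v hv.
- have [h1 _] := key v hv; apply: (le_trans h1).
  have m0 : 0 <= norm0_sq Th v by apply: (mesh_mass_ge0 Th v).
  rewrite -mulrA ler_wpM2l ?addr_ge0//.
  by rewrite ler_peMl ?addr_ge0// -addrA lerDl addr_ge0.
- have [h1 h2] := key v hv; apply: (fin v _ h1 (b0 v)); apply: (le_trans h2).
  rewrite lerD2l /B -[leRHS]mulrA ler_wpM2l//.
  have deg T (TT : T \in Th) : forall i, Ptot D (v T 0 i) by move=> i; apply: (Vh_degree hv TT).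
  have ex : exit_mass Th v e <= Cf * (e * boundary_sq Omega Th v).
    have bd := @boundary_sq_ge Th v (fun T i => shift_cell T i 1 \notin Th).
    have /bd{}bd : forall T i, T \in Th -> shift_cell T i 1 \notin Th ->
        facet T i true `<=` boundary Omega.
      by move=> T i TT; apply: (facet_boundary e0 domain_open cover lat).
    apply: le_trans (_ : Cf * (e * \sum_i \sum_(T <- Th | shift_cell T i 1 \notin Th)
        facet_int T i true (fun x => peval (v T 0 i) x ^+ 2)) <= _); last first.
      by rewrite ler_wpM2l// ler_wpM2l// ltW.
    rewrite mulr_sumr mulr_sumr; apply: ler_sum => i _.
    rewrite mulr_sumr mulr_sumr big_seq_cond [leRHS]big_seq_cond.
    apply: ler_sum => T /andP[TT _]; rewrite -(edge _ TT).
    by apply: hf; [apply: pos|apply: deg].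
  have [T0 TT0 _] : [set x | exists2 T, T \in Th & cell T x] x.
    by rewrite -cover; apply: subset_closure.
  have NM : (steps e M)%:R * e <= 2 * M.
    by have := steps_le e0 edge cover hM (Ordinal n1) TT0; apply.
  have N0 : 0 <= 2 * (steps e M)%:R :> R by rewrite mulr_ge0.
  apply: (le_trans (ler_wpM2l N0 ex)).
  have cb : 0 <= 2 * Cf * boundary_sq Omega Th v by rewrite mulr_ge0// mulr_ge0.
  have := ler_wpM2r cb NM.
  have -> : (steps e M)%:R * e * (2 * Cf * boundary_sq Omega Th v) =
    2 * (steps e M)%:R * (Cf * (e * boundary_sq Omega Th v)) by ring.
  by have -> : 2 * M * (2 * Cf * boundary_sq Omega Th v) =
    4 * M * Cf * boundary_sq Omega Th v by ring.
- have [hv' _] := hv; have [h1 h2] := key v hv'.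
  rewrite -[strain_sq Th v]addr0; apply: (fin v 0 h1 (lexx _)).
  apply: (le_trans h2); rewrite lerD2l mulr0.
  (* Every corner in [exit_mass] is a boundary vertex, where the vanishing degrees of freedom give
     the value 0 for both kinds of spaces. *)
  have -> : exit_mass Th v e = 0; last by rewrite !mulr0.
  apply: big1 => i _; rewrite big_seq_cond; apply: big1 => T /andP[TT ST].
  rewrite big1 ?mulr0// => s si.
  have fb := facet_boundary e0 domain_open cover lat TT ST.
  rewrite /cval (Vh0_vertex pos hv TT) ?expr0n//; first exact: corner_vertex.
  by apply/fb/facet_corner => //; apply: pos.
Qed.

End Main.

Theorem theorem2 (R : realType) (n : nat) (hn : n = 2%N \/ n = 3%N)
    (Omega : set 'rV[R]_n) (hOmega : polyhedral_domain Omega)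
    (S : fe_space) (r : nat) (hr : (min_degree S <= r)%N) :
  exists2 C : R, 0 < C &
    forall (h : R) (Th : seq (cube R n)), cube_mesh Omega h Th ->
      [/\ forall v, Vh S r Th v ->
            norm1h_sq Th v <= C * (strain_sq Th v + norm0_sq Th v),
          forall v, Vh S r Th v ->
            norm1h_sq Th v <= C * (strain_sq Th v + boundary_sq Omega Th v) &
          forall v, Vh0 S r Omega Th v ->
            norm1h_sq Th v <= C * strain_sq Th v].
Proof.
have n1 : (1 < n)%N by case: hn => ->.
(* Any existing mesh can serve as the fixed one; if there is none, the claim is vacuous. *)
have [[h0 [Th0 mesh0]]|none] := pselect (exists h Th, cube_mesh Omega h Th).
  exact: (korn_main n1 hOmega _ _ mesh0).
by exists 1 => // h Th mesh; case: none; exists h, Th.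
Qed.
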